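(* Let the downlink (DL) satellite network share spectrum with the uplink (UL) terrestrial network. For $R_{\min}^{\mathrm{s|u_s}}\le r\le R_{\max}^{\mathrm{s|u_s}}$ and $\|\mathbf x_1-\mathbf u_1^{\mathrm s}\|=r$, define the aggregated interference plus noise power $$I_{\mathrm{dn}}^{\mathrm{up}}(r)=\sum_{\mathbf x_n\in\Phi_{\mathrm s}\cap(\mathcal A_{\mathrm{s|u_s}}\setminus\mathcal A_{\mathrm{s|u_s}}(r))}G_n^{\mathrm{s|u_s}}P_{\mathrm s}H_n^{\mathrm s}\|\mathbf x_n-\mathbf u_1^{\mathrm s}\|^{-\alpha_{\mathrm s}}+\sum_{\mathbf u_k^{\mathrm t}\in\Phi_{\mathrm{u_t}}\cap\mathcal A_{\mathrm{u_t|u_s}}}G^{\mathrm{u_t|u_s}}P_{\mathrm{u_t}}H_k^{\mathrm t}\|\mathbf u_k^{\mathrm t}-\mathbf u_1^{\mathrm s}\|^{-\alpha_{\mathrm t}}+\sigma^2 .$$ Then, for $s\ge0$, its conditional Laplace transform $\mathbb E\bigl[e^{-sI_{\mathrm{dn}}^{\mathrm{up}}(r)}\,\big|\,\|\mathbf x_1-\mathbf u_1^{\mathrm s}\|=r,\ \Phi_{\mathrm s}(\mathcal A_{\mathrm{s|u_s}})\ge1\bigr]$ equals $$\exp\Biggl(-s\sigma^2-2\pi\tilde\lambda_{\mathrm{s|u_s}}\int_r^{R_{\max}^{\mathrm{s|u_s}}}\Bigl[1-\sum_{z=0}^{m_{\mathrm s}-1}\frac{\zeta(z)\Gamma(z+1)}{(\beta-c+sG_n^{\mathrm{s|u_s}}P_{\mathrm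 s}v^{-\alpha_{\mathrm s}})^{z+1}}\Bigr]v\,\mathrm dv-2\pi\lambda_{\mathrm{u_t}}\int_0^{R_{\max}^{\mathrm{u_t|u_s}}}\Bigl[1-\Bigl(1+\frac{sG^{\mathrm{u_t|u_s}}P_{\mathrm{u_t}}w^{-\alpha_{\mathrm t}}}{m_{\mathrm t}}\Bigr)^{-m_{\mathrm t}}\Bigr]w\,\mathrm dw\Biggr),$$ where $G_n^{\mathrm{s|u_s}}$ denotes the common (side-lobe) gain of all interfering satellites ($n\ne1$).
   Context: Geometry. The typical satellite user is fixed at $\mathbf u_1^{\mathrm s}=(0,0,R_{\mathrm{u_s}})\in\mathbb R^3$. Satellites lie on the origin-centered sphere of radius $R_{\mathrm s}>R_{\mathrm{u_s}}$ and form a homogeneous Poisson point process $\Phi_{\mathrm s}=\{\mathbf x_n\}$ with density $\lambda_{\mathrm s}>0$ per unit area. The elevation angle is $\theta_{\mathrm{u_s}}\in[0,\pi/2)$. Put $$R_{\min}^{\mathrm{s|u_s}}=R_{\mathrm s}-R_{\mathrm{u_s}},\quad R_{\max}^{\mathrm{s|u_s}}=\sqrt{R_{\mathrm s}^2-R_{\mathrm{u_s}}^2+R_{\mathrm{u_s}}^2\sin^2\theta_{\mathrm{u_s}}}-R_{\mathrm{u_s}}\sin\theta_{\mathrm{u_s}},\quad\tilde\lambda_{\mathrm{s|u_s}}=\lambda_{\mathrm s}\frac{R_{\mathrm s}}{R_{\mathrm{u_s}}}.$$ The visible cap $\mathcal A_{\mathrm{s|u_s}}$ is the set of points of the sphere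 of radius $R_{\mathrm s}$ at distance at most $R_{\max}^{\mathrm{s|u_s}}$ from $\mathbf u_1^{\mathrm s}$, and $\mathcal A_{\mathrm{s|u_s}}(r)$ is the set of those at distance at most $r$. $\mathbf x_1$ is the visible satellite nearest to $\mathbf u_1^{\mathrm s}$. The terrestrial users visible to the typical satellite user form, independently of everything else, a homogeneous Poisson point process $\Phi_{\mathrm{u_t}}=\{\mathbf u_k^{\mathrm t}\}$ of density $\lambda_{\mathrm{u_t}}>0$ in the planar disc $\mathcal A_{\mathrm{u_t|u_s}}$ of radius $R_{\max}^{\mathrm{u_t|u_s}}>0$ (and area $\pi(R_{\max}^{\mathrm{u_t|u_s}})^2$) centered at $\mathbf u_1^{\mathrm s}$. Gains. With carrier frequency $f_c$, speed of light $c_0$ and positive lobe gains: $G_n^{\mathrm{s|u_s}}=G_{\mathrm{u_s}}^{\mathrm{side}}G_{\mathrm s}^{\mathrm{side}}(c_0/4\pi f_c)^2$ for $n\neq1$; $G^{\mathrm{u_t|u_s}}=G_{\mathrm{u_s}}^{\mathrm{side}}G_{\mathrm{u_t}}^{\mathrm{side}}(c_0/4\pi f_c)^2$. Fading. All fading powers are mutually independent and independent of the point processes. The $H_n^{\mathrm s}$ are i.i.d., $\sqrt{H^{\mathrm s}}$ being Shadowed-Rician with density $$\Bigl(\tfrac{2bm_{\mathrm s}}{2bm_{\mathrm s}+\Omega}\Bigr)^{m_{\mathrm s}}\tfrac{x}{b}\,e^{-x^2/(2b)}\,{}_1F_1\Bigl(m_{\mathrm s};1;\tfrac{\Omega x^2}{2b(2bm_{\mathrm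 s}+\Omega)}\Bigr),\quad x>0,$$ with $b,\Omega>0$, $m_{\mathrm s}$ a positive integer, ${}_1F_1$ the confluent hypergeometric function. The $H_k^{\mathrm t}$ are i.i.d., $\sqrt{H^{\mathrm t}}$ being Nakagami with density $\frac{2m_{\mathrm t}^{m_{\mathrm t}}}{\Gamma(m_{\mathrm t})}x^{2m_{\mathrm t}-1}e^{-m_{\mathrm t}x^2}$, $x>0$, $m_{\mathrm t}>0$. Constants: $\beta=\frac1{2b}$, $c=\frac{\Omega}{2b(2bm_{\mathrm s}+\Omega)}$, $\zeta(z)=\bigl(\frac{2bm_{\mathrm s}}{2bm_{\mathrm s}+\Omega}\bigr)^{m_{\mathrm s}}\frac{\beta(-1)^z(1-m_{\mathrm s})_z c^z}{(z!)^2}$, with $(x)_z=x(x+1)\cdots(x+z-1)$ and $(x)_0=1$. $P_{\mathrm s},P_{\mathrm{u_t}}>0$ are transmit powers, $\sigma^2>0$ the noise power, $\alpha_{\mathrm s},\alpha_{\mathrm t}>0$ the path-loss exponents of satellite and terrestrial links. *)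

(* Defs.v *)
(* MathComp-Analysis. *)
From HB Require Import structures.
From mathcomp Require Import all_boot all_order all_algebra.
From mathcomp Require Import all_classical all_reals all_analysis.

Set Implicit Arguments.
Unset Strict Implicit.
Unset Printing Implicit Defensive.

Import Order.TTheory GRing.Theory Num.Theory.
Import numFieldNormedType.Exports.

Local Open Scope classical_set_scope.
Local Open Scope ring_scope.

(* R^3 is R * R * R rather than 'rV[R]_3: the product carries the Borel
   sigma-algebra in the library. *)
Notation R3 R := (R * R * R)%type.

Section geometry.
Variable R : realType.
Implicit Types (x y : R3 R) (rho : R).

Definition dot x y : R := x.1.1 * y.1.1 + x.1.2 * y.1.2 + x.2 * y.2.

(* The library norm on products is the sup norm; this is the Euclidean one. *)
Definition enorm x : R := Num.sqrt (dot x x).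

Definition dist x y : R := enorm (x - y).

Definition lincomb (e1 e2 : R3 R) (pq : R * R) : R3 R :=
  (pq.1 * e1.1.1 + pq.2 * e2.1.1,
   pq.1 * e1.1.2 + pq.2 * e2.1.2,
   pq.1 * e1.2 + pq.2 * e2.2).

(* th is the colatitude, ph the longitude. *)
Definition spherical rho (th ph : R) : R3 R :=
  (rho * sin th * cos ph, rho * sin th * sin ph, rho * cos th).

Definition sphere_area rho (B : set (R3 R)) : \bar R :=
  (\int[lebesgue_measure]_(th in `[0%R, pi])
     \int[lebesgue_measure]_(ph in `[0%R, (2 * pi)%R])
       (rho ^+ 2 * sin th * \1_B (spherical rho th ph))%:E)%E.

Definition planar_disc (u e1 e2 : R3 R) rho : set (R3 R) :=
  [set u + lincomb e1 e2 pq | pq in [set pq | pq.1 ^+ 2 + pq.2 ^+ 2 <= rho ^+ 2]].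

(* Area of the part of the disc lying in B, for orthonormal e1, e2. *)
Definition disc_area (u e1 e2 : R3 R) rho (B : set (R3 R)) : \bar R :=
  (lebesgue_measure \x lebesgue_measure)%E
    [set pq : R * R | pq.1 ^+ 2 + pq.2 ^+ 2 <= rho ^+ 2 /\
                      B (u + lincomb e1 e2 pq)].

End geometry.

Section special_functions.
Variable R : realType.

Definition pochhammer (a : R) (n : nat) : R := \prod_(i < n) (a + i%:R).

Definition hyp1F1 (a b x : R) : R :=
  limn (series (fun n => pochhammer a n / pochhammer b n * x ^+ n / n`!%:R)).

Definition Gamma (a : R) : R :=
  \int[lebesgue_measure]_(t in `]0, +oo[) (t `^ (a - 1) * expR (- t)).

Definition shadowed_rician_pdf (b Omega : R) (m : nat) (x : R) : R :=
  (2 * b * m%:R / (2 * b * m%:R + Omega)) ^+ m * (x / b)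
  * expR (- x ^+ 2 / (2 * b))
  * hyp1F1 m%:R 1 (Omega * x ^+ 2 / (2 * b * (2 * b * m%:R + Omega))).

Definition nakagami_pdf (m : R) (x : R) : R :=
  2 * m `^ m / Gamma m * x `^ (2 * m - 1) * expR (- m * x ^+ 2).

End special_functions.

Section probability.
Variables (d : measure_display) (T : measurableType d) (R : realType).
Variable P : probability T R.

Definition has_pdf_on_pos (V : T -> R) (f : R -> R) : Prop :=
  measurable_fun setT V /\
  forall B : set R, measurable B ->
    P (V @^-1` B) =
      (\int[lebesgue_measure]_(x in B `&` `]0%R, +oo[) (f x)%:E)%E.

Definition mutually_independent (I : Type) (F : I -> set (set T)) : Prop :=
  forall (n : nat) (i : 'I_n -> I) (A : 'I_n -> set T),
    injective i -> (forall k, F (i k) (A k)) ->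
    P (\bigcap_(k in [set: 'I_n]) A k) = (\prod_(k < n) P (A k))%E.

Section processes.
Variables (d' : measure_display) (E : measurableType d').

(* A finite point process is given by its number N of points and an
   enumeration x, of which only x 0, ..., x N.-1 are points; the values
   x n with N <= n are junk. *)
Implicit Types (N : T -> nat) (x : nat -> T -> E).

Definition npoints N x (B : set E) (w : T) : nat :=
  (\sum_(n < N w | x n w \in B) 1)%N.

(* The intensity is only required to be finite on the sets that are counted;
   the nat argument 0 of [poisson_prob] is a dummy. *)
Definition poisson_process N x (intensity : set E -> \bar R) : Prop :=
  [/\ measurable_fun setT N,
      forall n, measurable_fun setT (x n),
      forall B, measurable B -> (intensity B < +oo)%E ->
        forall K : set nat,
          P (npoints N x B @^-1` K) = poisson_prob (fine (intensity B)) 0%N K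
    & forall (m : nat) (B : 'I_m -> set E) (K : 'I_m -> set nat),
        (forall i, measurable (B i)) -> trivIset setT B ->
        P (\bigcap_(i in [set: 'I_m]) (npoints N x (B i) @^-1` K i)) =
          (\prod_(i < m) P (npoints N x (B i) @^-1` K i))%E].

(* The sigma-algebra of the enumerated process, junk values excluded. *)
Definition process_events N x : set (set T) :=
  <<s [set A | exists n (B : set E),
         measurable B /\ A = [set w | (n < N w)%N /\ B (x n w)]] >>.

End processes.

Definition rv_events (H : T -> R) : set (set T) :=
  [set H @^-1` B | B in measurable].

(* Conditioning on the null event X = r, given an event E of positive
   probability, in two standard senses. First, g is a version on D of
   r |-> E[Y | X = r, E], Y being real-valued and integrable. *)
Definition cond_expectation_version
    (E : set T) (X Y : T -> R) (D : set R) (g : R -> R) : Prop :=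
  [/\ P.-integrable E (EFin \o Y),
      measurable_fun D g,
      P (E `&` X @^-1` (~` D)) = 0%E
    & forall B : set R, measurable B -> B `<=` D ->
        (\int[P]_(w in E `&` X @^-1` B) (Y w)%:E =
         \int[P]_(w in E `&` X @^-1` B) (g (X w))%:E)%E].

(* Second, l is the limit of E[Y | |X - r| < eps, E] as eps -> 0. *)
Definition cond_expectation_at
    (E : set T) (X Y : T -> R) (r l : R) : Prop :=
  (fun eps : R => (\int[P]_(w in E `&` X @^-1` (ball r eps)) Y w)
                  / fine (P (E `&` X @^-1` (ball r eps)))) @ 0^'+ --> l.

End probability.

Record system (R : realType) := System {
  R_us : R;               (* |u_1^s| *)
  R_s : R;
  theta_us : R;
  R_ut : R;               (* radius of the disc of visible terrestrial users *)
  lambda_s : R;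
  lambda_ut : R;
  f_c : R;
  c_0 : R;
  Gside_us : R;
  Gside_s : R;
  Gside_ut : R;
  P_s : R;
  P_ut : R;
  sigma2 : R;
  alpha_s : R;
  alpha_t : R;
  b_s : R;                (* b *)
  Omega_s : R;            (* Omega *)
  m_s : nat;
  m_t : R
}.

Section model.
Variables (R : realType) (p : system R).

Record admissible : Prop := Admissible {
  R_us_gt0 : 0 < R_us p;
  R_us_lt_R_s : R_us p < R_s p;
  theta_us_itv : 0 <= theta_us p < pi / 2;
  R_ut_gt0 : 0 < R_ut p;
  lambda_s_gt0 : 0 < lambda_s p;
  lambda_ut_gt0 : 0 < lambda_ut p;
  f_c_gt0 : 0 < f_c p;
  c_0_gt0 : 0 < c_0 p;
  Gside_us_gt0 : 0 < Gside_us p;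
  Gside_s_gt0 : 0 < Gside_s p;
  Gside_ut_gt0 : 0 < Gside_ut p;
  P_s_gt0 : 0 < P_s p;
  P_ut_gt0 : 0 < P_ut p;
  sigma2_gt0 : 0 < sigma2 p;
  alpha_s_gt0 : 0 < alpha_s p;
  alpha_t_gt0 : 0 < alpha_t p;
  b_gt0 : 0 < b_s p;
  Omega_gt0 : 0 < Omega_s p;
  m_s_gt0 : (0 < m_s p)%N;
  m_t_gt0 : 0 < m_t p
}.

Definition u1 : R3 R := (0, 0, R_us p).

Definition R_min : R := R_s p - R_us p.

Definition R_max : R :=
  Num.sqrt (R_s p ^+ 2 - R_us p ^+ 2 + R_us p ^+ 2 * sin (theta_us p) ^+ 2)
  - R_us p * sin (theta_us p).

Definition lambda_tilde : R := lambda_s p * (R_s p / R_us p).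

Definition cap (rho : R) : set (R3 R) :=
  [set x | enorm x = R_s p /\ dist x u1 <= rho].

Definition gain_sat : R :=
  Gside_us p * Gside_s p * (c_0 p / (4 * pi * f_c p)) ^+ 2.

Definition gain_ut : R :=
  Gside_us p * Gside_ut p * (c_0 p / (4 * pi * f_c p)) ^+ 2.

Definition beta_ : R := 1 / (2 * b_s p).

Definition c_ : R := Omega_s p / (2 * b_s p * (2 * b_s p * (m_s p)%:R + Omega_s p)).

Definition zeta (z : nat) : R :=
  (2 * b_s p * (m_s p)%:R / (2 * b_s p * (m_s p)%:R + Omega_s p)) ^+ m_s p
  * (beta_ * (-1) ^+ z * pochhammer (1 - (m_s p)%:R) z * c_ ^+ z
     / z`!%:R ^+ 2).

Definition sat_intensity (B : set (R3 R)) : \bar R :=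
  ((lambda_s p)%:E * sphere_area (R_s p) B)%E.

Definition ut_intensity (e1 e2 : R3 R) (B : set (R3 R)) : \bar R :=
  ((lambda_ut p)%:E * disc_area u1 e1 e2 (R_ut p) B)%E.

Definition cond_laplace_formula (s r : R) : R :=
  expR (- s * sigma2 p
        - 2 * pi * lambda_tilde
          * \int[lebesgue_measure]_(v in `[r, R_max])
              ((1 - \sum_(0 <= z < m_s p)
                      zeta z * Gamma (z%:R + 1)
                      / (beta_ - c_ + s * gain_sat * P_s p
                                      * v `^ (- alpha_s p)) ^+ z.+1) * v)
        - 2 * pi * lambda_ut p
          * \int[lebesgue_measure]_(w in `[0, R_ut p])
              ((1 - (1 + s * gain_ut * P_ut p * w `^ (- alpha_t p) / m_t p)
                      `^ (- m_t p)) * w)).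

Section interference.
Variables (d : measure_display) (T : measurableType d).
Variables (e1 e2 : R3 R).
Variables (Ns : T -> nat) (x : nat -> T -> R3 R) (Hs : nat -> T -> R).
Variables (Nt : T -> nat) (u : nat -> T -> R3 R) (Ht : nat -> T -> R).

(* Satellites are numbered from 0, so x 0 stands for the serving one; it is
   at distance r, hence never in the first sum, and [gain_sat] is the gain of
   every satellite that is. *)
Definition interference (r : R) (w : T) : R :=
  \sum_(n < Ns w | x n w \in cap R_max `\` cap r)
     gain_sat * P_s p * Hs n w * dist (x n w) u1 `^ (- alpha_s p)
  + \sum_(k < Nt w | u k w \in planar_disc u1 e1 e2 (R_ut p))
     gain_ut * P_ut p * Ht k w * dist (u k w) u1 `^ (- alpha_t p)
  + sigma2 p.

Definition sat_visible : set T := [set w | (1 <= npoints Ns x (cap R_max) w)%N].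

Definition serving_is_nearest : Prop :=
  forall w, sat_visible w ->
    [/\ (0 < Ns w)%N, cap R_max (x 0%N w)
      & forall n, (n < Ns w)%N -> cap R_max (x n w) ->
          dist (x 0%N w) u1 <= dist (x n w) u1].

Inductive source :=
  sat_process | ut_process | sat_fading of nat | ut_fading of nat.

Definition source_events (i : source) : set (set T) :=
  match i with
  | sat_process => process_events Ns x
  | ut_process => process_events Nt u
  | sat_fading n => rv_events (Hs n)
  | ut_fading k => rv_events (Ht k)
  end.

End interference.
End model.

(* Main.v *)
Require Import Defs.
From HB Require Import structures.
From mathcomp Require Import all_boot all_order all_algebra.
From mathcomp Require Import all_classical all_reals all_analysis.
From mathcomp Require Import measurable_realfun zify ring lra.

Set Implicit Arguments.
Unset Strict Implicit.
Unset Printing Implicit Defensive.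

Import Order.TTheory GRing.Theory Num.Theory.
Import numFieldNormedType.Exports.

Local Open Scope classical_set_scope.
Local Open Scope ring_scope.

(* Averaging the independent fading powers replaces each factor of exp(- s I) by
   a Laplace transform evaluated at the distance of the transmitter: for the
   shadowed Rician law through Kummer's transformation, which turns the density
   into a finite combination of Gamma-type densities.  The distances of the
   visible satellites and of the terrestrial users form Poisson processes on the
   line with intensities 2 pi lambda~ v dv and 2 pi lambda_ut w dw, so the
   expectation of a product over points is the exponential of an integral.

   For the conditioning, the event a < X <= b says that no satellite is within
   distance a but some satellite is within b; it is independent of the
   satellites beyond b.  Hence the expectation of exp(- s I(b)) on this event is
   its probability times the claimed formula at b.  Cutting the range of X into
   such bins and refining them gives the disintegration, because for a given
   outcome I(b) is constant for b in a right neighbourhood of X. *)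

(** * Weighted image laws *)

(** The law of [x 0] is not given: the serving satellite is selected from the whole configuration,
    while the hypotheses on the process only speak of counts. Hence nothing is computed about it
    directly. Since [interference] excludes satellites by distance and not by index, the discounted
    interference and the absence of visible satellites within [a] are both encoded in products over
    all points, insensitive to the enumeration. A bin is a difference of two such products, so the
    Laplace functional governs serving distance and interference jointly; at [s = 0] it yields the
    law of the serving distance. A second obstacle is the enumeration: its values beyond the number
    of points are arbitrary, and the independence hypothesis does not cover them. The fading powers
    are therefore averaged on each event with fixed numbers of points, before any Poisson
    computation. Measures on the line are compared on half-lines []-oo, t]], where the calculus
    reduces to elementary primitives. *)

Section weighted_law.
Local Open Scope ereal_scope.
Context d d' (T : measurableType d) (S : measurableType d') (R : realType).
Variables (mu : {measure set T -> \bar R}) (W : T -> R) (M : T -> S).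
Hypotheses (mW : measurable_fun setT W) (W0 : forall t, (0 <= W t)%R).
Hypothesis mM : measurable_fun setT M.

(** This covers measures with a density ([M = id]), image laws ([W = 1]) and the law of [M] under a
    density; a single change of variables then serves all three. *)
Definition weighted_law (U : set S) : \bar R := \int[mu]_(t in M @^-1` U) (W t)%:E.

Let mpre U : measurable U -> measurable (M @^-1` U).
Proof. by move=> mU; rewrite -[X in measurable X]setTI; exact: mM. Qed.

Let weighted_law0 : weighted_law set0 = 0.
Proof. by rewrite /weighted_law preimage_set0 integral_set0. Qed.

Let weighted_law_ge0 U : 0 <= weighted_law U.
Proof. by apply: integral_ge0 => t _; rewrite lee_fin. Qed.

Let weighted_law_sigma_additive : semi_sigma_additive weighted_law.
Proof.
move=> F mF tF mUF; rewrite /weighted_law preimage_bigcup.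
rewrite ge0_integral_bigcup//.
- by apply: is_cvg_nneseries => n _ _; by apply: integral_ge0 => t _; rewrite lee_fin.
- by move=> k; exact: mpre.
- by apply/measurable_EFinP; exact: measurable_funS mW.
- by move=> t _; rewrite lee_fin.
- by move=> i j _ _ [t [/= Fi Fj]]; apply: tF => //; exists (M t).
Qed.

Definition weighted_law_mixin := isMeasure.Build _ _ _ weighted_law
  weighted_law0 weighted_law_ge0 weighted_law_sigma_additive.

Definition weighted_law_measure : {measure set S -> \bar R} :=
  HB.pack weighted_law weighted_law_mixin.

Section finite.
Hypothesis Woo : \int[mu]_t (W t)%:E < +oo.

Let weighted_law_fin_num : fin_num_fun weighted_law.
Proof.
move=> U mU; rewrite ge0_fin_numE//; apply: le_lt_trans Woo.
apply: ge0_subset_integral => //; first exact: mpre.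
  by apply/measurable_EFinP.
by move=> t _; rewrite lee_fin.
Qed.

Definition weighted_law_finite_measure : {finite_measure set S -> \bar R} :=
  HB.pack weighted_law weighted_law_mixin
    (Measure_isFinite.Build _ _ _ weighted_law_measure weighted_law_fin_num).

End finite.

Import HBNNSimple.

Lemma ge0_integral_weighted_law (F : S -> \bar R) :
  measurable_fun setT F -> (forall y, 0 <= F y) ->
  \int[weighted_law_measure]_y F y = \int[mu]_t ((W t)%:E * F (M t)).
Proof.
move=> mF F0.
pose f_ := nnsfun_approx measurableT mF.
transitivity (limn (fun n => \int[weighted_law_measure]_y (f_ n y)%:E)).
  rewrite -monotone_convergence//.
  - by apply: eq_integral => y _; apply/esym/cvg_lim => //; exact: cvg_nnsfun_approx.
  - by move=> n; exact/measurable_EFinP/measurable_funP.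
  - by move=> n y _; rewrite lee_fin.
  - by move=> y _ m n mn; rewrite lee_fin; exact/lefP/nd_nnsfun_approx.
have mfM n : measurable_fun setT (fun t => (f_ n (M t))%:E).
  by apply/measurable_EFinP; apply: measurableT_comp => //; exact: measurable_funP.
rewrite [X in limn X](_ : _ =
    (fun n => \int[mu]_t ((W t)%:E * (f_ n (M t))%:E))); last first.
  apply/funext => n.
  transitivity (\sum_(k \in range (f_ n)) \int[weighted_law_measure]_y
      (k * \1_(f_ n @^-1` [set k]) y)%:E).
    under eq_integral do rewrite fimfunE -fsumEFin//.
    rewrite ge0_integral_fsum//.
      by move=> r; exact/measurable_EFinP/measurable_funM.
    by move=> r y _; rewrite nnfun_muleindic_ge0.
  under [RHS]eq_integral => t _.
    rewrite fimfunE -fsumEFin// ge0_mule_fsumr; last first.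
      by move=> r; rewrite nnfun_muleindic_ge0.
    over.
  rewrite ge0_integral_fsum//.
  - apply: eq_fsbigr => r _.
    (* A nonnegative simple function takes no negative value, so both sides are then 0; for [r >= 0]
       the constant can be pulled out of the integral. *)
    have [r0|r0] := ltP r 0%R.
      rewrite preimage_nnfun0//.
      rewrite [LHS]integral0_eq; last by move=> y _; rewrite indic0 mulr0.
      by rewrite integral0_eq// => y _; rewrite indic0 mulr0 mule0.
    rewrite integralZl_indic_nnsfun// integral_indic//= setIT /weighted_law.
    rewrite -ge0_integralZl//; last 3 first.
    + exact: mpre.
    + by apply/measurable_EFinP; exact: measurable_funTS.
    + by move=> t _; rewrite lee_fin.
    rewrite integral_mkcond; apply: eq_integral => t _.
    rewrite /restrict/= indicE EFinM !muleA.
    have -> : (t \in M @^-1` (f_ n @^-1` [set r])) = (M t \in f_ n @^-1` [set r]).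
      by apply/idP/idP; rewrite !inE.
    by case: ifPn => h; rewrite ?mule1 ?mule0// muleC.
  - move=> r; apply: emeasurable_funM; first exact/measurable_EFinP.
    apply: (measurableT_comp (f := fun y => (r * \1_(f_ n @^-1` [set r]) y)%:E)) => //.
    by apply/measurable_EFinP/measurable_funM.
  - by move=> r t _; apply: mule_ge0; [rewrite lee_fin|rewrite EFinM nnfun_muleindic_ge0].
rewrite -monotone_convergence//.
- apply: eq_integral => t _; apply/cvg_lim => //; apply: cvgeZl => //.
  by apply: cvg_nnsfun_approx.
- by move=> n; by apply: emeasurable_funM => //; exact/measurable_EFinP.
- by move=> n t _; rewrite mule_ge0 ?lee_fin.
- move=> t _ m n mn; apply: lee_wpmul2l; first by rewrite lee_fin.
  by rewrite lee_fin; exact/lefP/nd_nnsfun_approx.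
Qed.

Lemma ge0_integral_weighted_law_finite
    (Woo : \int[mu]_t (W t)%:E < +oo) (F : S -> \bar R) :
  measurable_fun setT F -> (forall y, 0 <= F y) ->
  \int[weighted_law_finite_measure Woo]_y F y = \int[mu]_t ((W t)%:E * F (M t)).
Proof. exact: ge0_integral_weighted_law. Qed.

End weighted_law.

Section integral_unit_interval.
Local Open Scope ereal_scope.
Context d (T : measurableType d) (R : realType) (P : probability T R).
Variable f : T -> R.
Hypotheses (mf : measurable_fun setT f) (f01 : forall w, (0 <= f w <= 1)%R).

Lemma integral01 A : measurable A -> 0 <= \int[P]_(w in A) (f w)%:E <= 1.
Proof.
move=> mA; apply/andP; split.
  by apply: integral_ge0 => w _; rewrite lee_fin; case/andP: (f01 w).
apply: (@le_trans _ _ (\int[P]_(w in A) (cst 1 w))).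
  apply: ge0_le_integral => //.
  - by move=> w _; rewrite lee_fin; case/andP: (f01 w).
  - by apply/measurable_EFinP; exact: measurable_funTS.
  - by move=> w _; rewrite lee_fin; case/andP: (f01 w).
by rewrite integral_cst// mul1e probability_le1.
Qed.

Lemma integral01_fin_num A : measurable A ->
  \int[P]_(w in A) (f w)%:E \is a fin_num.
Proof.
move=> /integral01/andP[f0 f1]; rewrite ge0_fin_numE//.
by rewrite (le_lt_trans f1)// ltry.
Qed.

Lemma integrable01 A : measurable A -> P.-integrable A (EFin \o f).
Proof.
move=> mA; have f_ge0 w : (0 <= f w)%R by case/andP: (f01 w).
apply/integrableP; split.
  by apply/measurable_EFinP; exact: measurable_funTS.
under eq_integral => w _ do rewrite /= (ger0_norm (f_ge0 w)).
by have /andP[? ?] := integral01 mA; rewrite (le_lt_trans _ (ltry 1)).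
Qed.

End integral_unit_interval.

Lemma integral_indicM d (T : measurableType d) (R : realType)
    (mu : {measure set T -> \bar R}) (D B : set T) (f : T -> R) :
  (\int[mu]_(x in D) (\1_B x * f x)%:E = \int[mu]_(x in D `&` B) (f x)%:E)%E.
Proof.
rewrite integral_mkcond [RHS]integral_mkcond; apply: eq_integral => x _.
rewrite /restrict in_setI indicE.
by case: (x \in D); case: (x \in B) => //=; rewrite ?mul1r ?mul0r.
Qed.

(** * Averaging independent marks *)

Section independent_marks.
Local Open Scope ereal_scope.
Context d d1 d2 (T : measurableType d) (S1 : measurableType d1)
  (S2 : measurableType d2) (R : realType).
Variables (P : probability T R) (n : nat).
Variables (Z : nat -> T -> S1) (H : nat -> T -> S2) (q : nat -> S1 * S2 -> R).
Hypothesis mZ : forall j, measurable_fun setT (Z j).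
Hypothesis mH : forall j, measurable_fun setT (H j).
Hypothesis mq : forall j, measurable_fun setT (q j).
Hypothesis q01 : forall j zh, (0 <= q j zh <= 1)%R.
(** Events describing the positions, closed under conditions on [Z j] for [j < n]. This closure
    suits events with a fixed number of points, on which the first [n] positions, and no others, are
    observable through the process. *)
Variable AA : set (set T).
Hypothesis AA_measurable : AA `<=` measurable.
Hypothesis AA_preimage : forall A j U, (j < n)%N -> AA A -> measurable U ->
  AA (A `&` Z j @^-1` U).
Hypothesis AA_indep : forall A (V : nat -> set S2), AA A ->
  (forall j, measurable (V j)) ->
  P (A `&` [set w | forall j, (j < n)%N -> V j (H j w)]) =
    P A * \prod_(j < n) P (H j @^-1` V j).


Definition mark_mean j z : R := fine (\int[P]_w (q j (z, H j w))%:E).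

Let mqz j z : measurable_fun setT (fun w => q j (z, H j w)).
Proof. exact: (measurableT_comp (mq j) (measurable_fun_pair _ _)). Qed.

Let qz01 j z w : (0 <= q j (z, H j w) <= 1)%R. Proof. exact: q01. Qed.

Lemma mark_meanE j z : (mark_mean j z)%:E = \int[P]_w (q j (z, H j w))%:E.
Proof. by rewrite fineK// (integral01_fin_num P (mqz j z))//. Qed.

Lemma mark_mean01 j z : (0 <= mark_mean j z <= 1)%R.
Proof.
by rewrite -!lee_fin mark_meanE; exact: (integral01 P (mqz j z)).
Qed.

Lemma measurable_mark_mean j : measurable_fun setT (mark_mean j).
Proof.
apply: (measurableT_comp (@fine_measurable R setT measurableT)) => //.
have W1 : \int[P]_w (cst 1%R w)%:E < +oo.
  change (\int[P]_w cst 1%:E w < +oo).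
  by rewrite integral_cst// mul1e (le_lt_trans (probability_le1 _ _)) ?ltry.
pose L := weighted_law_finite_measure (measurable_cst _) (fun=> ler01) (mH j) W1.
(* Written with the law [L] of the mark instead of [P], the mean is a section integral, whose
   measurability is part of Tonelli's theorem. *)
rewrite (_ : (fun z => _) = fubini_F L (EFin \o q j)); last first.
  apply/funext => z; rewrite /fubini_F.
  rewrite ge0_integral_weighted_law_finite//.
  - by apply: eq_integral => w _; rewrite mul1e.
  - by apply/measurable_EFinP; exact: (measurableT_comp (mq j)).
  - by move=> h; rewrite lee_fin; case/andP: (q01 j (z, h)).
apply: measurable_fun_fubini_tonelli_F => //.
  by apply/measurable_EFinP.
by move=> zh; rewrite lee_fin; case/andP: (q01 j zh).
Qed.


(** The marks not yet averaged are confined to arbitrary sets. Carrying them through the induction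
    preserves the independence needed later: at step [k], the free set [V k] becomes the mark side
    of a rectangle. *)
Let tail k (V : nat -> set S2) := [set w | forall j, (k <= j < n)%N -> V j (H j w)].

Let tailS k V : (k < n)%N -> tail k V = H k @^-1` V k `&` tail k.+1 V.
Proof.
move=> kn; apply/seteqP; split=> w /=.
  move=> h; split; first by apply: h; rewrite leqnn.
  by move=> j /andP[kj jn]; apply: h; rewrite jn (ltnW kj).
move=> [h1 h2] j /andP[]; rewrite leq_eqVlt => /orP[/eqP<-//|kj jn].
by apply: h2; rewrite kj.
Qed.

Let measurable_tail k V : (forall j, measurable (V j)) -> measurable (tail k V).
Proof.
move=> mV; rewrite (_ : tail k V =
    \bigcap_(j in [set j | (k <= j < n)%N]) H j @^-1` V j); last first.
  by apply/seteqP; split=> w h j; apply: h.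
apply: bigcap_measurableType => //.
by move=> j _; rewrite -[X in measurable X]setTI; exact: mH.
Qed.

Let prod_measurable k : measurable_fun setT
  (fun w => (\prod_(j < k) q j (Z j w, H j w))%R).
Proof.
apply: measurable_prod => j _; apply: (measurableT_comp (mq j)).
exact: measurable_fun_pair.
Qed.

Let prodm_measurable k : measurable_fun setT
  (fun w => (\prod_(j < k) mark_mean j (Z j w))%R).
Proof.
apply: measurable_prod => j _.
by apply: (measurableT_comp (measurable_mark_mean j)).
Qed.

Let prod01 k w : (0 <= \prod_(j < k) q j (Z j w, H j w) <= 1)%R.
Proof.
rewrite prodr_ge0/=; last by move=> j _; case/andP: (q01 j (Z j w, H j w)).
by apply: prodr_ile1 => j _; exact: q01.
Qed.

Let prodm01 k w : (0 <= \prod_(j < k) mark_mean j (Z j w) <= 1)%R.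
Proof.
rewrite prodr_ge0/=; last by move=> j _; case/andP: (mark_mean01 j (Z j w)).
by apply: prodr_ile1 => j _; exact: mark_mean01.
Qed.

(* The marks are averaged one at a time: a step is Tonelli's theorem for the law
   of [(Z k, H k)] weighted by the factors already treated, which is a product
   measure because it is one on rectangles. *)
Let claim k : (k <= n)%N -> forall A V, AA A -> (forall j, measurable (V j)) ->
  \int[P]_(w in A `&` tail k V) (\prod_(j < k) q j (Z j w, H j w))%R%:E =
  \int[P]_(w in A) (\prod_(j < k) mark_mean j (Z j w))%R%:E *
    \prod_(k <= j < n) P (H j @^-1` V j).
Proof.
elim: k => [_|k IH kn] A V AAA mV.
  have mA := AA_measurable AAA.
  under eq_integral do rewrite big_ord0.
  under [in RHS]eq_integral do rewrite big_ord0.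
  rewrite !integral_cst//; last exact: measurableI (measurable_tail _ _).
  by rewrite !mul1e big_mkord -AA_indep.
have mA := AA_measurable AAA.
have mtl := measurable_tail k.+1 mV.
have mHV j U : measurable U -> measurable (H j @^-1` U).
  by move=> mU; rewrite -[X in measurable X]setTI; exact: mH.
have mZU j U : measurable U -> measurable (Z j @^-1` U).
  by move=> mU; rewrite -[X in measurable X]setTI; exact: mZ.
(* Probability contributed by the marks after [k], as a real number so that it can be part of a
   weight. *)
pose c := (\prod_(k.+1 <= j < n) fine (P (H j @^-1` V j)))%R.
have cE : c%:E = \prod_(k.+1 <= j < n) P (H j @^-1` V j).
  rewrite -prodEFin; apply: eq_bigr => j _.
  by rewrite fineK// fin_num_measure//; exact: mHV.
have c01 : (0 <= c <= 1)%R.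
  have p01 j : (0 <= fine (P (H j @^-1` V j)) <= 1)%R.
    rewrite fine_ge0//= -lee_fin fineK; first exact: probability_le1 (mHV _ _ _).
    by rewrite fin_num_measure//; exact: mHV.
  rewrite /c prodr_ge0/=; last by move=> j _; case/andP: (p01 j).
  by apply: prodr_ile1 => j _; exact: p01.
pose pq k w := (\prod_(j < k) q j (Z j w, H j w))%R.
pose pm k w := (\prod_(j < k) mark_mean j (Z j w))%R.
pose W1 := (fun w => \1_(A `&` tail k.+1 V) w * \prod_(j < k) q j (Z j w, H j w))%R.
pose W2 := (fun w => c * (\1_A w * \prod_(j < k) mark_mean j (Z j w)))%R.
have indic01 B (f : T -> R) w : (0 <= f w <= 1 -> 0 <= \1_B w * f w <= 1)%R.
  by rewrite indicE => f01; case: (w \in B); rewrite ?mul1r// mul0r lexx ler01.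
have W1_01 w : (0 <= W1 w <= 1)%R by exact: (indic01 _ (pq k) w (prod01 k w)).
have W2_01 w : (0 <= W2 w <= 1)%R.
  have /andP[h1 h2] := indic01 A (pm k) w (prodm01 k w); case/andP: c01 => c0 c1.
  by rewrite /W2 mulr_ge0//= mulr_ile1.
have W1_ge0 w : (0 <= W1 w)%R by case/andP: (W1_01 w).
have W2_ge0 w : (0 <= W2 w)%R by case/andP: (W2_01 w).
have mW1 : measurable_fun setT W1.
  by apply: measurable_funM => //; apply: measurable_indic; exact: measurableI.
have mW2 : measurable_fun setT W2.
  apply: measurable_funM; first exact: measurable_cst.
  by apply: measurable_funM; [exact: measurable_indic|exact: prodm_measurable].
have mM1 : measurable_fun setT (fun w => (Z k w, H k w)).
  exact: measurable_fun_pair.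
have one_oo : \int[P]_w (cst 1%R w)%:E < +oo.
  change (\int[P]_w cst 1%:E w < +oo).
  by rewrite integral_cst// mul1e (le_lt_trans (probability_le1 _ _)) ?ltry.
have W2oo : \int[P]_w (W2 w)%:E < +oo.
  have := integral01_fin_num P mW2 W2_01 measurableT.
  by rewrite ge0_fin_numE// integral_ge0// => w _; rewrite lee_fin.
pose mu1 := weighted_law_measure P mW1 W1_ge0 mM1.
pose m1 := weighted_law_finite_measure mW2 W2_ge0 (mZ k) W2oo.
pose m2 := weighted_law_finite_measure (measurable_cst _) (fun=> ler01) (mH k) one_oo.
have m12 : forall X, measurable X -> (m1 \x m2) X = mu1 X.
  apply: product_measure_unique => U V' mU mV'.
  (* The side [V'] is put in slot [k] and the later constraints are untouched, so the induction
     hypothesis evaluates [mu1] on the rectangle. *)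
  pose V'' j := if j == k then V' else V j.
  have mV'' j : measurable (V'' j) by rewrite /V''; case: ifP.
  have tail'' : tail k.+1 V'' = tail k.+1 V.
    apply/seteqP; split => w h j /[dup] /andP[kj _] /h;
    by rewrite /V'' gtn_eqF.
  have -> : mu1 (U `*` V') = \int[P]_(w in (A `&` Z k @^-1` U) `&` tail k V'')
      (\prod_(j < k) q j (Z j w, H j w))%R%:E.
    rewrite [LHS]integral_indicM (@tailS k V'' kn) tail''; congr (integral _ _ _).
    by rewrite /V'' eqxx; apply/seteqP; split => w /=; tauto.
  rewrite (IH (ltnW kn))//; last exact: AA_preimage.
  have Em1 : m1 U = c%:E * \int[P]_(w in A `&` Z k @^-1` U)
      (\prod_(j < k) mark_mean j (Z j w))%R%:E.
    rewrite setIC -integral_indicM -ge0_integralZl//.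
    - exact: mZU.
    - apply/measurable_EFinP; apply: measurable_funTS; apply: measurable_funM.
        exact: measurable_indic.
      exact: prodm_measurable.
    - by move=> w _; rewrite lee_fin; case/andP: (indic01 A (pm k) w (prodm01 k w)).
    - by rewrite lee_fin; case/andP: c01.
  have Em2 : m2 V' = P (H k @^-1` V').
    change (\int[P]_(w in H k @^-1` V') cst 1%:E w = P (H k @^-1` V')).
    by rewrite integral_cst ?mul1e//; exact: mHV.
  transitivity (c%:E * \int[P]_(w in A `&` Z k @^-1` U) (pm k w)%:E *
      P (H k @^-1` V')); last by rewrite -Em1 -Em2.
  rewrite big_ltn// {1}/V'' eqxx.
  rewrite (eq_big_nat _ _ (F2 := fun j => P (H j @^-1` V j))).
    by rewrite -cE muleA muleC muleA.
  by move=> j /andP[kj _]; rewrite /V'' gtn_eqF.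
transitivity (\int[mu1]_zh (q k zh)%:E).
  rewrite ge0_integral_weighted_law//; last 2 first.
  - exact/measurable_EFinP.
  - by move=> zh; rewrite lee_fin; case/andP: (q01 k zh).
  rewrite [RHS](_ : _ = \int[P]_w (\1_(A `&` tail k.+1 V) w *
      \prod_(j < k.+1) q j (Z j w, H j w))%:E).
    by rewrite integral_indicM setTI.
  by apply: eq_integral => w _; rewrite big_ord_recr/= mulrA EFinM.
rewrite (eq_measure_integral (m1 \x m2)); last by move=> X mX _; exact/esym/m12.
rewrite fubini_tonelli1//; last 2 first.
- exact/measurable_EFinP.
- by move=> zh; rewrite lee_fin; case/andP: (q01 k zh).
transitivity (\int[m1]_z (mark_mean k z)%:E).
  apply: eq_integral => z _; rewrite mark_meanE /fubini_F.
  rewrite ge0_integral_weighted_law_finite//.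
  - by apply: eq_integral => w _; rewrite mul1e.
  - by apply/measurable_EFinP; exact: (measurableT_comp (mq k)).
  - by move=> h; rewrite lee_fin; case/andP: (q01 k (z, h)).
rewrite ge0_integral_weighted_law_finite//; last 2 first.
- by apply/measurable_EFinP; exact: measurable_mark_mean.
- by move=> z; rewrite lee_fin; case/andP: (mark_mean01 k z).
rewrite -cE muleC -(setTI A) -integral_indicM -ge0_integralZl//; last 3 first.
- apply/measurable_EFinP; apply: measurable_funM.
    exact: measurable_indic.
  exact: prodm_measurable.
- by move=> w _; rewrite lee_fin; case/andP: (indic01 A (pm k.+1) w (prodm01 k.+1 w)).
- by rewrite lee_fin; case/andP: c01.
by apply: eq_integral => w _; rewrite -!EFinM /W2 big_ord_recr/= !mulrA.
Qed.

Lemma independent_marks_integral A : AA A ->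
  \int[P]_(w in A) (\prod_(j < n) q j (Z j w, H j w))%R%:E =
  \int[P]_(w in A) (\prod_(j < n) mark_mean j (Z j w))%R%:E.
Proof.
move=> AAA; have := claim (leqnn n) AAA (fun=> measurableT).
rewrite big_geq// mule1 => <-; congr (integral _ _ _).
by apply/seteqP; split => w//= [].
Qed.

End independent_marks.

(** * Measurability of sums and products with a random number of terms *)

Section random_index.
Context d d' (T : measurableType d) (S : measurableType d').

Lemma measurable_fun_random_index (N : T -> nat) (g : nat -> T -> S) :
  measurable_fun setT N -> (forall n, measurable_fun setT (g n)) ->
  measurable_fun setT (fun w => g (N w) w).
Proof.
move=> mN mg _ Y mY; rewrite setTI.
rewrite (_ : _ @^-1` Y = \bigcup_n (N @^-1` [set n] `&` g n @^-1` Y)).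
  apply: bigcup_measurable => n _; apply: measurableI.
    by rewrite -[X in measurable X]setTI; exact: mN.
  by rewrite -[X in measurable X]setTI; exact: mg.
by apply/seteqP; split=> [w Yw|w [n _ [/= -> Yw]]]//; exists (N w).
Qed.

End random_index.

Section random_index_corollaries.
Context d d' (T : measurableType d) (S : measurableType d').

Lemma measurable_mem (x : T -> S) (B : set S) :
  measurable_fun setT x -> measurable B -> measurable_fun setT (fun w => x w \in B).
Proof.
move=> mx mB; apply: (@measurable_fun_bool _ _ _ _ true).
rewrite setTI (_ : _ @^-1` _ = x @^-1` B).
  by rewrite -[X in measurable X]setTI; exact: mx.
by apply/seteqP; split=> w; [move=> /set_mem|move=> /mem_set].
Qed.

Lemma measurable_npoints (N : T -> nat) (x : nat -> T -> S) (B : set S) :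
  measurable_fun setT N -> (forall n, measurable_fun setT (x n)) ->
  measurable B -> measurable_fun setT (npoints N x B).
Proof.
move=> mN mx mB.
apply: (measurable_fun_random_index
  (g := fun n w => (\sum_(i < n | x i w \in B) 1)%N)) => // n.
elim: n => [|n IH]; first by under eq_fun do rewrite big_ord0; exact: measurable_cst.
rewrite (_ : (fun w => _) = fun w => if x n w \in B
    then (\sum_(i < n | x i w \in B) 1).+1 else (\sum_(i < n | x i w \in B) 1))%N.
  apply: measurable_fun_ifT => //; first exact: measurable_mem.
  exact: (measurableT_comp (f := succn)).
apply/funext => w; rewrite big_mkcond big_ord_recr/= -big_mkcond/=.
by case: ifP => _; rewrite ?addn1 ?addn0.
Qed.

Lemma measurable_random_prod (R : realType) (N : T -> nat) (b : nat -> T -> bool)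
    (f : nat -> T -> R) :
  measurable_fun setT N -> (forall n, measurable_fun setT (b n)) ->
  (forall n, measurable_fun setT (f n)) ->
  measurable_fun setT (fun w => \prod_(n < N w | b n w) f n w).
Proof.
move=> mN mb mf; apply: (measurable_fun_random_index
  (g := fun m w => \prod_(n < m | b n w) f n w)) => // m.
under eq_fun do rewrite big_mkcond.
apply: measurable_prod => n _; exact: measurable_fun_ifT.
Qed.

Lemma measurable_random_sum (R : realType) (N : T -> nat) (b : nat -> T -> bool)
    (f : nat -> T -> R) :
  measurable_fun setT N -> (forall n, measurable_fun setT (b n)) ->
  (forall n, measurable_fun setT (f n)) ->
  measurable_fun setT (fun w => \sum_(n < N w | b n w) f n w).
Proof.
move=> mN mb mf; apply: (measurable_fun_random_index
  (g := fun m w => \sum_(n < m | b n w) f n w)) => // m.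
under eq_fun do rewrite big_mkcond.
by apply: measurable_sum => n; exact: measurable_fun_ifT.
Qed.

End random_index_corollaries.

Section bounded_convergence.
Context d (T : measurableType d) (R : realType) (mu : {finite_measure set T -> \bar R}).

Lemma bounded_convergence (D : set T) (f_ : nat -> T -> R) (f : T -> R) :
  measurable D ->
  (forall n, measurable_fun setT (f_ n)) -> measurable_fun setT f ->
  (forall n w, 0 <= f_ n w <= 1) ->
  (forall w, D w -> f_ ^~ w @ \oo --> f w) ->
  (\int[mu]_(w in D) (f_ n w)%:E @[n --> \oo] --> \int[mu]_(w in D) (f w)%:E)%E.
Proof.
move=> mD mf_ mf f01 f_f.
have := @dominated_convergence _ _ _ mu D mD (fun n w => (f_ n w)%:E)
  (EFin \o f) (cst 1%E).
case=> //.
- by move=> n; apply/measurable_EFinP; exact: measurable_funTS.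
- by apply/measurable_EFinP; exact: measurable_funTS.
- by apply: aeW => w Dw; apply: cvg_EFin; [exact: nearW|exact: f_f].
- apply/integrableP; split => //.
  under eq_integral do rewrite /= normr1.
  by rewrite integral_cst// mul1e -ge0_fin_numE// fin_num_measure.
- by apply: aeW => w n _; rewrite /= lee_fin ger0_norm; case/andP: (f01 n w).
Qed.

End bounded_convergence.

(** * Laplace functional of a Poisson process *)

Lemma poisson_prob_set1 (R : realType) (mu : R) (k : nat) : 0 <= mu ->
  poisson_prob mu 0 [set k] = (mu ^+ k / k`!%:R * expR (- mu))%:E.
Proof.
rewrite le_eqVlt => /orP[/eqP<-|mu0]; rewrite /poisson_prob.
  (* At rate 0 the Poisson law is by convention the Dirac mass at 0, which agrees with the formula
     because [0 ^+ 0 = 1]. *)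
  rewrite ltxx oppr0 expR0 mulr1 diracE.
  case: k => [|k]; first by rewrite mem_set// expr0 fact0 divr1.
  by rewrite memNset// expr0n mul0r.
rewrite mu0 esum_set1; first by rewrite /poisson_pmf mu0.
by rewrite lee_fin poisson_pmf_ge0.
Qed.

Lemma poisson_pgf d (T : measurableType d) (R : realType) (P : probability T R)
    (N : T -> nat) (mu a : R) :
  measurable_fun setT N -> 0 <= mu -> 0 <= a ->
  (forall K : set nat, P (N @^-1` K) = poisson_prob mu 0 K) ->
  (\int[P]_w (a ^+ N w)%:E = (expR (- ((1 - a) * mu)))%:E)%E.
Proof.
move=> mN mu0 a0 NE.
have mNk k : measurable (N @^-1` [set k]).
  by rewrite -[X in measurable X]setTI; exact: mN.
have <- : \bigcup_k N @^-1` [set k] = setT.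
  by apply/seteqP; split=> // w _; exists (N w).
rewrite ge0_integral_bigcup//; last 3 first.
- apply/measurable_EFinP; apply: measurable_funTS.
  by apply: (measurableT_comp (f := fun k : nat => a ^+ k)).
- by move=> w _; rewrite lee_fin exprn_ge0.
- by move=> i j _ _ [w [/= <- <-]].
transitivity (\sum_(k <oo) ((a * mu) ^+ k / k`!%:R * expR (- mu))%:E)%E.
  apply: eq_eseriesr => k _.
  rewrite (eq_integral (fun=> (a ^+ k)%:E)); last by move=> w /set_mem /= ->.
  rewrite integral_cst// [X in (_ * X)%E](NE [set k]) poisson_prob_set1//.
  by rewrite -EFinM exprMn !mulrA.
rewrite mulrBl mul1r opprB expRD.
have h := @is_cvg_series_exp_coeff R (a * mu).
apply/cvg_lim => //.
under eq_fun => n do rewrite sumEFin -mulr_suml.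
apply: cvg_EFin; first exact: nearW.
apply: cvgMl; rewrite /expR; exact: h.
Qed.

(** The counts in disjoint sets are independent, so they can be treated as marks attached to a
    constant position: [independent_marks_integral] applies with the two trivial events, and each
    mean is a Poisson generating function. *)
Lemma poisson_process_pgf d (T : measurableType d) (R : realType)
    (P : probability T R) d' (E : measurableType d') (N : T -> nat)
    (x : nat -> T -> E) (L : set E -> \bar R) (m : nat) (B : nat -> set E)
    (a : nat -> R) :
  poisson_process P N x L ->
  (forall i, measurable (B i)) -> trivIset setT B ->
  (forall i, 0 <= L (B i) < +oo)%E -> (forall i, 0 <= a i <= 1) ->
  (\int[P]_w (\prod_(i < m) a i ^+ npoints N x (B i) w)%:E =
   (expR (- \sum_(i < m) (1 - a i) * fine (L (B i))))%:E)%E.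
Proof.
move=> [mN mx Lpoisson Lindep] mB tB Loo a01.
have mH i : measurable_fun setT (npoints N x (B i)) by exact: measurable_npoints.
pose q (i : nat) (zh : nat * nat) := a i ^+ zh.2.
have mq i : measurable_fun setT (q i).
  by apply: (measurableT_comp (f := fun k => a i ^+ k)).
have q01 i zh : 0 <= q i zh <= 1.
  by case/andP: (a01 i) => a0 a1; rewrite /q exprn_ge0//= exprn_ile1.
pose AA := [set A : set T | A = set0 \/ A = setT].
have key := @independent_marks_integral _ _ _ T nat nat R P m (fun _ _ => 0%N)
  (fun i => npoints N x (B i)) q (fun=> measurable_cst _) mH mq q01 AA _ _ _ setT.
rewrite [LHS]key; last by right.
- have meanE i : mark_mean P (fun i => npoints N x (B i)) q i 0 =
      expR (- ((1 - a i) * fine (L (B i)))).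
    have /andP[L0 Li] := Loo i; case/andP: (a01 i) => a0 a1.
    by rewrite /mark_mean (poisson_pgf (mH i) (fine_ge0 L0) a0
      (Lpoisson _ (mB i) Li)).
  under eq_integral => w _ do under eq_bigr => i _ do rewrite meanE.
  by rewrite integral_cst// -expR_sum sumrN [X in (_ * X)%E]probability_setT mule1.
- by move=> A [] ->.
- move=> A j U _ [] -> mU; first by rewrite set0I; left.
  rewrite setTI; have [U0|U0] := pselect (U 0%N).
    by right; apply/seteqP; split.
  by left; apply/seteqP; split.
- move=> A V [] -> mV; first by rewrite set0I !measure0 mul0e.
  rewrite setTI probability_setT mul1e.
  have := Lindep m (B \o val) (V \o val) (fun i => mB i); rewrite /= => <-.
    congr (P _); apply/seteqP; split=> w h.
      by move=> i _; apply: h.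
    by move=> j jm; exact: (h (Ordinal jm) Logic.I).
  by move=> i j _ _ /tB h; exact/val_inj/h.
Qed.

Lemma measurable_truncn (R : realType) : measurable_fun setT (@Num.truncn R).
Proof.
have mgt n : measurable [set x : R | (n < Num.truncn x)%N].
  rewrite (_ : [set x | _] = `[n.+1%:R, +oo[%classic)//.
  by apply/seteqP; split=> x /=; rewrite in_itv/= andbT truncn_gt_nat.
move=> _ K _; rewrite setTI (_ : _ @^-1` K =
    \bigcup_(i in K) (@Num.truncn R) @^-1` [set i]); last first.
  by apply/seteqP; split=> [y Ky|y [i Ki /= yi]]; [exists (Num.truncn y)|rewrite /preimage/= yi].
apply: bigcup_measurable => -[|i] _.
  rewrite (_ : _ @^-1` _ = ~` [set y : R | (0 < Num.truncn y)%N]).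
    exact: measurableC.
  apply/seteqP; split=> y /=; first by move=> ->.
  by rewrite lt0n => /negP; rewrite negbK => /eqP.
rewrite (_ : _ @^-1` _ = [set y : R | (i < Num.truncn y)%N] `&`
    ~` [set y : R | (i.+1 < Num.truncn y)%N]).
  by apply: measurableI => //; exact: measurableC.
apply/seteqP; split=> y /=; first by move=> ->; rewrite ltnn ltnSn.
by move=> [h1 /negP]; rewrite -leqNgt => h2; apply/eqP; rewrite eqn_leq h1 h2.
Qed.

Section poisson_laplace_functional.
Context d (T : measurableType d) (R : realType) (P : probability T R).
Context d' (E : measurableType d').
Variables (N : T -> nat) (x : nat -> T -> E) (L : set E -> \bar R).
Hypothesis ppp : poisson_process P N x L.
Variables (C : set E) (D : E -> R) (nu : {finite_measure set R -> \bar R}).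
Hypotheses (mC : measurable C) (mD : measurable_fun setT D).
Hypothesis L_nu : forall A, measurable A -> L (C `&` D @^-1` A) = nu A.

(** When the factor takes finitely many values [a i], its level sets cut [C] into disjoint pieces,
    and the product over the points becomes a product of powers of the counts in these pieces. *)
Let laplace_step (m : nat) (t : R -> nat) (a : nat -> R) :
  measurable_fun setT t -> (forall v, (t v < m)%N) -> (forall i, 0 <= a i <= 1) ->
  (\int[P]_w (\prod_(n < N w | x n w \in C) a (t (D (x n w))))%:E =
   (expR (- fine (\int[nu]_v (1 - a (t v))%:E)))%:E)%E.
Proof.
move=> mt tm a01.
pose B i := C `&` D @^-1` (t @^-1` [set i]).
have mti i : measurable (t @^-1` [set i]).
  by rewrite -[X in measurable X]setTI; exact: mt.
have mB i : measurable (B i).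
  by apply: measurableI => //; rewrite -[X in measurable X]setTI; exact: mD.
have tB : trivIset setT B by move=> i j _ _ [e [[_ /= <-] [_ /= <-]]].
have LB i : L (B i) = nu (t @^-1` [set i]) by exact: L_nu.
have LBoo i : (0 <= L (B i) < +oo)%E.
  by rewrite LB measure_ge0/= -ge0_fin_numE// fin_num_measure.
rewrite (eq_integral (fun w => (\prod_(i < m) a i ^+ npoints N x (B i) w)%:E)).
  rewrite (poisson_process_pgf _ ppp)//; congr (expR (- _))%:E.
  transitivity (fine (\sum_(i < m) \int[nu]_v
      ((1 - a i) * \1_(t @^-1` [set nat_of_ord i]) v)%:E)).
    rewrite -sum_fine//; last first.
      move=> i _; under eq_integral do rewrite mulrC; rewrite integral_indicM.
      by rewrite setTI integral_cst// fin_numM// fin_num_measure.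
    apply: eq_bigr => i _; under eq_integral do rewrite mulrC.
    rewrite integral_indicM setTI integral_cst// fineM//; first by rewrite LB.
    by rewrite fin_num_measure.
  congr fine; rewrite -ge0_integral_sum//; last 2 first.
  - move=> i; apply/measurable_EFinP; apply: measurable_funM => //.
  - move=> i v _; rewrite lee_fin mulr_ge0// subr_ge0.
    by case/andP: (a01 i).
  apply: eq_integral => v _; rewrite sumEFin (bigD1 (Ordinal (tm v)))//=.
  rewrite big1 ?addr0; first by rewrite indicE mem_set// mulr1.
  move=> i /eqP iv; rewrite indicE memNset ?mulr0//= => tvi.
  by apply: iv; exact/val_inj.
move=> w _; congr EFin.
transitivity (\prod_(i < m) \prod_(n < N w) (if x n w \in B i then a i else 1)).
  rewrite exchange_big/= [LHS]big_mkcond/=; apply: eq_bigr => n _.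
  rewrite (bigD1 (Ordinal (tm (D (x n w)))))//= big1 ?mulr1.
    by rewrite /B in_setI [X in _ && X]mem_set// andbT.
  move=> i /eqP iv; rewrite memNset//= => -[_ /= txi].
  by apply: iv; exact/val_inj.
apply: eq_bigr => i _; rewrite -big_mkcond/= /npoints.
by rewrite prodr_const sum1_card.
Qed.

(** Rounding [g] down to multiples of 1/(k+1) leaves finitely many values. Bounded convergence then
    applies on both sides: for each outcome the product is finite, and [nu] is a finite measure. *)
Lemma poisson_laplace_functional (g : R -> R) :
  measurable_fun setT g -> (forall v, 0 <= g v <= 1) ->
  (\int[P]_w (\prod_(n < N w | x n w \in C) g (D (x n w)))%:E =
   (expR (- fine (\int[nu]_v (1 - g v)%:E)))%:E)%E.
Proof.
move=> mg g01.
pose t k v := Num.truncn (g v * k.+1%:R).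
(* The minimum only caps indices above [k.+1], which [t k] never reaches; it keeps every [a k i] in
   [0, 1]. *)
pose a k (i : nat) : R := Num.min 1 (i%:R / k.+1%:R).
pose h k v := a k (t k v).
have tle k v : (t k v <= k.+1)%N.
  rewrite /t -[X in (_ <= X)%N](@natrK R); apply: le_truncn.
  by rewrite ler_piMl//; case/andP: (g01 v).
have hE k v : h k v = (t k v)%:R / k.+1%:R.
  by rewrite /h /a; apply/min_idPr; rewrite ler_pdivrMr// mul1r ler_nat.
have a01 k i : 0 <= a k i <= 1.
  by rewrite /a ge_min lexx le_min ler01/= divr_ge0.
have mt k : measurable_fun setT (t k).
  by apply: (measurableT_comp (@measurable_truncn R)); exact: measurable_funM.
have h_g v : h ^~ v @ \oo --> g v.
  apply: (@squeeze_cvgr _ _ _ _ (fun k => g v - k.+1%:R^-1) (fun=> g v)).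
  - apply: nearW => k; have g0 : 0 <= g v * k.+1%:R.
      by rewrite mulr_ge0//; case/andP: (g01 v).
    have /andP[h1 h2] := truncn_itv g0.
    rewrite hE /t ler_pdivrMr// h1 andbT ler_pdivlMr// mulrBl mulVf//.
    by rewrite lerBlDr natr1; exact: ltW.
  - rewrite -[X in _ --> X]subr0; apply: cvgB; first exact: cvg_cst.
    exact: cvg_harmonic.
  - exact: cvg_cst.
have h01 k v : 0 <= h k v <= 1 by exact: a01.
have mh k : measurable_fun setT (h k).
  by apply: (measurableT_comp (f := a k)).
have mx n : measurable_fun setT (x n) by case: ppp.
have mN : measurable_fun setT N by case: ppp.
have mprod (f : R -> R) : measurable_fun setT f ->
    measurable_fun setT (fun w => \prod_(n < N w | x n w \in C) f (D (x n w))).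
  move=> mf; apply: (measurable_random_prod (b := fun n w => x n w \in C)
    (f := fun n w => f (D (x n w)))) => // n; first exact: measurable_mem.
  by do 2 apply: measurableT_comp => //.
have prod01 (f : R -> R) w : (forall v, 0 <= f v <= 1) ->
    0 <= \prod_(n < N w | x n w \in C) f (D (x n w)) <= 1.
  move=> f01; rewrite prodr_ge0/=; last by move=> n _; case/andP: (f01 (D (x n w))).
  by apply: prodr_ile1 => n _; exact: f01.
have cl : (\int[P]_w (\prod_(n < N w | x n w \in C) h k (D (x n w)))%:E @[k --> \oo] -->
    \int[P]_w (\prod_(n < N w | x n w \in C) g (D (x n w)))%:E)%E.
  apply: bounded_convergence => //.
  - by move=> k; exact: mprod.
  - exact: mprod.
  - by move=> k w; exact: prod01.
  - move=> w _; apply: cvg_big => //; exact: mul_continuous.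
have cr : (\int[P]_w (\prod_(n < N w | x n w \in C) h k (D (x n w)))%:E @[k --> \oo] -->
    (expR (- fine (\int[nu]_v (1 - g v)%:E)))%:E)%E.
  (* The values of [t k] are 0, ..., k+1, hence k+2 of them. *)
  have lk k := laplace_step (mt k) (tle k : forall v, (t k v < k.+2)%N) (a01 k).
  under eq_fun => k do rewrite (lk k).
  have fin1B (f : R -> R) : measurable_fun setT f -> (forall v, 0 <= f v <= 1) ->
      (\int[nu]_v (1 - f v)%:E \is a fin_num)%E.
    move=> mf f01; rewrite ge0_fin_numE; last first.
      by apply: integral_ge0 => v _; rewrite lee_fin subr_ge0; case/andP: (f01 v).
    apply: (@le_lt_trans _ _ (\int[nu]_v (cst 1 v))%E).
      apply: ge0_le_integral => //.
      - by move=> v _; rewrite lee_fin subr_ge0; case/andP: (f01 v).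
      - by apply/measurable_EFinP; exact: measurable_funB.
      - by move=> v _; rewrite lee_fin gerBl; case/andP: (f01 v).
    by rewrite integral_cst// mul1e -ge0_fin_numE// fin_num_measure.
  have cJ : fine (\int[nu]_v (1 - h k v)%:E)%E @[k --> \oo] -->
      fine (\int[nu]_v (1 - g v)%:E)%E.
    apply: fine_cvg; rewrite fineK; last exact: fin1B.
    apply: bounded_convergence => //.
    - by move=> k; exact: measurable_funB.
    - exact: measurable_funB.
    - by move=> k v; case/andP: (h01 k v) => ? ?; rewrite subr_ge0 gerBl; apply/andP.
    - by move=> v _; apply: cvgB; [exact: cvg_cst|exact: h_g].
  apply: cvg_EFin; first by apply: nearW.
  apply: (cvg_comp _ _ (cvgN cJ)); exact: continuous_expR.
exact: (cvg_unique (@ereal_hausdorff R) cl cr).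
Qed.

End poisson_laplace_functional.

(** * Two marked processes *)

Section process_events.
Context d (T : measurableType d) (R : realType) d' (E : measurableType d').
Variables (N : T -> nat) (x : nat -> T -> E).

Definition process_generators : set (set T) :=
  [set A | exists n (B : set E),
     measurable B /\ A = [set w | (n < N w)%N /\ B (x n w)] ].

(** A copy of [T] carrying the sigma-algebra of the process, so that general measurability results
    apply to membership in [process_events]. *)
Definition processType := g_sigma_algebraType process_generators.

Lemma process_eventsE (A : set T) :
  process_events N x A = measurable (A : set processType).
Proof. by []. Qed.

Lemma process_events_point n (B : set E) : measurable B ->
  process_events N x [set w | (n < N w)%N /\ B (x n w)].
Proof. by move=> mB; apply: sub_sigma_algebra; exists n, B. Qed.

Lemma process_events_gt n : process_events N x [set w | (n < N w)%N].
Proof.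
rewrite (_ : [set w | _] = [set w | (n < N w)%N /\ [set: E] (x n w)]).
  exact: process_events_point.
by apply/seteqP; split=> w //= [].
Qed.

Lemma process_events_count n : process_events N x (N @^-1` [set n]).
Proof.
rewrite process_eventsE; case: n => [|n].
  rewrite (_ : _ @^-1` _ = ~` [set w | (0 < N w)%N]).
    by apply: measurableC; rewrite -process_eventsE; exact: process_events_gt.
  by apply/seteqP; split=> w /=; [move=> -> | move/negP; rewrite -eqn0Ngt => /eqP].
rewrite (_ : _ @^-1` _ = [set w | (n < N w)%N] `\` [set w | (n.+1 < N w)%N]).
  by apply: measurableD; rewrite -process_eventsE; exact: process_events_gt.
apply/seteqP; split=> w /=; first by move=> ->; rewrite ltnSn ltnn.
by move=> [h1 /negP]; rewrite -leqNgt => h2; apply/eqP; rewrite eqn_leq h1 h2.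
Qed.

Lemma process_eventsI A B : process_events N x A -> process_events N x B ->
  process_events N x (A `&` B).
Proof. by rewrite !process_eventsE; exact: measurableI. Qed.

Lemma process_events_measurable :
  measurable_fun setT N -> (forall n, measurable_fun setT (x n)) ->
  process_events N x `<=` measurable.
Proof.
move=> mN mx; apply: smallest_sub; first exact: sigma_algebra_measurable.
move=> _ [n [B [mB ->]]].
rewrite (_ : [set w | _] = N @^-1` [set k | (n < k)%N] `&` x n @^-1` B)//.
apply: measurableI; rewrite -[X in measurable X]setTI; first exact: mN.
exact: mx.
Qed.

Lemma process_prod_event (f : nat -> E -> R) (U : set R) :
  (forall n, measurable_fun setT (f n)) -> measurable U ->
  process_events N x ((fun w => \prod_(n < N w) f n (x n w)) @^-1` U).
Proof.
move=> mf mU; rewrite process_eventsE.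
(* Beyond the number of points [x n] is not observable through the process, so the factor is
   replaced there by a constant, which the product never meets. *)
pose F n (w : processType) := if (n < N w)%N then f n (x n w) else 0.
have mN : measurable_fun setT (N : processType -> nat).
  move=> _ K _; rewrite setTI (_ : _ @^-1` K = \bigcup_(n in K) N @^-1` [set n]).
    by apply: bigcup_measurable => n _; exact: process_events_count.
  by apply/seteqP; split=> [w Kw|w [n Kn /= wn]]; [exists (N w)|rewrite /preimage/= wn].
have mF n : measurable_fun setT (F n).
  move=> _ V mV; rewrite setTI.
  have mfV : measurable ([set w | (n < N w)%N /\ (f n @^-1` V) (x n w)] : set processType).
    rewrite -process_eventsE; apply: process_events_point.
    by rewrite -[X in measurable X]setTI; exact: mf.
  have mgt : measurable ([set w | (n < N w)%N] : set processType).
    by rewrite -process_eventsE; exact: process_events_gt.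
  (* Whether 0 lies in [V] decides if the outcomes with at most [n] points belong to the
     preimage. *)
  have [V0|V0] := pselect (V 0).
    rewrite (_ : _ @^-1` V = [set w | (n < N w)%N /\ (f n @^-1` V) (x n w)] `|`
        ~` [set w | (n < N w)%N]); first by apply: measurableU => //; exact: measurableC.
    apply/seteqP; split=> w /=; rewrite /F.
      by case: ifP => nN; [left|right].
    by case=> [[-> //]|/negP/negbTE ->].
  rewrite (_ : _ @^-1` V = [set w | (n < N w)%N /\ (f n @^-1` V) (x n w)])//.
  by apply/seteqP; split=> w /=; rewrite /F; [case: ifP|case=> ->].
rewrite (_ : (fun w => _) = (fun w : processType => \prod_(n < N w | true) F n w)).
  rewrite -[X in measurable X]setTI.
  by apply: (measurable_random_prod (b := fun _ _ => true)).
apply/funext => w; apply: eq_bigr => n _; by rewrite /F ltn_ord.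
Qed.

End process_events.

Section two_networks.
Local Open Scope ereal_scope.
Context d (T : measurableType d) (R : realType) (P : probability T R).
Variables (Ns : T -> nat) (x : nat -> T -> R3 R) (Hs : nat -> T -> R).
Variables (Nt : T -> nat) (u : nat -> T -> R3 R) (Ht : nat -> T -> R).
Hypotheses (mNs : measurable_fun setT Ns) (mx : forall n, measurable_fun setT (x n)).
Hypotheses (mNt : measurable_fun setT Nt) (mu : forall n, measurable_fun setT (u n)).
Hypothesis mHs : forall n, measurable_fun setT (Hs n).
Hypothesis mHt : forall n, measurable_fun setT (Ht n).
Hypothesis indep : mutually_independent P (source_events Ns x Hs Nt u Ht).

Let ps_measurable : process_events Ns x `<=` measurable.
Proof. exact: process_events_measurable. Qed.

Let pt_measurable : process_events Nt u `<=` measurable.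
Proof. exact: process_events_measurable. Qed.

Lemma processes_independent As At :
  process_events Ns x As -> process_events Nt u At ->
  P (As `&` At) = P As * P At.
Proof.
move=> mAs mAt.
pose i (k : 'I_2) := if k == ord0 then sat_process else ut_process.
pose A (k : 'I_2) := if k == ord0 then As else At.
have := @indep 2%N i A; rewrite !big_ord_recl big_ord0 mule1 /A/= => <-.
- congr (P _); apply/seteqP; split=> w.
    by move=> [Asw Atw] k _ /=; case: ifP.
  by move=> h; split; [exact: (h ord0 Logic.I)|exact: (h (lift ord0 ord0) Logic.I)].
- move=> [[|[|//]] hk] [[|[|//]] hl]; rewrite /i/= => // _; exact/val_inj.
- by move=> [[|[|//]] hk]; rewrite /i/=.
Qed.

Section marks.
Variables (psis psit : R3 R * R -> R).
Hypotheses (mpsis : measurable_fun setT psis) (mpsit : measurable_fun setT psit).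
Hypothesis psis01 : forall zh, (0 <= psis zh <= 1)%R.
Hypothesis psit01 : forall zh, (0 <= psit zh <= 1)%R.

Let phis := mark_mean P Hs (fun=> psis).
Let phit := mark_mean P Ht (fun=> psit).

Let marks_fixed_counts n m :
  \int[P]_(w in Ns @^-1` [set n] `&` Nt @^-1` [set m])
     (\prod_(j < n) psis (x j w, Hs j w) * \prod_(k < m) psit (u k w, Ht k w))%R%:E =
  \int[P]_(w in Ns @^-1` [set n] `&` Nt @^-1` [set m])
     (\prod_(j < n) phis j (x j w) * \prod_(k < m) phit k (u k w))%R%:E.
Proof.
(* Both networks in one list: index [j < n] is satellite [j], index [n + k] is terrestrial user [k].
   A single averaging then treats all fading powers. *)
pose Z j := if (j < n)%N then x j else u (j - n)%N.
pose H j := if (j < n)%N then Hs j else Ht (j - n)%N.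
pose q j := if (j < n)%N then psis else psit.
pose I j := if (j < n)%N then sat_fading j else ut_fading (j - n)%N.
have mZ j : measurable_fun setT (Z j) by rewrite /Z; case: ifP.
have mH j : measurable_fun setT (H j) by rewrite /H; case: ifP.
have mq j : measurable_fun setT (q j) by rewrite /q; case: ifP.
have q01 j zh : (0 <= q j zh <= 1)%R by rewrite /q; case: ifP.
(* With the counts fixed to [n] and [m], a condition on a listed point automatically concerns a
   genuine point, and is therefore an event of its process. *)
pose AA := [set A : set T | exists As At, [/\ process_events Ns x As,
  process_events Nt u At, As `<=` Ns @^-1` [set n], At `<=` Nt @^-1` [set m] &
  A = As `&` At]].
have AAm : AA `<=` measurable.
  move=> _ [As [At [mAs mAt _ _ ->]]].
  by apply: measurableI; [exact: ps_measurable|exact: pt_measurable].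
have AAp A j U : (j < n + m)%N -> AA A -> measurable U -> AA (A `&` Z j @^-1` U).
  move=> jnm [As [At [mAs mAt Asn Atm ->]]] mU; rewrite /Z; case: ltnP => jn.
    exists (As `&` [set w | (j < Ns w)%N /\ U (x j w)]), At; split => //.
    - by apply: process_eventsI => //; exact: process_events_point.
    - by move=> w [/Asn].
    - apply/seteqP; split=> w /=; last by move=> [[? [_ ?]] ?].
      by move=> [[/[dup] /Asn /= -> ? ?] ?].
  exists As, (At `&` [set w | (j - n < Nt w)%N /\ U (u (j - n)%N w)]); split => //.
  - by apply: process_eventsI => //; exact: process_events_point.
  - by move=> w [/Atm].
  - apply/seteqP; split=> w /=; last by move=> [? [? [_ ?]]].
    move=> [[? /[dup] /Atm /= -> ?] ?]; do !split => //.
    by rewrite ltn_subLR.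
have AAi A (V : nat -> set R) : AA A -> (forall j, measurable (V j)) ->
    P (A `&` [set w | forall j, (j < n + m)%N -> V j (H j w)]) =
    P A * \prod_(j < n + m) P (H j @^-1` V j).
  move=> [As [At [mAs mAt Asn Atm ->]]] mV.
  rewrite (processes_independent mAs mAt).
  (* Slots 0 and 1 hold the two processes and slot k+2 holds mark k, so one instance of mutual
     independence covers everything. *)
  pose i (k : 'I_(n + m).+2) := match val k with
    0%N => sat_process | 1%N => ut_process | k'.+2 => I k' end.
  pose B (k : 'I_(n + m).+2) := match val k with
    0%N => As | 1%N => At | k'.+2 => H k' @^-1` V k' end.
  have := @indep (n + m).+2%N i B; rewrite !big_ord_recl /= -muleA => <-.
  - congr (P _); apply/seteqP; split=> w /=.
      move=> [[Asw Atw] h] [[|[|k]] hk] _ //=.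
      by apply: h.
    move=> h; do !split.
    + exact: (h ord0 Logic.I).
    + exact: (h (lift ord0 ord0) Logic.I).
    + by move=> j jnm; exact: (h (@Ordinal (n + m).+2 j.+2 jnm) Logic.I).
  - move=> [[|[|k]] hk] [[|[|l]] hl]; rewrite /i/= /I => //= e;
      apply/val_inj => //=.
    + by move: e; case: ifP.
    + by move: e; case: ifP.
    + by move: e; case: ifP.
    + by move: e; case: ifP.
    + move: e; case: (ltnP k n) => kn; case: (ltnP l n) => ln // [] kl.
        by rewrite kl.
      by rewrite -(subnK kn) kl subnK.
  - move=> [[|[|k]] hk]; rewrite /i /B//= /I /H; case: ifP => _ /=.
      by exists (V k).
    by exists (V k).
have AA0 : AA (Ns @^-1` [set n] `&` Nt @^-1` [set m]).
  exists (Ns @^-1` [set n]), (Nt @^-1` [set m]); split => //;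
  exact: process_events_count.
have split_prod (f : nat -> R) (f1 f2 : nat -> R) :
    (forall j, (j < n)%N -> f j = f1 j) -> (forall k, f (n + k)%N = f2 k) ->
    (\prod_(j < n + m) f j = \prod_(j < n) f1 j * \prod_(k < m) f2 k)%R.
  move=> ff1 ff2; rewrite big_split_ord; congr (_ * _)%R; apply: eq_bigr => k _ //=.
  exact: ff1.
have nk k : (n + k < n)%N = false by rewrite ltnNge leq_addr.
transitivity (\int[P]_(w in Ns @^-1` [set n] `&` Nt @^-1` [set m])
    (\prod_(j < n + m) q j (Z j w, H j w))%R%:E).
  apply: eq_integral => w _; congr EFin; apply/esym.
  apply: (split_prod (fun j => q j (Z j w, H j w))
    (fun j => psis (x j w, Hs j w)) (fun k => psit (u k w, Ht k w))).
    by move=> j jn; rewrite /q /Z /H jn.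
  by move=> k; rewrite /q /Z /H nk addKn.
rewrite (independent_marks_integral mZ mH mq q01 AAm AAp AAi AA0).
apply: eq_integral => w _; congr EFin.
apply: (split_prod (fun j => mark_mean P H q j (Z j w))
  (fun j => phis j (x j w)) (fun k => phit k (u k w))).
  by move=> j jn; rewrite /phis /mark_mean /q /Z /H jn.
by move=> k; rewrite /phit /mark_mean /q /Z /H nk addKn.
Qed.

Let phis01 j z : (0 <= phis j z <= 1)%R.
Proof. exact: mark_mean01. Qed.

Let phit01 j z : (0 <= phit j z <= 1)%R.
Proof. exact: mark_mean01. Qed.

Let mphis j : measurable_fun setT (phis j).
Proof. exact: measurable_mark_mean. Qed.

Let mphit j : measurable_fun setT (phit j).
Proof. exact: measurable_mark_mean. Qed.

Let prod01 (n : nat) (f : nat -> R) : (forall j, 0 <= f j <= 1)%R ->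
  (0 <= \prod_(j < n) f j <= 1)%R.
Proof.
move=> f01; rewrite prodr_ge0/=; last by move=> j _; case/andP: (f01 j).
by apply: prodr_ile1 => j _; exact: f01.
Qed.

Let mrp (N : T -> nat) (f : nat -> T -> R) : measurable_fun setT N ->
  (forall j, measurable_fun setT (f j)) ->
  measurable_fun setT (fun w => \prod_(j < N w) f j w)%R.
Proof.
by move=> mN mf; apply: (measurable_random_prod (b := fun _ _ => true)).
Qed.

Let prod2_01 (a b : R) : (0 <= a <= 1 -> 0 <= b <= 1 -> 0 <= a * b <= 1)%R.
Proof. by move=> /andP[? ?] /andP[? ?]; rewrite mulr_ge0//= mulr_ile1. Qed.

Let marks_mean_integral :
  \int[P]_w (\prod_(j < Ns w) psis (x j w, Hs j w) *
     \prod_(k < Nt w) psit (u k w, Ht k w))%R%:E =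
  \int[P]_w (\prod_(j < Ns w) phis j (x j w) * \prod_(k < Nt w) phit k (u k w))%R%:E.
Proof.
have mNsn n : measurable (Ns @^-1` [set n]).
  by rewrite -[X in measurable X]setTI; exact: mNs.
have mNtn n : measurable (Nt @^-1` [set n]).
  by rewrite -[X in measurable X]setTI; exact: mNt.
have Tn : \bigcup_n Ns @^-1` [set n] = setT.
  by apply/seteqP; split=> // w _; exists (Ns w).
have Tm n : Ns @^-1` [set n] = \bigcup_m (Ns @^-1` [set n] `&` Nt @^-1` [set m]).
  by apply/seteqP; split=> [w wn|w [m _ []]]//; exists (Nt w).
have split_int (f : T -> R) : measurable_fun setT f -> (forall w, 0 <= f w)%R ->
    \int[P]_w (f w)%:E = \sum_(n <oo) \sum_(m <oo)
      \int[P]_(w in Ns @^-1` [set n] `&` Nt @^-1` [set m]) (f w)%:E.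
  move=> mf f0; rewrite -Tn ge0_integral_bigcup//; last 3 first.
  - by apply/measurable_EFinP; exact: measurable_funTS.
  - by move=> w _; rewrite lee_fin.
  - by move=> i j _ _ [w [/= <- <-]].
  apply: eq_eseriesr => n _; rewrite {1}Tm ge0_integral_bigcup//.
  - by move=> m; exact: measurableI.
  - by apply/measurable_EFinP; exact: measurable_funTS.
  - by move=> w _; rewrite lee_fin.
  - by move=> i j _ _ [w [[_ /= <-] [_ /= <-]]].
have mpsi2 (psi : R3 R * R -> R) (y : T -> R3 R) (h : T -> R) :
    measurable_fun setT psi -> measurable_fun setT y -> measurable_fun setT h ->
    measurable_fun setT (fun w => psi (y w, h w)).
  move=> mpsi my mh; apply: (measurableT_comp mpsi); exact: measurable_fun_pair.
rewrite split_int; last 2 first.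
- apply: measurable_funM.
    by apply: (@mrp Ns (fun j w => psis (x j w, Hs j w))) => // j; exact: mpsi2.
  by apply: (@mrp Nt (fun j w => psit (u j w, Ht j w))) => // j; exact: mpsi2.
- by move=> w; apply: mulr_ge0; apply: prodr_ge0 => j _;
    [case/andP: (psis01 (x j w, Hs j w))|case/andP: (psit01 (u j w, Ht j w))].
rewrite split_int; last 2 first.
- apply: measurable_funM.
    apply: (@mrp Ns (fun j w => phis j (x j w))) => // j.
    exact: (measurableT_comp (mphis j)).
  apply: (@mrp Nt (fun j w => phit j (u j w))) => // j.
  exact: (measurableT_comp (mphit j)).
- by move=> w; apply: mulr_ge0; apply: prodr_ge0 => j _;
    [case/andP: (phis01 j (x j w))|case/andP: (phit01 j (u j w))].
apply: eq_eseriesr => n _; apply: eq_eseriesr => m _.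
transitivity (\int[P]_(w in Ns @^-1` [set n] `&` Nt @^-1` [set m])
    (\prod_(j < n) psis (x j w, Hs j w) * \prod_(k < m) psit (u k w, Ht k w))%R%:E).
  by apply: eq_integral => w /set_mem[/= -> ->].
rewrite marks_fixed_counts.
by apply: eq_integral => w /set_mem[/= -> ->].
Qed.

(** Once the marks are averaged, one functional per process remains. Their expectations separate by
    the same averaging lemma with a single mark: the satellite product acts as the position, the
    terrestrial product as the mark. *)
Lemma two_networks_marks_integral :
  \int[P]_w (\prod_(j < Ns w) psis (x j w, Hs j w) *
     \prod_(k < Nt w) psit (u k w, Ht k w))%R%:E =
  \int[P]_w (\prod_(j < Ns w) phis j (x j w))%R%:E *
  \int[P]_w (\prod_(k < Nt w) phit k (u k w))%R%:E.
Proof.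
rewrite marks_mean_integral.
pose F w := (\prod_(j < Ns w) phis j (x j w))%R.
pose G w := (\prod_(j < Nt w) phit j (u j w))%R.
(* The averaging lemma asks for a kernel with values in [0, 1] on the whole of [R * R]; on the
   values actually taken, [clamp] is the identity. *)
pose clamp (z : R) := Num.max 0%R (Num.min 1%R z).
have clamp01 z : (0 <= clamp z <= 1)%R.
  by rewrite /clamp le_max lexx/= ge_max ler01/= ge_min lexx.
have clampE z : (0 <= z <= 1)%R -> clamp z = z.
  by move=> /andP[z0 z1]; rewrite /clamp (min_idPr z1) (max_idPr z0).
have mclamp : measurable_fun setT clamp.
  by apply: measurable_maxr => //; exact: measurable_minr.
have F01 w : (0 <= F w <= 1)%R by exact: (@prod01 _ (fun j => phis j (x j w))).
have G01 w : (0 <= G w <= 1)%R by exact: (@prod01 _ (fun j => phit j (u j w))).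
have mF : measurable_fun setT F.
  apply: (@mrp Ns (fun j w => phis j (x j w))) => // j.
  exact: (measurableT_comp (mphis j)).
have mG : measurable_fun setT G.
  apply: (@mrp Nt (fun j w => phit j (u j w))) => // j.
  exact: (measurableT_comp (mphit j)).
pose q (j : nat) (zh : R * R) := (clamp zh.1 * clamp zh.2)%R.
have mq j : measurable_fun setT (q j).
  by apply: measurable_funM; exact: measurableT_comp.
have q01 j zh : (0 <= q j zh <= 1)%R by exact: prod2_01.
have := @independent_marks_integral _ _ _ T R R R P 1%N (fun=> F) (fun=> G) q
  (fun=> mF) (fun=> mG) mq q01 (process_events Ns x) ps_measurable.
move=> /(_ _ _ setT) key.
transitivity (\int[P]_w (\prod_(j < 1) q j (F w, G w))%R%:E).
  by apply: eq_integral => w _; rewrite big_ord1 /q/= !clampE.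
rewrite key; last 3 first.
- move=> A j U _ mA mU; apply: process_eventsI => //.
  exact: process_prod_event.
- move=> A V mA mV; rewrite big_ord1.
  rewrite (_ : [set w | _] = G @^-1` V 0%N); last first.
    apply/seteqP; split=> w /=; first exact.
    by move=> GV [].
  by apply: processes_independent => //; exact: process_prod_event.
- by rewrite process_eventsE; exact: measurableT.
rewrite -ge0_integralZr//; last 3 first.
- exact/measurable_EFinP.
- by move=> w _; rewrite lee_fin; case/andP: (F01 w).
- by apply: integral_ge0 => w _; rewrite lee_fin; case/andP: (G01 w).
apply: eq_integral => w _; rewrite big_ord1 mark_meanE//.
under eq_integral do rewrite /q/= !clampE// EFinM.
rewrite ge0_integralZl//.
- exact/measurable_EFinP.
- by move=> v _; rewrite lee_fin; case/andP: (G01 v).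
- by rewrite lee_fin; case/andP: (F01 w).
Qed.

End marks.

End two_networks.

(** * Distances from the user *)

(** Half-lines form a pi-system generating the Borel sets, and finiteness on each []-oo, n]] gives
    the exhaustion that uniqueness demands. *)
Lemma measure_unique_lray (R : realType) (m1 m2 : {measure set R -> \bar R}) :
  (forall r : R, m1 `]-oo, r]%classic = m2 `]-oo, r]%classic) ->
  (forall r : R, m1 `]-oo, r]%classic < +oo)%E ->
  forall A, measurable A -> m1 A = m2 A.
Proof.
move=> m12 m1oo A mA.
pose G := [set B : set R | exists r, B = `]-oo, r]%classic].
have itvI (r1 r2 : R) : `]-oo, r1]%classic `&` `]-oo, r2]%classic =
    `]-oo, Num.min r1 r2]%classic.
  by apply/seteqP; split=> x /=; rewrite !in_itv/= le_min => /andP.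
apply: (measure_unique G (fun n => `]-oo, n%:R]%classic)).
- apply/seteqP; split.
    move=> B; rewrite [X in X B -> _](@RGenOInfty.measurableE R).
    apply: smallest_sub; first exact: smallest_sigma_algebra.
    move=> _ [r ->]; rewrite -setCitvl -[X in <<s _ >> X]setTD.
    by apply: sigma_algebraCD; apply: sub_sigma_algebra; exists r.
  apply: smallest_sub; first exact: sigma_algebra_measurable.
  by move=> _ [r ->].
- by move=> _ _ [r1 ->] [r2 ->]; exists (Num.min r1 r2).
- by move=> n; exists n%:R.
- apply/seteqP; split => // x _; exists (Num.truncn `|x|).+1 => //=.
  by rewrite in_itv/= (le_trans _ (ltW (truncnS_gt _)))// ler_norm.
- by move=> _ [r ->].
- by move=> n; exact: m1oo.
- by [].
Qed.

Lemma FTC2_is_derive (R : realType) (F f : R -> R) (a b : R) : a <= b ->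
  continuous f -> (forall x, is_derive x (1 : R) F (f x)) ->
  (\int[lebesgue_measure]_(x in `[a, b]) (f x)%:E = (F b - F a)%:E)%E.
Proof.
rewrite le_eqVlt => /predU1P[<- _ _|ab cf dF].
  by rewrite set_itv1 integral_set1 subrr.
have dF1 x : derivable F x 1 by case: (dF x).
have cF : continuous F.
  by move=> x; apply: differentiable_continuous; exact/derivable1_diffP.
rewrite (@continuous_FTC2 _ f F)//.
- exact: continuous_subspaceT.
- split; first by move=> x _; exact: dF1.
  + exact/cvg_at_right_filter/cF.
  + exact/cvg_at_left_filter/cF.
- by move=> x _; rewrite derive1E; exact: derive_val.
Qed.

Section radial_measure.
Local Open Scope ereal_scope.
Context (R : realType) (k lo hi : R).
Hypotheses (k0 : (0 <= k)%R) (lo0 : (0 <= lo)%R).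

Definition radial_weight (v : R) : R := (\1_`[lo, hi] v * (k * v))%R.

Lemma radial_weight_ge0 v : (0 <= radial_weight v)%R.
Proof.
rewrite /radial_weight indicE; case: (boolP (v \in _)) => [/set_mem|_]; last by rewrite mul0r.
by rewrite /= in_itv/= mul1r => /andP[lov _]; rewrite mulr_ge0//; exact: le_trans lov.
Qed.

Lemma measurable_radial_weight : measurable_fun setT radial_weight.
Proof.
apply: measurable_funM; first exact: measurable_indic.
by apply: measurable_funM => //; exact: measurable_id.
Qed.

Lemma radial_integral (t : R) : (lo <= t)%R ->
  \int[lebesgue_measure]_(v in `[lo, t]) (k * v)%:E = (k * (t ^+ 2 - lo ^+ 2) / 2)%:E.
Proof.
move=> lot.
have dF (v : R) : is_derive v (1%R : R) (fun v => k * v ^+ 2 / 2)%R (k * v)%R.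
  by apply: is_derive_eq; rewrite /GRing.scale/=; field.
have cf : continuous (fun v : R => k * v)%R.
  by move=> v; apply: cvgM; [exact: cvg_cst|exact: cvg_id].
by rewrite (FTC2_is_derive lot cf dF); congr EFin; field.
Qed.

Lemma radial_weight_oo :
  \int[lebesgue_measure]_v (radial_weight v)%:E < +oo.
Proof.
rewrite integral_indicM setTI.
have [lohi|hilo] := leP lo hi; first by rewrite radial_integral// ltry.
by rewrite set_itv_ge ?integral_set0// bnd_simp -ltNge.
Qed.

Definition radial_measure :=
  @weighted_law_finite_measure _ _ (measurableTypeR R) R R (@lebesgue_measure R)
    radial_weight id measurable_radial_weight radial_weight_ge0
    (@measurable_id _ _ setT) radial_weight_oo.

Lemma radial_measure_lray (t : R) : (lo <= hi)%R ->
  radial_measure `]-oo, t]%classic =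
  (if t < lo then 0 else k * (Num.min t hi ^+ 2 - lo ^+ 2) / 2)%R%:E.
Proof.
move=> lohi; transitivity (\int[lebesgue_measure]_(v in `]-oo, t]%classic)
    (radial_weight v)%:E) => //.
rewrite integral_indicM.
rewrite (_ : _ `&` _ = `[lo, Num.min t hi]%classic); last first.
  apply/seteqP; split=> v /=; rewrite !in_itv/= le_min.
    by move=> [-> /andP[-> ->]].
  by move=> /andP[-> /andP[-> ->]].
case: ifPn => [tlo|]; last first.
  by rewrite -leNgt => lot; rewrite radial_integral// le_min lot.
rewrite set_itv_ge ?integral_set0// bnd_simp -ltNge.
by rewrite (le_lt_trans _ tlo)// ge_min lexx.
Qed.

Lemma integral_radial_measure (f : R -> R) :
  measurable_fun setT f -> (forall v, 0 <= f v)%R ->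
  \int[radial_measure]_v (f v)%:E =
  \int[lebesgue_measure]_(v in `[lo, hi]) (k * v * f v)%:E.
Proof.
move=> mf f0; rewrite ge0_integral_weighted_law_finite//; last first.
  exact/measurable_EFinP.
transitivity (\int[lebesgue_measure]_v (\1_`[lo, hi] v * (k * v * f v))%:E).
  by apply: eq_integral => v _; rewrite -EFinM /radial_weight -!mulrA.
by rewrite integral_indicM setTI.
Qed.

End radial_measure.

Section satellite_sphere.
Variables (R : realType) (p : system R) (p_admissible : admissible p).

Local Notation Rs := (R_s p).
Local Notation Rus := (R_us p).
(** Law of cosines for the distance from the user to a point of colatitude [th]; the longitude does
    not enter. *)
Let D (th : R) := Num.sqrt (Rs ^+ 2 + Rus ^+ 2 - 2 * Rs * Rus * cos th).

Let Rus0 : 0 < Rus. Proof. exact: R_us_gt0. Qed.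
Let RusRs : Rus < Rs. Proof. exact: R_us_lt_R_s. Qed.
Let Rs0 : 0 < Rs. Proof. exact: lt_trans RusRs. Qed.

Lemma R_min_gt0 : 0 < R_min p. Proof. by rewrite subr_gt0. Qed.

Let s0 : 0 <= sin (theta_us p) < 1.
Proof.
have /andP[t0 tpi] := theta_us_itv p_admissible.
have pi0 := @pi_gt0 R.
rewrite sin_ge0_pi ?t0/=; last by lra.
have c0 : 0 < cos (theta_us p) by apply: cos_gt0_pihalf; lra.
have c2 : 0 < cos (theta_us p) ^+ 2 by rewrite exprn_gt0.
by rewrite ltNge; apply/negP => s1; have := cos2Dsin2 (theta_us p); nra.
Qed.

Let sqrRusRs : Rus ^+ 2 < Rs ^+ 2.
Proof. by rewrite ltr_pXn2r// nnegrE ltW. Qed.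

Let sqrtr_le (a b : R) : 0 <= b -> (Num.sqrt a <= b) = (a <= b ^+ 2).
Proof. by move=> b0; rewrite -[in LHS](ger0_norm b0) -sqrtr_sqr ler_sqrt ?sqr_ge0. Qed.

Lemma R_min_lt_R_max : R_min p < R_max p.
Proof.
case/andP: s0 => s0' s1; rewrite /R_min /R_max ltrBrDr.
apply: le_lt_trans (ler_norm _) _; rewrite -sqrtr_sqr.
(* This is half the difference of the two squares compared in [h]. *)
have h1 : 0 < Rus * (1 - sin (theta_us p)) * (Rs - Rus).
  by rewrite !mulr_gt0// subr_gt0.
have h : (Rs - Rus + Rus * sin (theta_us p)) ^+ 2 <
    Rs ^+ 2 - Rus ^+ 2 + Rus ^+ 2 * sin (theta_us p) ^+ 2 by nra.
by rewrite ltr_sqrt// (le_lt_trans _ h)// sqr_ge0.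
Qed.

(** It guarantees that the cosine at the edge of a cap, computed in [sat_intensity_radial], is at
    least -1. *)
Lemma R_max_le : R_max p <= Rs + Rus.
Proof.
case/andP: s0 => s0' s1; rewrite /R_max lerBlDr sqrtr_le; last first.
  by rewrite !addr_ge0 ?mulr_ge0// ltW.
have h1 : 0 <= Rs * Rus by rewrite mulr_ge0// ltW.
have h2 : 0 <= Rs * Rus * sin (theta_us p) by rewrite mulr_ge0// ltW.
have h3 : 0 <= Rus * Rus * sin (theta_us p) by rewrite !mulr_ge0// ltW.
nra.
Qed.

Lemma enorm_spherical th ph : enorm (spherical Rs th ph) = Rs.
Proof.
rewrite /enorm /dot/= -[RHS](ger0_norm (ltW Rs0)) -sqrtr_sqr; congr Num.sqrt.
transitivity (Rs ^+ 2 * (cos th ^+ 2 + sin th ^+ 2 * (cos ph ^+ 2 + sin ph ^+ 2))).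
  by ring.
by rewrite !cos2Dsin2 mulr1 cos2Dsin2 mulr1.
Qed.

Lemma dist_spherical th ph : dist (spherical Rs th ph) (u1 p) = D th.
Proof.
rewrite /dist /enorm /dot/= /D !subr0; congr Num.sqrt.
transitivity (Rs ^+ 2 * (cos th ^+ 2 + sin th ^+ 2 * (cos ph ^+ 2 + sin ph ^+ 2)) +
    Rus ^+ 2 - 2 * Rs * Rus * cos th); first by ring.
by rewrite cos2Dsin2 mulr1 cos2Dsin2 mulr1.
Qed.

Let mD : measurable_fun setT D.
Proof.
apply: continuous_measurable_fun => th.
apply: (@continuous_comp R R R (fun th => Rs ^+ 2 + Rus ^+ 2 - 2 * Rs * Rus * cos th)
  Num.sqrt); last exact: sqrt_continuous.
apply: cvgB; first exact: cvg_cst.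
by apply: cvgM; [exact: cvg_cst|exact: continuous_cos].
Qed.

(** Coefficient of [sin th] in the intensity of the colatitude, after the longitude has been
    integrated out. *)
Let k := lambda_s p * (2 * pi * Rs ^+ 2).

Let k0 : 0 <= k.
Proof.
apply: mulr_ge0; first exact: ltW (lambda_s_gt0 p_admissible).
by apply: mulr_ge0; [apply: mulr_ge0; [|exact: pi_ge0]|exact: sqr_ge0].
Qed.

Let W (th : R) := \1_`[0, pi] th * (\1_`]-oo, R_max p] (D th) * (k * sin th)).

Let W0 th : 0 <= W th.
Proof.
rewrite /W indicE; case: (boolP (th \in _)) => [/set_mem|_]; last by rewrite mul0r.
by rewrite /= in_itv/= => thpi; rewrite mul1r; apply: mulr_ge0 => //;
  apply: mulr_ge0 => //; exact: sin_ge0_pi.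
Qed.

Let msin : measurable_fun setT (@sin R).
Proof. by apply: continuous_measurable_fun; exact: continuous_sin. Qed.

Let m1D (A : set R) : measurable A -> measurable_fun setT (fun th => \1_A (D th) : R).
Proof.
move=> mA; rewrite (_ : (fun th => _) = \1_(D @^-1` A)); last first.
  by apply/funext => th; rewrite !indicE.
by apply: measurable_indic; rewrite -[X in measurable X]setTI; exact: mD.
Qed.

Let mW : measurable_fun setT W.
Proof.
apply: measurable_funM; first exact: measurable_indic.
apply: measurable_funM; last exact: measurable_funM.
exact: m1D.
Qed.

Let int_sin (a b : R) : a <= b ->
  (\int[lebesgue_measure]_(th in `[a, b]) (k * sin th)%:E = (k * (cos a - cos b))%:E)%E.
Proof.
move=> ab.
have dF (v : R) : is_derive v (1 : R) (fun v => - k * cos v) (k * sin v).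
  by apply: is_derive_eq; rewrite /GRing.scale/=; ring.
have cf : continuous (fun v : R => k * sin v).
  by move=> v; apply: cvgM; [exact: cvg_cst|exact: continuous_sin].
by rewrite (FTC2_is_derive ab cf dF); congr EFin; ring.
Qed.

Lemma sat_intensity_weighted_law (A : set R) : measurable A ->
  sat_intensity p (cap p (R_max p) `&` (fun y => dist y (u1 p)) @^-1` A) =
  weighted_law (@lebesgue_measure R) W D A.
Proof.
move=> mA.
have capE th ph : \1_(cap p (R_max p) `&` (fun y => dist y (u1 p)) @^-1` A)
    (spherical Rs th ph) = \1_`]-oo, R_max p] (D th) * \1_A (D th) :> R.
  rewrite !indicE in_setI -natrM mulnb; congr (_ && _)%:R.
    transitivity (D th <= R_max p); apply/idP/idP.
    - by move=> /set_mem[_]; rewrite dist_spherical.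
    - by move=> h; apply/mem_set; split; rewrite ?dist_spherical ?enorm_spherical.
    - by move=> h; apply/mem_set; rewrite /= in_itv.
    - by move=> /set_mem; rewrite /= in_itv.
  by rewrite -(dist_spherical th ph).
rewrite /sat_intensity /sphere_area.
transitivity ((lambda_s p)%:E * \int[lebesgue_measure]_(th in `[0%R, pi])
    (\1_`]-oo, R_max p] (D th) * \1_A (D th) * (2 * pi * Rs ^+ 2) * sin th)%:E)%E.
  congr (_ * _)%E; apply: eq_integral => th _.
  under eq_integral do rewrite capE.
  rewrite integral_cst//= lebesgue_measure_itv/= lte_fin mulr_gt0 ?pi_gt0//.
  by rewrite oppr0 adde0 -EFinM; congr EFin; ring.
rewrite -ge0_integralZl//; last 3 first.
- apply/measurable_EFinP; apply: measurable_funTS.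
  apply: measurable_funM => //; apply: measurable_funM => //.
  by apply: measurable_funM; exact: m1D.
- by move=> th; rewrite /= in_itv/= => thpi; rewrite lee_fin;
  do ![apply: mulr_ge0]; rewrite ?indicE ?ler0n ?pi_ge0 ?sqr_ge0 ?sin_ge0_pi// ltW.
- by rewrite lee_fin ltW// lambda_s_gt0.
rewrite /weighted_law integral_indicM setIC -integral_indicM.
apply: eq_integral => th _; rewrite -EFinM; congr EFin.
by rewrite /k [\1_(D @^-1` A) th](_ : _ = \1_A (D th))//; ring.
Qed.

(* Archimedes' hat-box theorem, in the distance to the user. *)
Lemma sat_intensity_radial (A : set R) (lo0 : 0 <= R_min p)
    (l0 : 0 <= 2 * pi * lambda_tilde p) : measurable A ->
  sat_intensity p (cap p (R_max p) `&` (fun y => dist y (u1 p)) @^-1` A) =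
  radial_measure (R_max p) l0 lo0 A.
Proof.
move=> mA; rewrite sat_intensity_weighted_law//.
pose m1 := weighted_law_measure (@lebesgue_measure R) mW W0 mD.
have D_ge th : R_min p <= D th.
  rewrite -[X in X <= _](ger0_norm lo0) -sqrtr_sqr; apply: ler_wsqrtr.
  have := cos_le1 th; have : 0 < Rs * Rus by rewrite mulr_gt0.
  by rewrite /R_min; nra.
have key t : m1 `]-oo, t]%classic = radial_measure (R_max p) l0 lo0 `]-oo, t]%classic.
  rewrite radial_measure_lray; last exact: ltW R_min_lt_R_max.
  pose tau := Num.min t (R_max p).
  transitivity (\int[lebesgue_measure]_(th in [set th : R | (0 <= th <= pi)%R /\ (D th <= tau)%R])
      (k * sin th)%:E)%E.
    rewrite [LHS]integral_indicM integral_indicM; congr (integral _ _ _).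
    apply/seteqP; split=> th /=; rewrite !in_itv/= /tau le_min.
      by move=> [[-> ->] ->].
    by move=> [-> /andP[-> ->]].
  case: ifPn => [tlo|]; last rewrite -leNgt => lot.
    rewrite (_ : [set th | _] = set0) ?integral_set0// -subset0 => th [_ /=].
    by rewrite le_min => /andP[+ _]; rewrite leNgt (lt_le_trans tlo).
  pose b := 2 * Rs * Rus.
  have b0 : 0 < b by rewrite !mulr_gt0.
  have lotau : R_min p <= tau by rewrite le_min lot ltW// R_min_lt_R_max.
  have tau0 : 0 <= tau by exact: le_trans lotau.
  have tauhi : tau <= Rs + Rus by rewrite ge_min R_max_le orbT.
  (* Cosine of the colatitude at which the distance equals [tau]. *)
  pose c := (Rs ^+ 2 + Rus ^+ 2 - tau ^+ 2) / b.
  have c1 : -1 <= c <= 1.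
    have h1 : tau ^+ 2 <= (Rs + Rus) ^+ 2.
      by rewrite ler_pXn2r// nnegrE// addr_ge0// ltW.
    have h2 : (Rs - Rus) ^+ 2 <= tau ^+ 2 by rewrite ler_pXn2r.
    by rewrite /c ler_pdivlMr// ler_pdivrMr// /b; apply/andP; split; nra.
  (* The distance increases with the colatitude, so a ball around the user cuts out an interval of
     colatitudes starting at the pole. *)
  rewrite (_ : [set th | _] = `[0, acos c]%classic); last first.
    have acb : acos c \in `[0, pi] by rewrite in_itv/= acos_ge0//= acos_lepi.
    have lac th : 0 <= th <= pi -> (th <= acos c) = (c <= cos th).
      by move=> thpi; rewrite leNgt -ltr_cos ?in_itv//= -?leNgt acosK ?in_itv.
    apply/seteqP; split=> th /=; rewrite in_itv/= /D sqrtr_le//.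
      move=> [thpi]; rewrite lerBlDl -lerBlDr -[2 * Rs * Rus]/b => h.
      have /andP[-> _] := thpi.
      by rewrite lac// /c ler_pdivrMr// mulrC.
    move=> /andP[th0 thc]; have thpi : 0 <= th <= pi.
      by rewrite th0/= (le_trans thc)// acos_lepi.
    split => //; move: thc; rewrite lac// /c ler_pdivrMr// mulrC.
    by rewrite lerBlDl -lerBlDr.
  rewrite int_sin ?acos_ge0// cos0 acosK//; congr EFin.
  (* Here [1 - c] is [(tau ^+ 2 - R_min p ^+ 2) / b], and [k / b = pi * lambda_s p * (Rs / Rus)]:
     this quotient is the origin of the factor [Rs / Rus] in [lambda_tilde]. *)
  rewrite /c /k /lambda_tilde /R_min -/tau /b; field.
  by rewrite !gt_eqF.
apply: (measure_unique_lray (m1 := m1) (m2 := radial_measure (R_max p) l0 lo0)) => // t.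
rewrite key radial_measure_lray; last exact: ltW R_min_lt_R_max.
exact: ltry.
Qed.

End satellite_sphere.

(** * Planar areas and the distances of the terrestrial users *)

Lemma disc_area_radius (R : realType) (t : R) : 0 <= t ->
  ((@lebesgue_measure R \x @lebesgue_measure R)
     [set pq : R * R | (pq.1 ^+ 2 + pq.2 ^+ 2 <= t ^+ 2)%R] = (pi * t ^+ 2)%:E)%E.
Proof.
move=> t0.
rewrite /product_measure1.
(* The section of the disc at abscissa [v] is a chord of length [2 * sqrt (t ^+ 2 - v ^+ 2)]. *)
transitivity (\int[lebesgue_measure]_(v in `[(- t)%R, t]) (2 * Num.sqrt (t ^+ 2 - v ^+ 2))%R%:E)%E.
  rewrite [RHS]integral_mkcond; apply: eq_integral => v _.
  transitivity (@lebesgue_measure R [set y : R | v ^+ 2 + y ^+ 2 <= t ^+ 2]).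
    congr (lebesgue_measure _); rewrite xsectionE.
    by apply/seteqP; split.
  rewrite patchE; case: ifPn => [/set_mem|]; rewrite ?notin_setE/= in_itv/=.
    rewrite -ler_norml => vt.
    have vt2 : 0 <= t ^+ 2 - v ^+ 2.
      by rewrite subr_ge0 -[X in X <= _]real_normK ?num_real// ler_pXn2r.
    rewrite (_ : [set y | _] =
        `[- Num.sqrt (t ^+ 2 - v ^+ 2), Num.sqrt (t ^+ 2 - v ^+ 2)]%classic).
      rewrite lebesgue_measure_itv/= lte_fin; case: ifPn => h.
        by congr EFin; ring.
      have := sqrtr_ge0 (t ^+ 2 - v ^+ 2); move: h; rewrite -leNgt => h1 h2.
      by congr EFin; lra.
    apply/seteqP; split=> y /=; rewrite in_itv/= -ler_norml.
      by rewrite -lerBrDl => h; rewrite -sqrtr_sqr ler_wsqrtr.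
    move=> h; rewrite -lerBrDl -[X in X <= _]real_normK ?num_real//.
    by rewrite -[X in _ <= X]sqr_sqrtr// ler_pXn2r// nnegrE sqrtr_ge0.
  rewrite -ler_norml => /negP; rewrite -ltNge => vt.
  rewrite (_ : [set y | _] = set0) ?measure0//.
  rewrite -subset0 => y /=; apply/negP; rewrite -ltNge.
  have : t ^+ 2 < v ^+ 2.
    by rewrite -[X in _ < X]real_normK ?num_real// ltr_pXn2r// nnegrE ltW.
  by have := sqr_ge0 y; lra.
(* The zero radius is set apart because the substitution [v = t * sin x] has to be strictly
   increasing. *)
move: t0; rewrite le_eqVlt => /predU1P[<-|t0].
  by rewrite oppr0 set_itv1 integral_set1 expr0n mulr0.
have pi0 := @pi_gt0 R.
have dF (x : R) : is_derive x (1 : R) (fun x => t * sin x) (t * cos x).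
  by apply: is_derive_eq; rewrite /GRing.scale/=; ring.
have F'E : derive1 (fun x : R => t * sin x) = (fun x => t * cos x).
  by apply/funext => x; rewrite derive1E; exact: derive_val.
have cF' : continuous (fun x : R => t * cos x).
  by move=> x; apply: cvgM; [exact: cvg_cst|exact: continuous_cos].
have cF : continuous (fun x : R => t * sin x).
  by move=> x; apply: cvgM; [exact: cvg_cst|exact: continuous_sin].
have := @integration_by_substitution_increasing R (fun x => t * sin x)
  (fun v => 2 * Num.sqrt (t ^+ 2 - v ^+ 2)) (- (pi / 2)) (pi / 2).
rewrite F'E sinN sin_pihalf mulrN mulr1 => ->; last 7 first.
- by lra.
- move=> x y; rewrite !in_itv/= => /andP[x1 x2] /andP[y1 y2] xy.
  by rewrite ltr_pM2l// ltr_sin// in_itv/= ?x1 ?x2 ?y1 ?y2.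
- by move=> x _; exact: cF'.
- by apply: cvgP; exact/cvg_at_right_filter/cF'.
- by apply: cvgP; exact/cvg_at_left_filter/cF'.
- split; first by move=> x _; case: (dF x).
  + exact/cvg_at_right_filter/cF.
  + exact/cvg_at_left_filter/cF.
- apply: continuous_subspaceT => v; apply: cvgM; first exact: cvg_cst.
  apply: (@continuous_comp R R R (fun v => t ^+ 2 - v ^+ 2) Num.sqrt).
    by apply: cvgB; [exact: cvg_cst|exact: exprn_continuous].
  exact: sqrt_continuous.
pose f (x : R) := 2 * t ^+ 2 * cos x ^+ 2.
transitivity (\int[lebesgue_measure]_(x in `[(- (pi / 2))%R, (pi / 2)%R]) (f x)%:E)%E.
  apply: eq_integral => x /set_mem; rewrite /= in_itv/= => xpi; congr EFin.
  rewrite /f !fctE /= exprMn -[X in X - _]mulr1 -mulrBr.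
  have -> : 1 - sin x ^+ 2 = cos x ^+ 2 by rewrite -(cos2Dsin2 x) addrK.
  rewrite -exprMn sqrtr_sqr ger0_norm ?mulr_ge0 ?(ltW t0) ?cos_ge0_pihalf//.
  by rewrite /=; ring.
have df (x : R) : is_derive x (1 : R) (fun x => t ^+ 2 * (x + sin x * cos x)) (f x).
  apply: is_derive_eq; rewrite /GRing.scale/= /f.
  transitivity (t ^+ 2 * (cos x ^+ 2 + sin x ^+ 2 + (cos x ^+ 2 - sin x ^+ 2))).
    by rewrite cos2Dsin2; ring.
  by ring.
have cf : continuous f.
  move=> x; apply: cvgM; first exact: cvg_cst.
  by apply: (@continuous_comp R R R cos (fun y => y ^+ 2));
    [exact: continuous_cos|exact: exprn_continuous].
have ab : - (pi / 2) <= pi / 2 :> R by lra.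
rewrite (FTC2_is_derive ab cf df) cosN cos_pihalf; congr EFin.
by rewrite !mulr0 !addr0; field.
Qed.

Section measurable_geometry.
Variable R : realType.

Let m11 : measurable_fun setT (fun y : R3 R => y.1.1).
Proof. by apply: (measurableT_comp measurable_fst). Qed.

Let m12 : measurable_fun setT (fun y : R3 R => y.1.2).
Proof. by apply: (measurableT_comp measurable_snd). Qed.

Lemma measurable_dot_sub (u e : R3 R) :
  measurable_fun setT (fun y : R3 R => dot (y - u) e).
Proof.
rewrite /dot/=; apply: measurable_funD; first apply: measurable_funD.
- by apply: measurable_funM => //; exact: measurable_funB.
- by apply: measurable_funM => //; exact: measurable_funB.
- by apply: measurable_funM => //; exact: measurable_funB.
Qed.

Let measurable_sqrt : measurable_fun setT (@Num.sqrt R).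
Proof. by apply: continuous_measurable_fun; exact: sqrt_continuous. Qed.

Lemma measurable_dist (u : R3 R) : measurable_fun setT (fun y => dist y u).
Proof.
rewrite /dist /enorm; apply: (measurableT_comp measurable_sqrt).
rewrite /dot/=; apply: measurable_funD; first apply: measurable_funD.
- by apply: measurable_funM => //; exact: measurable_funB.
- by apply: measurable_funM => //; exact: measurable_funB.
- by apply: measurable_funM => //; exact: measurable_funB.
Qed.

Lemma measurable_cap (p : system R) rho : measurable (cap p rho).
Proof.
rewrite (_ : cap p rho = (fun y => dist y 0) @^-1` [set R_s p] `&`
    (fun y => dist y (u1 p)) @^-1` `]-oo, rho]%classic).
  by apply: measurableI; rewrite -[X in measurable X]setTI; exact: measurable_dist.
by apply/seteqP; split=> y /=; rewrite /dist subr0 in_itv.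
Qed.

Section disc.
Variables (u e1 e2 : R3 R).
Hypotheses (e11 : dot e1 e1 = 1) (e22 : dot e2 e2 = 1) (e12 : dot e1 e2 = 0).

Lemma dot_lincomb1 pq : dot (lincomb e1 e2 pq) e1 = pq.1.
Proof.
transitivity (pq.1 * dot e1 e1 + pq.2 * dot e1 e2); first by rewrite /dot/=; ring.
by rewrite e11 e12 mulr0 mulr1 addr0.
Qed.

Lemma dot_lincomb2 pq : dot (lincomb e1 e2 pq) e2 = pq.2.
Proof.
transitivity (pq.1 * dot e1 e2 + pq.2 * dot e2 e2); first by rewrite /dot/=; ring.
by rewrite e22 e12 mulr0 add0r mulr1.
Qed.

Lemma dist_lincomb pq :
  dist (u + lincomb e1 e2 pq) u = Num.sqrt (pq.1 ^+ 2 + pq.2 ^+ 2).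
Proof.
rewrite /dist /enorm addrAC subrr add0r; congr Num.sqrt.
transitivity (pq.1 * dot (lincomb e1 e2 pq) e1 + pq.2 * dot (lincomb e1 e2 pq) e2).
  by rewrite /dot/=; ring.
by rewrite dot_lincomb1 dot_lincomb2 -!expr2.
Qed.

(** As an image the disc is not visibly measurable. By Pythagoras it is also the set where the two
    coordinates [a], [b] along the frame satisfy the radius bound and already account for the whole
    squared distance to [u]. *)
Lemma measurable_planar_disc rho : measurable (planar_disc u e1 e2 rho).
Proof.
pose a y := dot (y - u) e1; pose b y := dot (y - u) e2.
have ma : measurable_fun setT a by exact: measurable_dot_sub.
have mb : measurable_fun setT b by exact: measurable_dot_sub.
rewrite (_ : planar_disc u e1 e2 rho =
    (fun y => a y ^+ 2 + b y ^+ 2) @^-1` `]-oo, rho ^+ 2]%classic `&`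
    (fun y => dist y u ^+ 2 - (a y ^+ 2 + b y ^+ 2)) @^-1` [set 0]).
  have m1 : measurable_fun setT (fun y => a y ^+ 2 + b y ^+ 2).
    by apply: measurable_funD; exact: measurable_funX.
  apply: measurableI; rewrite -[X in measurable X]setTI; first exact: m1.
  apply: measurable_funB => //; apply: measurable_funX; exact: measurable_dist.
apply/seteqP; split=> y /=; rewrite in_itv/=.
  move=> [pq h <-].
  rewrite /a /b dist_lincomb addrAC subrr add0r dot_lincomb1 dot_lincomb2.
  by rewrite sqr_sqrtr ?addr_ge0 ?sqr_ge0// subrr.
move=> [h0 /eqP]; rewrite subr_eq0 => /eqP h; exists (a y, b y) => //=.
have : dist y u ^+ 2 = dot (y - u) (y - u).
  by rewrite sqr_sqrtr// /dot !addr_ge0// -expr2 sqr_ge0.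
rewrite h => h2.
(* The component of [y - u] orthogonal to the plane; its squared length is shown to vanish. *)
pose z := y - u - lincomb e1 e2 (a y, b y).
have zE (A B : R) : dot (y - u - lincomb e1 e2 (A, B)) (y - u - lincomb e1 e2 (A, B)) =
    dot (y - u) (y - u) - 2 * (A * dot (y - u) e1 + B * dot (y - u) e2) +
    (A ^+ 2 * dot e1 e1 + B ^+ 2 * dot e2 e2 + 2 * A * B * dot e1 e2).
  by rewrite /dot/=; ring.
have z0 : dot z z = 0.
  by rewrite zE -/(a y) -/(b y) e11 e22 e12 -h2; ring.
have : z = 0.
  move: z0; clearbody z; case: z => [[z1 z2] z3]; rewrite /dot/=.
  have := sqr_ge0 z1; have := sqr_ge0 z2; have := sqr_ge0 z3; rewrite !expr2 => h3 h4 h5 h6.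
  have /eqP : z1 * z1 = 0 by lra.
  have /eqP : z2 * z2 = 0 by lra.
  have /eqP : z3 * z3 = 0 by lra.
  by rewrite !mulf_eq0 !orbb => /eqP-> /eqP-> /eqP->.
by rewrite /z => /eqP; rewrite subr_eq0 => /eqP <-; rewrite addrC subrK.
Qed.

End disc.
End measurable_geometry.

Section user_disc.
Variables (R : realType) (p : system R) (p_admissible : admissible p).
Variables (e1 e2 : R3 R).
Hypotheses (e11 : dot e1 e1 = 1) (e22 : dot e2 e2 = 1) (e12 : dot e1 e2 = 0).

Let N (pq : R * R) := Num.sqrt (pq.1 ^+ 2 + pq.2 ^+ 2).
Let S := [set pq : R * R | pq.1 ^+ 2 + pq.2 ^+ 2 <= R_ut p ^+ 2].
Let W (pq : R * R) : R := \1_S pq * lambda_ut p.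
Let mu2 := (@lebesgue_measure R \x @lebesgue_measure R)%E.

Let msq : measurable_fun setT (fun pq : R * R => pq.1 ^+ 2 + pq.2 ^+ 2).
Proof. by apply: measurable_funD; exact: measurable_funX. Qed.

Let mN : measurable_fun setT N.
Proof.
apply: (measurableT_comp (f := @Num.sqrt R)) => //.
by apply: continuous_measurable_fun; exact: sqrt_continuous.
Qed.

Let mS r : measurable [set pq : R * R | pq.1 ^+ 2 + pq.2 ^+ 2 <= r].
Proof.
rewrite (_ : [set pq | _] = (fun pq : R * R => pq.1 ^+ 2 + pq.2 ^+ 2) @^-1` `]-oo, r]%classic).
  by rewrite -[X in measurable X]setTI; exact: msq.
by apply/seteqP; split=> y /=; rewrite in_itv.
Qed.

Let W0 pq : 0 <= W pq.
Proof.
by apply: mulr_ge0; [rewrite indicE ler0n|exact: ltW (lambda_ut_gt0 p_admissible)].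
Qed.

Let mW : measurable_fun setT W.
Proof. by apply: measurable_funM => //; exact: measurable_indic (mS _). Qed.

Let Rut0 : 0 <= R_ut p. Proof. exact: ltW (R_ut_gt0 p_admissible). Qed.

(** A bound on the distance cuts the disc in a concentric disc, whose area is quadratic in the
    radius, like the mass of a half-line under the radial measure. *)
Lemma ut_intensity_radial (A : set R) (l0 : 0 <= 2 * pi * lambda_ut p) :
  measurable A ->
  ut_intensity p e1 e2 (planar_disc (u1 p) e1 e2 (R_ut p) `&`
    (fun y => dist y (u1 p)) @^-1` A) =
  radial_measure (R_ut p) l0 (lexx 0) A.
Proof.
move=> mA.
have mNA B : measurable B -> measurable (N @^-1` B).
  by move=> mB; rewrite -[X in measurable X]setTI; exact: mN.
pose m1 := weighted_law_measure mu2 mW W0 mN.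
have -> : ut_intensity p e1 e2 (planar_disc (u1 p) e1 e2 (R_ut p) `&`
    (fun y => dist y (u1 p)) @^-1` A) = m1 A.
  rewrite [RHS]integral_indicM integral_cst; last exact: measurableI (mNA _ mA) (mS _).
  congr (_ * _)%E; rewrite /disc_area; congr (mu2 _).
  apply/seteqP; split=> pq /=; rewrite dist_lincomb//.
    by move=> [? []].
  by move=> [? ?]; do !split => //; exists pq.
have key t : m1 `]-oo, t]%classic = radial_measure (R_ut p) l0 (lexx 0) `]-oo, t]%classic.
  rewrite radial_measure_lray//.
  rewrite [LHS]integral_indicM integral_cst; last exact: measurableI (mNA _ _) (mS _).
  case: ifPn => [t0|].
    rewrite (_ : _ `&` _ = set0) ?measure0 ?mule0// -subset0 => pq [/=].
    by rewrite in_itv/= leNgt (lt_le_trans t0)// sqrtr_ge0.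
  rewrite -leNgt => t0.
  have m0 : 0 <= Num.min t (R_ut p) by rewrite le_min t0.
  rewrite (_ : _ `&` _ =
    [set pq : R * R | pq.1 ^+ 2 + pq.2 ^+ 2 <= Num.min t (R_ut p) ^+ 2]).
    by rewrite [X in (_ * X)%E](disc_area_radius m0) -EFinM; congr EFin; field.
  have sqrtE (r : R) (pq : R * R) : 0 <= r -> (N pq <= r) = (pq.1 ^+ 2 + pq.2 ^+ 2 <= r ^+ 2).
    by move=> r0; rewrite -[in LHS](ger0_norm r0) -sqrtr_sqr ler_sqrt ?sqr_ge0.
  apply/seteqP; split=> pq /=; rewrite in_itv/= -(sqrtE _ _ m0) le_min /S/=.
    by rewrite -(sqrtE _ _ Rut0) => -[-> ->].
  by rewrite -(sqrtE _ _ Rut0) => /andP[].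
apply: (measure_unique_lray (m1 := m1) (m2 := radial_measure (R_ut p) l0 (lexx 0))) => // t.
by rewrite key radial_measure_lray// ltry.
Qed.

End user_disc.

(** * Laplace transforms of the fading powers *)

Lemma pochhammer_nat (R : realType) (m n : nat) :
  pochhammer (m.+1%:R : R) n = (n`! * 'C(m + n, n))%:R.
Proof.
elim: n => [|n IH]; first by rewrite /pochhammer big_ord0 bin0.
rewrite /pochhammer big_ord_recr/= -/(pochhammer _ _) IH -natrD -natrM; congr _%:R.
have := mul_bin_diag (m + n).+1 n; rewrite /= => h.
by rewrite factS addnS addSn [RHS](mulnAC _ _ _) -h; lia.
Qed.

(** The sign turns the product into m (m-1) ... (m-z+1), which vanishes for [z > m] just as the
    binomial coefficient does. *)
Lemma pochhammer_opp_nat (R : realType) (m z : nat) :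
  (-1) ^+ z * pochhammer (1 - m.+1%:R : R) z = (z`! * 'C(m, z))%:R.
Proof.
elim: z => [|z IH]; first by rewrite /pochhammer big_ord0 bin0 mulr1.
rewrite /pochhammer big_ord_recr/= -/(pochhammer _ _) exprS.
transitivity ((-1) ^+ z * pochhammer (1 - m.+1%:R : R) z * (m%:R - z%:R)).
  by rewrite -natr1; ring.
rewrite IH; have [zm|mz] := leqP z m.
  rewrite -natrB// -natrM; congr _%:R.
  by have := mul_bin_left m z; rewrite factS => h; nia.
by rewrite !bin_small ?muln0 ?mul0r// ltnW.
Qed.

(** Since C(n, z) / n! = 1 / (z! (n - z)!), dropping the first [z] terms, which are zero, leaves a
    shifted exponential series. *)
Lemma cvg_series_binomial_exp (R : realType) (z : nat) (x : R) :
  series (fun n => 'C(n, z)%:R * x ^+ n / n`!%:R) @ \oo --> x ^+ z / z`!%:R * expR x.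
Proof.
rewrite -(cvg_shiftn z).
rewrite (_ : (fun n => _) = (fun n => x ^+ z / z`!%:R * series (exp_coeff x) n)).
  by apply: cvgM; [exact: cvg_cst|exact: is_cvg_series_exp_coeff].
apply/funext => n; rewrite /series/= (@big_cat_nat _ _ _ z)//=; last exact: leq_addl.
rewrite big1_seq ?add0r; last first.
  by move=> i /andP[_]; rewrite mem_index_iota => /andP[_ iz]; rewrite bin_small// !mul0r.
rewrite -{1}[z]add0n big_addn addnK mulr_sumr; apply: eq_bigr => i _.
have f0 k : (k`!%:R : R) != 0 by rewrite pnatr_eq0 -lt0n fact_gt0.
have := bin_fact (leq_addl i z); rewrite addnK => /(congr1 (fun n => n%:R : R)).
rewrite !natrM => h; rewrite /exp_coeff/= exprD -h.
have b0 : ('C(i + z, z)%:R : R) != 0 by rewrite pnatr_eq0 -lt0n bin_gt0 leq_addl.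
by field; rewrite b0 !f0.
Qed.

(* Kummer's transformation, a consequence of Vandermonde's convolution. *)
Lemma hyp1F1_nat (R : realType) (m : nat) (x : R) :
  hyp1F1 (m.+1%:R) 1 x = expR x * \sum_(z < m.+1) 'C(m, z)%:R * x ^+ z / z`!%:R.
Proof.
apply: cvg_lim => //.
rewrite (_ : series _ = (fun N => \sum_(z < m.+1) 'C(m, z)%:R *
    series (fun n => 'C(n, z)%:R * x ^+ n / n`!%:R) N)).
  rewrite mulr_sumr; apply: cvg_big => [|z _]; first exact: add_continuous.
  rewrite [X in _ --> X](_ : _ = 'C(m, z)%:R * (x ^+ z / z`!%:R * expR x)); last by ring.
  by apply: cvgM; [exact: cvg_cst|exact: cvg_series_binomial_exp].
apply/funext => N; rewrite /series/=.
under [RHS]eq_bigr do rewrite mulr_sumr.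
rewrite exchange_big/=; apply: eq_bigr => n _.
have f0 : (n`!%:R : R) != 0 by rewrite pnatr_eq0 -lt0n fact_gt0.
have -> : pochhammer (1 : R) n = n`!%:R.
  by have := @pochhammer_nat R 0 n; rewrite add0n binn muln1.
rewrite pochhammer_nat natrM -(binomial.Vandermonde m n n) natr_sum.
transitivity ((\sum_(z < m.+1) ('C(m, z) * 'C(n, z))%:R : R) * x ^+ n / n`!%:R); last first.
  by rewrite !mulr_suml; apply: eq_bigr => z _; rewrite natrM; ring.
rewrite [X in X / _ * _ / _]mulrC mulfK//; congr (_ * _ / _).
rewrite -(big_mkord xpredT (fun z => ('C(m, z) * 'C(n, n - z))%:R)).
rewrite -(big_mkord xpredT (fun z => ('C(m, z) * 'C(n, z))%:R)).
pose f z : R := ('C(m, z) * 'C(n, z))%:R.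
(* Vandermonde's sum runs up to [n], Kummer's polynomial up to [m]; a binomial coefficient vanishes
   beyond either bound, so both equal the sum up to [m + n]. *)
have extend k : (forall j, (k < j)%N -> f j = 0) -> (k <= m + n)%N ->
    \sum_(0 <= z < k.+1) f z = \sum_(0 <= z < (m + n).+1) f z.
  move=> fk kmn; rewrite [RHS](@big_cat_nat _ _ _ k.+1)//=.
  rewrite [X in _ + X]big1_seq ?addr0// => j /andP[_].
  by rewrite mem_index_iota => /andP[kj _]; exact: fk.
rewrite [RHS](extend m) ?leq_addr//; last by move=> j mj; rewrite /f bin_small.
rewrite -(extend n) ?leq_addl//; last by move=> j nj; rewrite /f (bin_small nj) muln0.
by apply: eq_big_nat => j /andP[_ jn]; rewrite bin_sub.
Qed.

(** The substitution [t = c * x ^+ 2], proved by comparing two measures on half-lines, so that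
    measurability of [F] suffices: the Gamma integrand is unbounded at 0 when its parameter is below
    1. *)
Lemma ge0_integral_square_substitution (R : realType) (F : R -> R) (c : R) :
  measurable_fun setT F -> (forall t, 0 <= F t) -> 0 < c ->
  (\int[lebesgue_measure]_(x in `]0%R, +oo[) (2 * x * F (c * x ^+ 2))%R%:E =
   (c^-1)%:E * \int[lebesgue_measure]_(t in `]0%R, +oo[) (F t)%:E)%E.
Proof.
move=> mF F0 c0.
pose W1 (x : R) : R := \1_`]0%R, +oo[ x * (2 * x).
pose W2 (x : R) : R := \1_`]0%R, +oo[ x * c^-1.
have W10 x : 0 <= W1 x.
  rewrite /W1 indicE; case: (boolP (x \in _)) => [/set_mem|_]; last by rewrite mul0r.
  by rewrite /= in_itv/= andbT mul1r => x0; rewrite mulr_ge0// ltW.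
have W20 x : 0 <= W2 x by rewrite /W2 mulr_ge0 ?indicE ?ler0n// invr_ge0 ltW.
have mW1 : measurable_fun setT W1.
  by apply: measurable_funM; [exact: measurable_indic|exact: measurable_funM].
have mW2 : measurable_fun setT W2.
  by apply: measurable_funM => //; exact: measurable_indic.
have mM : measurable_fun setT (fun x : R => c * x ^+ 2).
  by apply: measurable_funM => //; exact: measurable_funX.
pose m1 := @weighted_law_measure _ _ (measurableTypeR R) R R (@lebesgue_measure R)
  W1 _ mW1 W10 mM.
pose m2 := @weighted_law_measure _ _ (measurableTypeR R) R R (@lebesgue_measure R)
  W2 id mW2 W20 (@measurable_id _ _ setT).
have m1E (t : R) : m1 `]-oo, t]%classic = (Num.max 0 t / c)%:E.
  rewrite [LHS]integral_indicM.
  have [t0|t0] := leP t 0.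
    rewrite mul0r (_ : _ `&` _ = set0) ?integral_set0// -subset0 => x [/=].
    rewrite !in_itv/= andbT => xt x0.
    by have := lt_le_trans (mulr_gt0 c0 (exprn_gt0 2 x0)) (le_trans xt t0); rewrite ltxx.
  have s0 : 0 < Num.sqrt (t / c) by rewrite sqrtr_gt0 divr_gt0.
  rewrite (_ : _ `&` _ = `]0%R, Num.sqrt (t / c)]%classic); last first.
    apply/seteqP; split=> x /=; rewrite !in_itv/= ?andbT.
      move=> [xt x0]; rewrite x0/= -(ger0_norm (ltW x0)) -sqrtr_sqr ler_wsqrtr//.
      by rewrite ler_pdivlMr// mulrC.
    move=> /andP[x0 xt]; split => //; rewrite mulrC -ler_pdivlMr//.
    rewrite -(@sqr_sqrtr _ (t / c)); last exact: ltW (divr_gt0 t0 c0).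
    by rewrite ler_pXn2r ?nnegrE// ltW.
  rewrite integral_itv_obnd_cbnd; last first.
    by apply/measurable_EFinP; apply: measurable_funTS; exact: measurable_funM.
  have dF (x : R) : is_derive x (1 : R) (fun x => x ^+ 2) (2 * x).
    by apply: is_derive_eq; rewrite /GRing.scale/=; ring.
  have cf : continuous (fun x : R => 2 * x).
    by move=> x; apply: cvgM; [exact: cvg_cst|exact: cvg_id].
  rewrite (FTC2_is_derive (ltW s0) cf dF) sqr_sqrtr; last exact: ltW (divr_gt0 t0 c0).
  by congr EFin; rewrite expr0n subr0.
have m2E (t : R) : m2 `]-oo, t]%classic = (Num.max 0 t / c)%:E.
  rewrite [LHS]integral_indicM.
  rewrite (_ : _ `&` _ = `]0%R, t]%classic); last first.
    apply/seteqP; split=> x /=; rewrite !in_itv/= ?andbT; first by move=> [-> ->].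
    by move=> /andP[-> ->].
  rewrite integral_cst//= lebesgue_measure_itv/= lte_fin.
  case: ltP => t0; last by rewrite mule0 mul0r.
  by rewrite sube0 -EFinM mulrC.
have m12 A : measurable A -> m1 A = m2 A.
  by apply: measure_unique_lray => t; rewrite m1E ?m2E ?ltry.
have mFE : measurable_fun setT (EFin \o F) by exact/measurable_EFinP.
transitivity (\int[m1]_t (F t)%:E)%E.
  rewrite ge0_integral_weighted_law//.
  rewrite [RHS](_ : _ = \int[lebesgue_measure]_x
      (\1_`]0%R, +oo[ x * (2 * x * F (c * x ^+ 2)))%:E)%E; last first.
    by apply: eq_integral => x _; rewrite -EFinM /W1 -!mulrA.
  by rewrite integral_indicM setTI.
rewrite (eq_measure_integral m2); last by move=> A mA _; exact: m12.
rewrite ge0_integral_weighted_law//.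
rewrite (_ : (\int[lebesgue_measure]_x _)%E = \int[lebesgue_measure]_x
    (\1_`]0%R, +oo[ x * (c^-1 * F x))%:E)%E; last first.
  by apply: eq_integral => x _; rewrite -EFinM /W2 -!mulrA.
rewrite integral_indicM setTI -ge0_integralZl//.
- exact: measurable_funTS.
- by move=> x _; rewrite lee_fin.
- by rewrite lee_fin invr_ge0 ltW.
Qed.

Section extended_gamma.
Variable R : realType.

(** [Gamma] is the finite part of this integral. Its convergence is not estimated but deduced from
    the total mass 1 of the fading densities. *)
Definition extended_Gamma (a : R) : \bar R :=
  (\int[lebesgue_measure]_(t in `]0%R, +oo[) (t `^ (a - 1) * expR (- t))%:E)%E.

Lemma extended_Gamma_ge0 a : (0 <= extended_Gamma a)%E.
Proof. by apply: integral_ge0 => t _; rewrite lee_fin mulr_ge0 ?powR_ge0 ?expR_ge0. Qed.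

Let mgamma (a : R) : measurable_fun setT (fun t : R => t `^ (a - 1) * expR (- t)).
Proof.
apply: measurable_funM; first exact: measurable_powR.
by apply: measurableT_comp => //; exact: measurable_funN.
Qed.

Lemma integral_powR_gauss (a c : R) : 0 < c ->
  (\int[lebesgue_measure]_(x in `]0%R, +oo[)
     (2 * x `^ (2 * a - 1) * expR (- c * x ^+ 2))%R%:E =
   (c `^ (- a))%:E * extended_Gamma a)%E.
Proof.
move=> c0.
have := ge0_integral_square_substitution (mgamma a) _ c0.
move=> /(_ (fun t => mulr_ge0 (powR_ge0 _ _) (expR_ge0 _))) h.
have cp : 0 < c `^ (1 - a) by exact: powR_gt0.
transitivity ((c `^ (1 - a))%:E * \int[lebesgue_measure]_(x in `]0%R, +oo[)
   (2 * x * ((c * x ^+ 2) `^ (a - 1) * expR (- (c * x ^+ 2))))%:E)%E.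
  rewrite -ge0_integralZl//; last 3 first.
  - apply: measurable_funTS; apply/measurable_EFinP; apply: measurable_funM.
      exact: measurable_funM.
    apply: (measurableT_comp (mgamma a)).
    by apply: measurable_funM => //; exact: measurable_funX.
  - move=> x /=; rewrite in_itv/= andbT => x0.
    by rewrite lee_fin !mulr_ge0 ?powR_ge0 ?expR_ge0// ltW.
  - by rewrite lee_fin ltW.
  apply: eq_integral => x /set_mem; rewrite /= in_itv/= andbT => x0.
  rewrite -EFinM; congr EFin.
  have x2 : (x ^+ 2) `^ (a - 1) = x `^ (2 * a - 2).
    by rewrite -powR_mulrn ?ltW// -powRrM; congr (_ `^ _); ring.
  rewrite powRM ?sqr_ge0 ?(ltW c0)// x2 mulNr.
  have -> : x `^ (2 * a - 1) = x * x `^ (2 * a - 2).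
    rewrite -{2}(powRr1 (ltW x0)) -powRD; last by rewrite (gt_eqF x0) implybT.
    by congr (_ `^ _); ring.
  have cc : c `^ (1 - a) * c `^ (a - 1) = 1.
    rewrite -powRD; last by rewrite (gt_eqF c0) implybT.
    by rewrite addrC addrA subrK subrr powRr0.
  transitivity (c `^ (1 - a) * c `^ (a - 1) *
    (2 * x * x `^ (2 * a - 2) * expR (- (c * x ^+ 2)))).
    by rewrite cc; ring.
  by ring.
rewrite h muleA -EFinM; congr (_%:E * _)%E.
rewrite -powR_inv1 ?ltW// -powRD; last by rewrite (gt_eqF c0) implybT.
by congr (_ `^ _); ring.
Qed.

End extended_gamma.

Lemma has_pdf_on_pos_integral d (T : measurableType d) (R : realType)
    (P : probability T R) (V : T -> R) (f g : R -> R) :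
  has_pdf_on_pos P V f -> measurable_fun setT f -> (forall x, 0 < x -> 0 <= f x) ->
  measurable_fun setT g -> (forall x, 0 <= g x) ->
  (\int[P]_w (g (V w))%:E =
   \int[lebesgue_measure]_(x in `]0%R, +oo[) (g x * f x)%:E)%E.
Proof.
move=> [mV Vf] mf f0 mg g0.
pose W (x : R) : R := \1_`]0%R, +oo[ x * f x.
have W0 x : 0 <= W x.
  rewrite /W indicE; case: (boolP (x \in _)) => [/set_mem|_]; last by rewrite mul0r.
  by rewrite /= in_itv/= andbT mul1r => /f0.
have mW : measurable_fun setT W.
  by apply: measurable_funM => //; exact: measurable_indic.
pose m1 := weighted_law_measure P (measurable_cst _) (fun=> ler01) mV.
pose m2 := @weighted_law_measure _ _ (measurableTypeR R) R R (@lebesgue_measure R)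
  W id mW W0 (@measurable_id _ _ setT).
have m12 A : measurable A -> m1 A = m2 A.
  move=> mA; have -> : m2 A = P (V @^-1` A).
    by rewrite [LHS]integral_indicM Vf.
  change ((\int[P]_(w in V @^-1` A) cst 1 w)%E = P (V @^-1` A)).
  by rewrite integral_cst ?mul1e// -[X in measurable X]setTI; exact: (mV measurableT _ mA).
have mgE : measurable_fun setT (EFin \o g) by exact/measurable_EFinP.
transitivity (\int[m1]_t (g t)%:E)%E.
  rewrite ge0_integral_weighted_law//.
  by apply: eq_integral => w _; rewrite mul1e.
rewrite (eq_measure_integral m2); last by move=> A mA _; exact: m12.
rewrite ge0_integral_weighted_law//.
rewrite (_ : (\int[lebesgue_measure]_x _)%E = \int[lebesgue_measure]_x
    (\1_`]0%R, +oo[ x * (g x * f x))%:E)%E; last first.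
  by apply: eq_integral => x _; rewrite -EFinM /W /=; congr EFin; ring.
by rewrite integral_indicM setTI.
Qed.

Lemma nakagami_laplace d (T : measurableType d) (R : realType)
    (P : probability T R) (H : T -> R) (m k : R) :
  0 < m -> 0 <= k -> (forall w, 0 <= H w) ->
  has_pdf_on_pos P (fun w => Num.sqrt (H w)) (nakagami_pdf m) ->
  (\int[P]_w (expR (- k * H w))%:E = ((1 + k / m) `^ (- m))%:E)%E.
Proof.
move=> m0 k0 H0 Hpdf.
pose K := m `^ m / Gamma m.
have Gamma0 : 0 <= Gamma m by rewrite fine_ge0// extended_Gamma_ge0.
have K0 : 0 <= K by rewrite divr_ge0// powR_ge0.
have mf : measurable_fun setT (nakagami_pdf m).
  apply: measurable_funM.
    exact: (measurable_funM (measurable_cst _) (measurable_powR _)).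
  apply: measurableT_comp => //; apply: measurable_funM => //; exact: measurable_funX.
have f0 x : 0 <= nakagami_pdf m x.
  rewrite /nakagami_pdf -[2 * _ / _]mulrA -/K.
  by do ![apply: mulr_ge0]; rewrite ?powR_ge0 ?expR_ge0 ?invr_ge0.
have laplaceE j : 0 <= j -> (\int[P]_w (expR (- j * H w))%:E =
    K%:E * ((m + j) `^ (- m))%:E * extended_Gamma m)%E.
  move=> j0.
  pose g (x : R) := expR (- j * x ^+ 2).
  have mg : measurable_fun setT g.
    apply: measurableT_comp => //; apply: measurable_funM => //; exact: measurable_funX.
  transitivity (\int[P]_w (g (Num.sqrt (H w)))%:E)%E.
    by apply: eq_integral => w _; rewrite /g sqr_sqrtr.
  rewrite (has_pdf_on_pos_integral Hpdf mf (fun x _ => f0 x) mg (fun x => expR_ge0 _)).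
  rewrite -muleA -integral_powR_gauss; last by rewrite ltr_pwDl.
  rewrite -ge0_integralZl; last 4 first.
  - exact: measurable_itv.
  - apply/measurable_EFinP; apply: measurable_funTS; apply: measurable_funM.
      exact: (measurable_funM (measurable_cst _) (measurable_powR _)).
    apply: measurableT_comp => //; apply: measurable_funM => //; exact: measurable_funX.
  - by move=> x _; rewrite lee_fin !mulr_ge0 ?powR_ge0 ?expR_ge0.
  - by rewrite lee_fin.
  apply: eq_integral => x _; rewrite -EFinM; congr EFin.
  have -> : expR (- (m + j) * x ^+ 2) = expR (- j * x ^+ 2) * expR (- m * x ^+ 2).
    by rewrite -expRD; congr expR; ring.
  by rewrite /g /nakagami_pdf /K; ring.
(* [Gamma m] is the finite part of an integral in the extended reals; total
   mass 1 rules out the value +oo. *)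
have mass : (1 = K%:E * (m `^ (- m))%:E * extended_Gamma m)%E.
  transitivity (\int[P]_w (expR (- 0 * H w))%:E)%E; last by rewrite laplaceE// addr0.
  under eq_integral do rewrite oppr0 mul0r expR0.
  by rewrite integral_cst// [X in (_ * X)%E]probability_setT mule1.
have mm : m `^ m * m `^ (- m) = 1.
  by rewrite powRN mulfV// gt_eqF// powR_gt0.
rewrite laplaceE//; move: mass.
have := extended_Gamma_ge0 m; rewrite /K.
have GE : Gamma m = fine (extended_Gamma m) by [].
move: GE; case: (extended_Gamma m) => [G|GE|//]; last first.
  by rewrite GE/= invr0 mulr0 !mul0e => _ /eqP; rewrite eqe oner_eq0.
move=> -> /=; rewrite lee_fin => G0; rewrite -!EFinM => -[mass]; congr EFin.
have Gn0 : G != 0.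
  by apply/eqP => G00; move: mass; rewrite G00 mulr0 => /eqP; rewrite oner_eq0.
transitivity (m `^ m * (m + k) `^ (- m)); first by field.
have -> : 1 + k / m = (m + k) / m by field; rewrite gt_eqF.
have mk : 0 < m + k by rewrite ltr_pwDl.
rewrite powRM ?invr_ge0 ?(ltW m0) ?(ltW mk)// mulrC; congr (_ * _).
by rewrite -powR_inv1 ?(ltW m0)// -powRrM mulN1r opprK.
Qed.

Section shadowed_rician.
Variables (R : realType) (p : system R) (p_admissible : admissible p).

Let b0 : 0 < b_s p. Proof. exact: b_gt0. Qed.
Let O0 : 0 < Omega_s p. Proof. exact: Omega_gt0. Qed.
Let m0 : 0 < (m_s p)%:R :> R. Proof. by rewrite ltr0n m_s_gt0. Qed.
Let den0 : 0 < 2 * b_s p * (m_s p)%:R + Omega_s p.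
Proof. by rewrite addr_gt0// !mulr_gt0. Qed.

Lemma beta_sub_c_gt0 : 0 < beta_ p - c_ p.
Proof.
rewrite (_ : beta_ p - c_ p = (m_s p)%:R / (2 * b_s p * (m_s p)%:R + Omega_s p)).
  by rewrite divr_gt0.
by rewrite /beta_ /c_; field; rewrite !gt_eqF// mulr_gt0.
Qed.

(** The alternating sign and the Pochhammer symbol merge into a binomial coefficient, which makes
    the positivity of [zeta] visible. *)
Lemma zetaE z : zeta p z =
  (2 * b_s p * (m_s p)%:R / (2 * b_s p * (m_s p)%:R + Omega_s p)) ^+ m_s p
  * (beta_ p * 'C((m_s p).-1, z)%:R * c_ p ^+ z / z`!%:R).
Proof.
have f0 : (z`!%:R : R) != 0 by rewrite pnatr_eq0 -lt0n fact_gt0.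
have mE : (m_s p)%:R = (m_s p).-1.+1%:R :> R by rewrite prednK// m_s_gt0.
rewrite /zeta; congr (_ * _); rewrite mE -[beta_ p * _ * _]mulrA.
by rewrite pochhammer_opp_nat natrM; field.
Qed.

Let zeta_gt0 z : (z < m_s p)%N -> 0 < zeta p z.
Proof.
move=> zm; rewrite zetaE mulr_gt0//; first by rewrite exprn_gt0// divr_gt0// !mulr_gt0.
have beta0 : 0 < beta_ p by rewrite divr_gt0// mulr_gt0.
have c0 : 0 < c_ p by rewrite divr_gt0// !mulr_gt0.
rewrite divr_gt0 ?ltr0n ?fact_gt0// mulr_gt0 ?exprn_gt0// mulr_gt0// ltr0n bin_gt0.
by rewrite -ltnS prednK// m_s_gt0.
Qed.

Let term_ge0 (z : 'I_(m_s p)) (x j : R) : 0 < x ->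
  0 <= zeta p z * (2 * x ^+ (2 * z + 1) * expR j).
Proof.
move=> x0; apply: mulr_ge0; first exact: ltW (zeta_gt0 _).
by apply: mulr_ge0; [apply: mulr_ge0; rewrite ?exprn_ge0// ltW|exact: expR_ge0].
Qed.

(** The factor [exp (c x^2)] released by Kummer's transformation lowers the Gaussian rate from
    [beta_] to [beta_ - c_]; what remains of the hypergeometric function is a polynomial. *)
Lemma shadowed_rician_pdfE x :
  shadowed_rician_pdf (b_s p) (Omega_s p) (m_s p) x =
  \sum_(z < m_s p) zeta p z * (2 * x ^+ (2 * z + 1) * expR (- (beta_ p - c_ p) * x ^+ 2)).
Proof.
have hyp (m : nat) (y : R) : (0 < m)%N -> hyp1F1 m%:R 1 y =
    expR y * \sum_(z < m) 'C(m.-1, z)%:R * y ^+ z / z`!%:R.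
  by case: m => // m _; exact: hyp1F1_nat.
rewrite /shadowed_rician_pdf.
have -> : Omega_s p * x ^+ 2 / (2 * b_s p * (2 * b_s p * (m_s p)%:R + Omega_s p)) =
    c_ p * x ^+ 2 by rewrite /c_ mulrAC.
rewrite hyp ?m_s_gt0//.
rewrite !mulr_sumr; apply: eq_bigr => z _; rewrite zetaE.
have -> : expR (- (beta_ p - c_ p) * x ^+ 2) =
    expR (- x ^+ 2 / (2 * b_s p)) * expR (c_ p * x ^+ 2).
  by rewrite -expRD; congr expR; rewrite /beta_; field; rewrite gt_eqF.
rewrite /beta_ [(c_ p * x ^+ 2) ^+ z]exprMn -exprM addn1 [x ^+ (2 * z).+1]exprS.
have f0 : (z`!%:R : R) != 0 by rewrite pnatr_eq0 -lt0n fact_gt0.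
set K := (_ / _) ^+ m_s p.
set e1 := expR (- x ^+ 2 / _); set e2 := expR (c_ p * _).
by field; rewrite f0 gt_eqF.
Qed.

Lemma shadowed_rician_laplace d (T : measurableType d) (P : probability T R)
    (H : T -> R) (k : R) :
  0 <= k -> (forall w, 0 <= H w) ->
  has_pdf_on_pos P (fun w => Num.sqrt (H w))
    (shadowed_rician_pdf (b_s p) (Omega_s p) (m_s p)) ->
  (\int[P]_w (expR (- k * H w))%:E =
   (\sum_(0 <= z < m_s p) zeta p z * Gamma (z%:R + 1) /
      (beta_ p - c_ p + k) ^+ z.+1)%:E)%E.
Proof.
move=> k0 H0 Hpdf.
pose f := shadowed_rician_pdf (b_s p) (Omega_s p) (m_s p).
have mX n j : measurable_fun setT
    (fun x : R => 2 * x ^+ n * expR (- j * x ^+ 2)).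
  apply: measurable_funM; first by apply: measurable_funM => //; exact: measurable_funX.
  by apply: measurableT_comp => //; apply: measurable_funM => //; exact: measurable_funX.
have mf : measurable_fun setT f.
  have -> : f = (fun x => \sum_(z < m_s p)
      zeta p z * (2 * x ^+ (2 * z + 1) * expR (- (beta_ p - c_ p) * x ^+ 2))).
    by apply/funext => x; exact: shadowed_rician_pdfE.
  by apply: measurable_sum => z; exact: measurable_funM.
have f0 x : 0 < x -> 0 <= f x.
  move=> x0; rewrite /f shadowed_rician_pdfE; apply: sumr_ge0 => z _.
  exact: term_ge0.
have laplaceE j : 0 <= j -> (\int[P]_w (expR (- j * H w))%:E =
    \sum_(z < m_s p) (zeta p z * (beta_ p - c_ p + j) ^- z.+1)%:E *
      extended_Gamma (z%:R + 1))%E.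
  move=> j0.
  pose g (x : R) := expR (- j * x ^+ 2).
  have mg : measurable_fun setT g.
    by apply: measurableT_comp => //; apply: measurable_funM => //; exact: measurable_funX.
  transitivity (\int[P]_w (g (Num.sqrt (H w)))%:E)%E.
    by apply: eq_integral => w _; rewrite /g sqr_sqrtr.
  rewrite (has_pdf_on_pos_integral Hpdf mf f0 mg (fun x => expR_ge0 _)).
  have cj : 0 < beta_ p - c_ p + j by rewrite ltr_pwDl// beta_sub_c_gt0.
  transitivity (\sum_(z < m_s p) \int[lebesgue_measure]_(x in `]0%R, +oo[)
      (zeta p z * (2 * x ^+ (2 * z + 1) * expR (- (beta_ p - c_ p + j) * x ^+ 2)))%:E)%E.
    rewrite -ge0_integral_sum//; last 2 first.
    - move=> z; apply/measurable_EFinP; apply: measurable_funTS.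
      apply: measurable_funM; first exact: measurable_cst.
      exact: mX.
    - move=> z x; rewrite /= in_itv/= andbT => x0.
      by rewrite lee_fin; exact: term_ge0.
    apply: eq_integral => x _; rewrite sumEFin; congr EFin.
    rewrite shadowed_rician_pdfE mulr_sumr.
    apply: eq_bigr => z _.
    have -> : expR (- (beta_ p - c_ p + j) * x ^+ 2) =
        g x * expR (- (beta_ p - c_ p) * x ^+ 2).
      by rewrite -expRD; congr expR; ring.
    by ring.
  apply: eq_bigr => z _.
  transitivity ((zeta p z)%:E * \int[lebesgue_measure]_(x in `]0%R, +oo[)
     (2 * x `^ (2 * (z%:R + 1) - 1) * expR (- (beta_ p - c_ p + j) * x ^+ 2))%:E)%E.
    rewrite -ge0_integralZl//; last 3 first.
    - apply/measurable_EFinP; apply: measurable_funTS; apply: measurable_funM.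
        exact: (measurable_funM (measurable_cst _) (measurable_powR _)).
      by apply: measurableT_comp => //; apply: measurable_funM => //; exact: measurable_funX.
    - by move=> x _; rewrite lee_fin !mulr_ge0 ?powR_ge0 ?expR_ge0.
    - by rewrite lee_fin ltW// zeta_gt0.
    apply: eq_integral => x /set_mem; rewrite /= in_itv/= andbT => x0.
    rewrite -EFinM; congr (_ * (_ * _ * _))%:E.
    by rewrite -powR_mulrn ?ltW//; congr (_ `^ _); rewrite natrD natrM; ring.
  rewrite integral_powR_gauss// muleA -EFinM; congr ((_ * _)%:E * _)%E.
  by rewrite powRN -(natrD _ z 1) addn1 powR_mulrn// ltW.
have gterm z j : (z < m_s p)%N -> 0 <= j -> 0 < zeta p z * (beta_ p - c_ p + j) ^- z.+1.
  move=> zm j0; rewrite divr_gt0 ?zeta_gt0// exprn_gt0// ltr_pwDl//.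
  exact: beta_sub_c_gt0.
(* The total mass 1 is a sum of nonnegative terms with positive coefficients, so no single Gamma
   integral can be infinite. *)
have Gfin (z : 'I_(m_s p)) : extended_Gamma (z%:R + 1 : R) \is a fin_num.
  have mass : (1 = \sum_(z < m_s p) (zeta p z * (beta_ p - c_ p + 0) ^- z.+1)%:E *
      extended_Gamma (z%:R + 1))%E.
    rewrite -laplaceE//; under eq_integral do rewrite oppr0 mul0r expR0.
    by rewrite integral_cst// [X in (_ * X)%E]probability_setT mule1.
  have ge0 (i : 'I_(m_s p)) : (0 <= (zeta p i * (beta_ p - c_ p + 0) ^- i.+1)%:E *
      extended_Gamma (i%:R + 1))%E.
    by rewrite mule_ge0 ?extended_Gamma_ge0// lee_fin ltW// gterm.
  rewrite ge0_fin_numE ?extended_Gamma_ge0// ltNge leye_eq; apply/negP => /eqP Goo.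
  move: mass; rewrite (bigD1 z)//= Goo gt0_muley ?lte_fin ?gterm// addye.
    by move=> /eqP.
  by rewrite gt_eqF// (lt_le_trans ltNy0)// sume_ge0.
rewrite laplaceE// big_mkord -sumEFin; apply: eq_bigr => z _.
have -> : Gamma (z%:R + 1) = fine (extended_Gamma (z%:R + 1)) by [].
by rewrite -[X in (_ * X)%E = _](fineK (Gfin z)) -EFinM; congr EFin; rewrite mulrAC.
Qed.

End shadowed_rician.

(** * Conditioning on the serving distance *)

(* Bins are closed on the right, and [Y] is evaluated at the right end of the
   bin of [X w]; refining the bins, the right end decreases to [X w]. *)
Lemma disintegration_of_bins d (T : measurableType d) (R : realType)
    (P : probability T R) (E : set T) (X : T -> R) (Y : R -> T -> R) (G : R -> R) :
  measurable E -> measurable_fun setT X ->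
  (forall r : T -> R, measurable_fun setT r -> measurable_fun setT (fun w => Y (r w) w)) ->
  (forall b w, 0 <= Y b w <= 1) ->
  (forall w, E w -> \forall b \near (X w)^'+, Y b w = Y (X w) w) ->
  continuous G -> (forall b, 0 <= G b <= 1) ->
  (forall a b : R, (a <= b)%R ->
    \int[P]_(w in E `&` X @^-1` `]a, b]) (Y b w)%:E =
    (G b)%:E * P (E `&` X @^-1` `]a, b]))%E ->
  forall B, measurable B ->
  (\int[P]_(w in E `&` X @^-1` B) (Y (X w) w)%:E =
   \int[P]_(w in E `&` X @^-1` B) (G (X w))%:E)%E.
Proof.
move=> mE mX mY Y01 Yright cG G01 bins.
have mXB B : measurable B -> measurable (E `&` X @^-1` B).
  by move=> mB; apply: measurableI => //; rewrite -[S in measurable S]setTI; exact: mX.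
have mG : measurable_fun setT G by exact: continuous_measurable_fun.
have mGX : measurable_fun setT (G \o X) by exact: measurableT_comp.
have mYX : measurable_fun setT (fun w => Y (X w) w) by exact: mY.
(* Half-lines suffice, since both sides are finite measures as functions of [B]. *)
have rays rho : (\int[P]_(w in E `&` X @^-1` `]-oo, rho]) (Y (X w) w)%:E =
    \int[P]_(w in E `&` X @^-1` `]-oo, rho]) (G (X w))%:E)%E.
  (* Bins of width 1/(n+1) are counted downwards from [rho]: rounding [rho - X w] down makes them
     closed on the right, with right end [b n (i n w)]. *)
  pose i n w := Num.truncn ((rho - X w) * n.+1%:R).
  pose b n (k : nat) : R := rho - k%:R / n.+1%:R.
  have mi n : measurable_fun setT (i n).
    apply: (measurableT_comp (@measurable_truncn R)); apply: measurable_funM => //.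
    exact: measurable_funB.
  have mb n : measurable_fun setT (fun w => b n (i n w)).
    by apply: (measurableT_comp (f := b n)).
  have b_bin n k w : X w <= rho -> i n w = k <-> b n k.+1 < X w <= b n k.
    move=> Xrho; have h0 : 0 <= (rho - X w) * n.+1%:R by rewrite mulr_ge0// subr_ge0.
    rewrite /b ltrBlDr -ltrBlDl ltr_pdivlMr// lerBrDr -lerBrDl ler_pdivrMr// andbC.
    by rewrite -truncn_eq//; split => /eqP.
  have b_ge n w : X w <= rho -> X w <= b n (i n w) < X w + n.+1%:R^-1.
    move=> Xrho; have /andP[h1 h2] := (b_bin n (i n w) w Xrho).1 erefl.
    have e : (i n w).+1%:R / n.+1%:R = (i n w)%:R / n.+1%:R + n.+1%:R^-1 :> R.
      by rewrite -[(i n w).+1]addn1 natrD mulrDl mul1r.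
    rewrite h2/=; move: h1; rewrite /b e.
    move: ((i n w)%:R / n.+1%:R : R) => y; move: (n.+1%:R^-1 : R) => z; lra.
  have fine_rays n : (\int[P]_(w in E `&` X @^-1` `]-oo, rho]) (Y (b n (i n w)) w)%:E =
      \int[P]_(w in E `&` X @^-1` `]-oo, rho]) (G (b n (i n w)))%:E)%E.
    have DE : E `&` X @^-1` `]-oo, rho] =
        \bigcup_k (E `&` X @^-1` (`]b n k.+1, b n k])).
      apply/seteqP; split=> [w [Ew] /=|w [k _ [Ew]]].
        rewrite in_itv/= => Xrho; exists (i n w) => //; split => //=.
        by rewrite in_itv/=; exact/b_bin.
      rewrite /= in_itv/= => /andP[_ Xb]; split => //=; rewrite in_itv/=.
      by apply: le_trans Xb _; rewrite /b gerBl divr_ge0.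
    have tD : trivIset setT (fun k => E `&` X @^-1` (`]b n k.+1, b n k])).
      move=> k l _ _ [w [[_ /=]]]; rewrite in_itv/= => hk [_ /=]; rewrite in_itv/= => hl.
      have Xrho : X w <= rho.
        by case/andP: hk => _ /le_trans; apply; rewrite /b gerBl divr_ge0.
      by rewrite -((b_bin n k w Xrho).2 hk) -((b_bin n l w Xrho).2 hl).
    have Xbin k w : (E `&` X @^-1` (`]b n k.+1, b n k])) w -> b n (i n w) = b n k.
      move=> [_ /=]; rewrite in_itv/= => hk; congr (b n _); apply/b_bin => //.
      by case/andP: hk => _ /le_trans; apply; rewrite /b gerBl divr_ge0.
    rewrite DE !ge0_integral_bigcup//.
    - apply: eq_eseriesr => k _.
      have bb : b n k.+1 <= b n k by rewrite /b lerB// ler_pM2r ?invr_gt0// ler_nat.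
      rewrite (eq_integral (fun w => (Y (b n k) w)%:E)); last first.
        by move=> w /set_mem /Xbin ->.
      rewrite [RHS](eq_integral (fun w => (G (b n k))%:E)); last first.
        by move=> w /set_mem /Xbin ->.
      by rewrite bins// integral_cst//; exact: mXB.
    - by move=> k; exact: mXB.
    - apply/measurable_EFinP; apply: measurable_funTS; exact: measurableT_comp.
    - by move=> w _; rewrite lee_fin; case/andP: (G01 (b n (i n w))).
    - by move=> k; exact: mXB.
    - by apply/measurable_EFinP; apply: measurable_funTS; exact: mY.
    - by move=> w _; rewrite lee_fin; case/andP: (Y01 (b n (i n w)) w).
  have b_cvg w : X w <= rho -> b n (i n w) @[n --> \oo] --> X w.
    move=> Xrho; apply: (@squeeze_cvgr _ _ _ _ (fun=> X w) (fun n => X w + n.+1%:R^-1)).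
    - by apply: nearW => n; case/andP: (b_ge n w Xrho) => -> /ltW ->.
    - exact: cvg_cst.
    - rewrite -[Z in _ --> Z]addr0; apply: cvgD; first exact: cvg_cst.
      exact: cvg_harmonic.
  have mD : measurable (E `&` X @^-1` `]-oo, rho]) by exact: mXB.
  have clY : (\int[P]_(w in E `&` X @^-1` `]-oo, rho]) (Y (b n (i n w)) w)%:E @[n --> \oo] -->
      \int[P]_(w in E `&` X @^-1` `]-oo, rho]) (Y (X w) w)%:E)%E.
    apply: bounded_convergence => //.
    - by move=> n; exact: mY.
    - move=> w [Ew]; rewrite /= in_itv/= => Xrho.
      have /nbhs_ballP[e /= e0 Ye] := Yright w Ew.
      apply: cvg_near_cst.
      have /cvgrPdist_lt /(_ e e0) := b_cvg w Xrho; apply: filterS => n.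
      (* The right neighbourhood filter leaves out [X w] itself, so this value is treated apart. *)
      have [->|bX] := eqVneq (b n (i n w)) (X w); first by [].
      move=> h; apply: Ye => //; rewrite lt_neqAle eq_sym bX.
      by case/andP: (b_ge n w Xrho).
  have clG : (\int[P]_(w in E `&` X @^-1` `]-oo, rho]) (G (b n (i n w)))%:E @[n --> \oo] -->
      \int[P]_(w in E `&` X @^-1` `]-oo, rho]) (G (X w))%:E)%E.
    apply: bounded_convergence => //.
    - by move=> n; exact: measurableT_comp.
    - move=> w [Ew]; rewrite /= in_itv/= => Xrho.
      by apply: (cvg_comp _ _ (b_cvg w Xrho)); exact: cG.
  move: clY; under eq_fun do rewrite fine_rays.
  by move=> clY; exact: (cvg_unique (@ereal_hausdorff R) clY clG).
move=> B mB.
have W_ge0 (f : T -> R) : (forall w, 0 <= f w <= 1) -> forall w, 0 <= \1_E w * f w.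
  by move=> f01 w; rewrite indicE mulr_ge0//; case/andP: (f01 w).
have mW (f : T -> R) : measurable_fun setT f -> measurable_fun setT (fun w => \1_E w * f w).
  by move=> mf; apply: measurable_funM => //; exact: measurable_indic.
pose m1 := weighted_law_measure P (mW _ mYX) (W_ge0 _ (fun w => Y01 (X w) w)) mX.
pose m2 := weighted_law_measure P (mW _ mGX) (W_ge0 _ (fun w => G01 (X w))) mX.
have m1E A : m1 A = (\int[P]_(w in E `&` X @^-1` A) (Y (X w) w)%:E)%E.
  by rewrite setIC -integral_indicM.
have m2E A : m2 A = (\int[P]_(w in E `&` X @^-1` A) (G (X w))%:E)%E.
  by rewrite setIC -integral_indicM.
rewrite -m1E -m2E; apply: measure_unique_lray => // r; first by rewrite m1E m2E rays.
rewrite m1E.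
have /andP[_ h] := integral01 P mYX (fun w => Y01 (X w) w)
  (mXB _ (measurable_itv `]-oo, r])).
by rewrite (le_lt_trans h)// ltry.
Qed.

(** On the event that [X] is close to [r], the integrand may be traded for [G (X w)], which stays
    within [del] of [G r]; hence so does its mean over this event of positive probability. *)
Lemma cond_expectation_at_continuous d (T : measurableType d) (R : realType)
    (P : probability T R) (E : set T) (X Y : T -> R) (G : R -> R) (r : R) :
  measurable E -> measurable_fun setT X ->
  continuous G -> (forall b, 0 <= G b <= 1) ->
  (forall B, measurable B -> (\int[P]_(w in E `&` X @^-1` B) (Y w)%:E =
    \int[P]_(w in E `&` X @^-1` B) (G (X w))%:E)%E) ->
  (forall e : R, 0 < e -> (0 < P (E `&` X @^-1` ball r e))%E) ->
  cond_expectation_at P E X Y r (G r).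
Proof.
move=> mE mX cG G01 YG P0.
have mG : measurable_fun setT (G \o X).
  by apply: measurableT_comp => //; exact: continuous_measurable_fun.
have G0 w : 0 <= G (X w) by case/andP: (G01 (X w)).
rewrite /cond_expectation_at; apply/cvgrPdist_le => /= del del0.
have /cvgrPdist_le /(_ _ del0) /nbhs_ballP[e /= e0 eG] := cG r.
near=> eps.
have eps0 : 0 < eps by near: eps; exact: nbhs_right_gt.
have epse : eps < e by near: eps; exact: nbhs_right_lt.
pose S := E `&` X @^-1` ball r eps.
have mball : measurable (ball r eps) by exact: measurable_ball.
have mS : measurable S.
  by apply: measurableI => //; rewrite -[Q in measurable Q]setTI; exact: mX.
have PS : P S = (fine (P S))%:E by rewrite fineK// fin_num_measure.
have p0 : 0 < fine (P S) by rewrite -lte_fin -PS P0.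
have IE : (\int[P]_(w in S) (G (X w))%:E)%E =
    (fine (\int[P]_(w in S) (G (X w))%:E)%E)%:E.
  by rewrite fineK// integral01_fin_num// => w; exact: G01.
have -> : \int[P]_(w in S) Y w = fine (\int[P]_(w in S) (G (X w))%:E)%E.
  by rewrite /Rintegral YG.
have GS w : S w -> `|G r - G (X w)| <= del.
  by move=> [_ Xw]; apply: eG; exact: le_ball (ltW epse) _ Xw.
set I := fine _ in IE *; set q := fine _ in PS p0 *.
have up : I <= (G r + del) * q.
  rewrite -lee_fin EFinM -IE -PS -(integral_cst P mS).
  apply: ge0_le_integral => //.
  - by move=> w _; rewrite lee_fin.
  - by apply/measurable_EFinP; exact: measurable_funTS.
  - by move=> w /GS; rewrite ler_distlC lee_fin => /andP[_]; lra.
(* Stated additively because [G r - del] may be negative, while the comparison is one of nonnegative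
   integrands. *)
have low : G r * q <= I + del * q.
  rewrite -lee_fin EFinD !EFinM -IE -PS -!(integral_cst P mS) -ge0_integralD//; last 3 first.
  - by move=> w _; rewrite lee_fin.
  - by apply/measurable_EFinP; exact: measurable_funTS.
  - by move=> w _; rewrite lee_fin ltW.
  apply: ge0_le_integral => //.
  - by move=> w _; rewrite lee_fin; case/andP: (G01 r).
  - by apply: emeasurable_funD => //; apply/measurable_EFinP; exact: measurable_funTS.
  - by move=> w /GS; rewrite ler_distlC -EFinD lee_fin => /andP[]; lra.
rewrite ler_distlC; apply/andP; split.
  by rewrite ler_pdivlMr//; lra.
by rewrite ler_pdivrMr.
Unshelve. all: by end_near. Qed.

(** This holds for infinite [y] as well, because [fine] sends both infinities to 0. *)
Lemma fine_scale (R : realType) (k : R) (y : \bar R) : fine (k%:E * y)%E = k * fine y.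
Proof.
case: y => [//| |]; rewrite [RHS]mulr0.
  have [k0|k0|->] := ltgtP k 0; last by rewrite mul0e.
    by rewrite lt0_muley ?lte_fin.
  by rewrite gt0_muley ?lte_fin.
have [k0|k0|->] := ltgtP k 0; last by rewrite mul0e.
  by rewrite lt0_muleNy ?lte_fin.
by rewrite gt0_muleNy ?lte_fin.
Qed.

Section radial_measure_corollaries.
Context (R : realType) (k lo hi : R) (k0 : 0 <= k) (lo_ge0 : 0 <= lo).

Lemma fine_integral_radial_measure (f : R -> R) :
  measurable_fun setT f -> (forall v, 0 <= f v) ->
  fine (\int[radial_measure hi k0 lo_ge0]_v (f v)%:E)%E =
  k * \int[lebesgue_measure]_(v in `[lo, hi]) (f v * v).
Proof.
move=> mf f0; rewrite integral_radial_measure// /Rintegral -fine_scale; congr fine.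
rewrite -ge0_integralZl//; last 2 first.
- apply: measurable_funTS; apply/measurable_EFinP; exact: measurable_funM.
- move=> v; rewrite /= in_itv/= => /andP[lov _].
  by rewrite lee_fin mulr_ge0// (le_trans lo_ge0).
by apply: eq_integral => v _; rewrite -EFinM; congr EFin; ring.
Qed.

(** The density is at most [k * hi], which becomes the Lipschitz constant of [sat_tail]. *)
Lemma radial_measure_itv_le (b c : R) : 0 <= hi -> b <= c ->
  fine (radial_measure hi k0 lo_ge0 `]b, c]%classic) <= k * hi * (c - b).
Proof.
move=> hi0 bc; rewrite -lee_fin fineK ?fin_num_measure//.
apply: (@le_trans _ _ (\int[lebesgue_measure]_(v in `]b, c]) (k * hi)%:E)%E); last first.
  rewrite integral_cst//= lebesgue_measure_itv/= lte_fin; case: ifPn => h.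
    by rewrite -EFinB -EFinM.
  by rewrite mule0 lee_fin !mulr_ge0 ?subr_ge0.
have -> : radial_measure hi k0 lo_ge0 `]b, c]%classic =
    (\int[lebesgue_measure]_(v in `]b, c]) (radial_weight k lo hi v)%:E)%E by [].
apply: ge0_le_integral => //.
- by move=> v _; rewrite lee_fin radial_weight_ge0.
- by apply: measurable_funTS; apply/measurable_EFinP; exact: measurable_radial_weight.
- move=> v _; rewrite lee_fin /radial_weight indicE.
  case: (boolP (v \in _)) => [/set_mem|_]; last by rewrite mul0r mulr_ge0.
  by rewrite /= in_itv/= mul1r => /andP[_ vhi]; rewrite ler_wpM2l.
Qed.

End radial_measure_corollaries.

Lemma Lipschitz_continuous (R : realType) (f : R -> R) (K : R) : 0 <= K ->
  (forall b c, b <= c -> `|f b - f c| <= K * (c - b)) -> continuous f.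
Proof.
move=> K0 fK b; apply/cvgrPdist_le => /= e e0.
(* [K + 1] instead of [K] avoids dividing by zero. *)
have eK : 0 < e / (K + 1) by rewrite divr_gt0// ltr_wpDl.
apply/nbhs_ballP; exists (e / (K + 1)) => //= c bc.
have le1 : K * `|b - c| <= e.
  apply: (@le_trans _ _ ((K + 1) * `|b - c|)); first by rewrite ler_wpM2r// lerDl.
  by rewrite mulrC -ler_pdivlMr ?ltr_wpDl//; exact: ltW.
apply: le_trans le1; have [bc'|cb] := leP b c.
  by rewrite (le_trans (fK _ _ bc'))// [`|b - c|]distrC ger0_norm ?subr_ge0.
by rewrite distrC (le_trans (fK _ _ (ltW cb)))// ger0_norm ?subr_ge0// ltW.
Qed.

Section sphere_distance.
Variables (R : realType) (p : system R) (p_admissible : admissible p).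

(** Once the square is expanded, the distance depends only on the height [y.2], and decreases with
    it up to the pole [y.2 = R_s p]. *)
Lemma R_min_le_dist (y : R3 R) : enorm y = R_s p -> R_min p <= dist y (u1 p).
Proof.
move=> yR; have Rus0 := R_us_gt0 p_admissible; have RusRs := R_us_lt_R_s p_admissible.
have Rs0 : 0 < R_s p by exact: lt_trans RusRs.
have y2 : dot y y = R_s p ^+ 2.
  rewrite -yR /enorm sqr_sqrtr// /dot -!expr2.
  by apply: addr_ge0; [apply: addr_ge0|]; exact: sqr_ge0.
have y3 : y.2 <= R_s p.
  apply: le_trans (ler_norm _) _; rewrite -(ger0_norm (ltW Rs0)) -!sqrtr_sqr -y2.
  apply: ler_wsqrtr; rewrite /dot -!expr2 lerDr.
  by apply: addr_ge0; exact: sqr_ge0.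
rewrite -[leLHS]ger0_norm; last by rewrite subr_ge0 ltW.
rewrite -sqrtr_sqr; apply: ler_wsqrtr.
have -> : dot (y - u1 p) (y - u1 p) = dot y y - 2 * R_us p * y.2 + R_us p ^+ 2.
  by rewrite /dot/=; ring.
by rewrite y2 /R_min; nra.
Qed.

End sphere_distance.

(** * The interference *)

Section conditional_laplace.
Context (R : realType) (d : measure_display) (T : measurableType d).
Variable P : probability T R.
Variables (p : system R) (p_admissible : admissible p) (e1 e2 : R3 R).
Hypotheses (e11 : dot e1 e1 = 1) (e22 : dot e2 e2 = 1) (e12 : dot e1 e2 = 0).
Variables (Ns : T -> nat) (x : nat -> T -> R3 R) (Hs : nat -> T -> R).
Variables (Nt : T -> nat) (u : nat -> T -> R3 R) (Ht : nat -> T -> R).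
Hypothesis sat_ppp : poisson_process P Ns x (sat_intensity p).
Hypothesis ut_ppp : poisson_process P Nt u (ut_intensity p e1 e2).
Hypotheses (Hs_meas : forall n, measurable_fun setT (Hs n))
           (Ht_meas : forall k, measurable_fun setT (Ht k)).
Hypotheses (Hs_ge0 : forall n w, 0 <= Hs n w) (Ht_ge0 : forall k w, 0 <= Ht k w).
Hypothesis Hs_law : forall n, has_pdf_on_pos P (fun w => Num.sqrt (Hs n w))
                       (shadowed_rician_pdf (b_s p) (Omega_s p) (m_s p)).
Hypothesis Ht_law : forall k, has_pdf_on_pos P (fun w => Num.sqrt (Ht k w))
                       (nakagami_pdf (m_t p)).
Hypothesis all_indep : mutually_independent P (source_events Ns x Hs Nt u Ht).
Variables (s : R) (s_ge0 : 0 <= s).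

Local Notation C := (cap p (R_max p)).
Local Notation A_ut := (planar_disc (u1 p) e1 e2 (R_ut p)).
Local Notation D y := (dist y (u1 p)).

Definition sat_loss (v : R) : R := s * gain_sat p * P_s p * v `^ (- alpha_s p).
Definition ut_loss (v : R) : R := s * gain_ut p * P_ut p * v `^ (- alpha_t p).

Definition sat_laplace (v : R) : R :=
  \sum_(0 <= z < m_s p) zeta p z * Gamma (z%:R + 1) /
    (beta_ p - c_ p + sat_loss v) ^+ z.+1.
Definition ut_laplace (v : R) : R := (1 + ut_loss v / m_t p) `^ (- m_t p).

Lemma sat_loss_ge0 v : 0 <= sat_loss v.
Proof.
case: p_admissible => *; apply: mulr_ge0; last exact: powR_ge0.
apply: mulr_ge0; last exact: ltW.
apply: mulr_ge0 => //; apply: mulr_ge0; last exact: sqr_ge0.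
by apply: mulr_ge0; exact: ltW.
Qed.

Lemma ut_loss_ge0 v : 0 <= ut_loss v.
Proof.
case: p_admissible => *; apply: mulr_ge0; last exact: powR_ge0.
apply: mulr_ge0; last exact: ltW.
apply: mulr_ge0 => //; apply: mulr_ge0; last exact: sqr_ge0.
by apply: mulr_ge0; exact: ltW.
Qed.

Lemma measurable_sat_loss : measurable_fun setT sat_loss.
Proof. exact: (measurable_funM (measurable_cst _) (measurable_powR _)). Qed.

Lemma measurable_ut_loss : measurable_fun setT ut_loss.
Proof. exact: (measurable_funM (measurable_cst _) (measurable_powR _)). Qed.

Let mNs : measurable_fun setT Ns. Proof. by case: sat_ppp. Qed.
Let mx n : measurable_fun setT (x n). Proof. by case: sat_ppp. Qed.
Let mNt : measurable_fun setT Nt. Proof. by case: ut_ppp. Qed.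
Let mu n : measurable_fun setT (u n). Proof. by case: ut_ppp. Qed.

(* Marks range over R, but a mark is multiplied by a loss and only its
   nonnegative part keeps the exponential in [0, 1]. *)
Let damp (loss : R -> R) (vh : R * R) : R := expR (- loss vh.1 * Num.max 0 vh.2).

Let damp01 loss : (forall v, 0 <= loss v) -> forall vh, 0 <= damp loss vh <= 1.
Proof.
move=> l0 vh; rewrite expR_ge0/= -expR0 ler_expR mulNr oppr_le0 mulr_ge0//.
by rewrite le_max lexx.
Qed.

Let measurable_damp loss : measurable_fun setT loss -> measurable_fun setT (damp loss).
Proof.
move=> ml; apply: measurableT_comp => //; apply: measurable_funM.
  by apply: measurable_funN; exact: (measurableT_comp ml measurable_fst).
by apply: measurable_maxr => //; exact: measurable_snd.
Qed.

Let sat_mean n v : mark_mean P Hs (fun=> damp sat_loss) n v = sat_laplace v.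
Proof.
apply: EFin_inj; rewrite mark_meanE//; last 2 first.
- by move=> _; apply: measurable_damp; exact: measurable_sat_loss.
- by move=> _; apply: damp01; exact: sat_loss_ge0.
rewrite -(shadowed_rician_laplace p_admissible (sat_loss_ge0 v) (Hs_ge0 n) (Hs_law n)).
by apply: eq_integral => w _; rewrite /damp/= (max_idPr (Hs_ge0 n w)).
Qed.

Let ut_mean n v : mark_mean P Ht (fun=> damp ut_loss) n v = ut_laplace v.
Proof.
apply: EFin_inj; rewrite mark_meanE//; last 2 first.
- by move=> _; apply: measurable_damp; exact: measurable_ut_loss.
- by move=> _; apply: damp01; exact: ut_loss_ge0.
rewrite -(nakagami_laplace (m_t_gt0 p_admissible) (ut_loss_ge0 v) (Ht_ge0 n) (Ht_law n)).
by apply: eq_integral => w _; rewrite /damp/= (max_idPr (Ht_ge0 n w)).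
Qed.

Lemma sat_laplace01 v : 0 <= sat_laplace v <= 1.
Proof.
rewrite -(sat_mean 0); apply: mark_mean01 => //.
- by move=> _; apply: measurable_damp; exact: measurable_sat_loss.
- by move=> _; apply: damp01; exact: sat_loss_ge0.
Qed.

Lemma ut_laplace01 v : 0 <= ut_laplace v <= 1.
Proof.
rewrite -(ut_mean 0); apply: mark_mean01 => //.
- by move=> _; apply: measurable_damp; exact: measurable_ut_loss.
- by move=> _; apply: damp01; exact: ut_loss_ge0.
Qed.

Lemma measurable_sat_laplace : measurable_fun setT sat_laplace.
Proof.
rewrite (_ : sat_laplace = mark_mean P Hs (fun=> damp sat_loss) 0%N).
  apply: measurable_mark_mean => //.
  - by move=> _; apply: measurable_damp; exact: measurable_sat_loss.
  - by move=> _; apply: damp01; exact: sat_loss_ge0.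
by apply/funext => v; rewrite sat_mean.
Qed.

Lemma measurable_ut_laplace : measurable_fun setT ut_laplace.
Proof.
rewrite (_ : ut_laplace = mark_mean P Ht (fun=> damp ut_loss) 0%N).
  apply: measurable_mark_mean => //.
  - by move=> _; apply: measurable_damp; exact: measurable_ut_loss.
  - by move=> _; apply: damp01; exact: ut_loss_ge0.
by apply/funext => v; rewrite ut_mean.
Qed.

(** Intensities of the distances. Their densities stay abstract: they enter only through the
    hypotheses of [continuous_laplace_tail] and [laplace_tailE]. *)
Variables nus nut : {finite_measure set R -> \bar R}.
Hypothesis sat_distance_law : forall A, measurable A ->
  sat_intensity p (C `&` (fun y => D y) @^-1` A) = nus A.
Hypothesis ut_distance_law : forall A, measurable A ->
  ut_intensity p e1 e2 (A_ut `&` (fun y => D y) @^-1` A) = nut A.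

(** Mean factor of a visible satellite at distance [v]: forbidden up to [a], ignored between [a] and
    [b], an interferer beyond [b]. *)
Let gs (a b v : R) : R := if v <= a then 0 else if v <= b then 1 else sat_laplace v.

Let gs01 a b v : 0 <= gs a b v <= 1.
Proof.
rewrite /gs; case: ifP => _; first by rewrite lexx ler01.
by case: ifP => _; rewrite ?ler01 ?lexx ?sat_laplace01.
Qed.

Let mgs a b : measurable_fun setT (gs a b).
Proof.
apply: measurable_fun_ifT => //; first exact: measurable_fun_ler.
apply: measurable_fun_ifT => //; first exact: measurable_fun_ler.
exact: measurable_sat_laplace.
Qed.

Let psis (a b : R) (yh : R3 R * R) : R :=
  if yh.1 \in C then
    if D yh.1 <= a then 0 else if D yh.1 <= b then 1 else damp sat_loss (D yh.1, yh.2)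
  else 1.

Let psit (yh : R3 R * R) : R :=
  if yh.1 \in A_ut then damp ut_loss (D yh.1, yh.2) else 1.

Let psis01 a b yh : 0 <= psis a b yh <= 1.
Proof.
rewrite /psis; case: ifP => _; last by rewrite ler01 lexx.
case: ifP => _; first by rewrite lexx ler01.
by case: ifP => _; rewrite ?ler01 ?lexx// damp01//; exact: sat_loss_ge0.
Qed.

Let psit01 yh : 0 <= psit yh <= 1.
Proof.
rewrite /psit; case: ifP => _; last by rewrite ler01 lexx.
by rewrite damp01//; exact: ut_loss_ge0.
Qed.

Let mD1 : measurable_fun setT (fun yh : R3 R * R => D yh.1).
Proof. exact: (measurableT_comp (measurable_dist _) measurable_fst). Qed.

Let mdampD loss : measurable_fun setT loss ->
  measurable_fun setT (fun yh : R3 R * R => damp loss (D yh.1, yh.2)).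
Proof.
move=> ml; apply: (measurableT_comp (measurable_damp ml)).
exact: measurable_fun_pair.
Qed.

Let mpsis a b : measurable_fun setT (psis a b).
Proof.
apply: measurable_fun_ifT => //.
  exact: (measurable_mem measurable_fst (measurable_cap _ _)).
apply: measurable_fun_ifT => //; first exact: measurable_fun_ler.
apply: measurable_fun_ifT => //; first exact: measurable_fun_ler.
by apply: mdampD; exact: measurable_sat_loss.
Qed.

Let mpsit : measurable_fun setT psit.
Proof.
apply: measurable_fun_ifT => //.
  apply: (measurable_mem measurable_fst); exact: measurable_planar_disc.
by apply: mdampD; exact: measurable_ut_loss.
Qed.

Let psis_mean a b n y : mark_mean P Hs (fun=> psis a b) n y =
  if y \in C then gs a b (D y) else 1.
Proof.
rewrite /mark_mean /psis /gs/=; case: ifP => _; last first.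
  by rewrite integral_cst// [X in (_ * X)%E]probability_setT mule1.
case: ifP => _; first by rewrite integral0_eq.
case: ifP => _; last by rewrite -(sat_mean n).
by rewrite integral_cst// [X in (_ * X)%E]probability_setT mule1.
Qed.

Let psit_mean n y : mark_mean P Ht (fun=> psit) n y =
  if y \in A_ut then ut_laplace (D y) else 1.
Proof.
rewrite /mark_mean /psit/=; case: ifP => _; first by rewrite -(ut_mean n).
by rewrite integral_cst// [X in (_ * X)%E]probability_setT mule1.
Qed.

(* [Z a b] is the discounted interference of the satellites beyond [b], killed
   by a visible satellite within distance [a]; hence [Z a b - Z b b] lives on
   the bin [a < X <= b] of the serving distance. *)
Let Z (a b : R) w := \prod_(j < Ns w) psis a b (x j w, Hs j w) *
  \prod_(k < Nt w) psit (u k w, Ht k w).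

Let Lt := expR (- fine (\int[nut]_v (1 - ut_laplace v)%:E)%E).

Let expectation_Z a b : (\int[P]_w (Z a b w)%:E =
  (expR (- fine (\int[nus]_v (1 - gs a b v)%:E)%E) * Lt)%:E)%E.
Proof.
rewrite (two_networks_marks_integral mNs mx mNt mu Hs_meas Ht_meas all_indep
  (mpsis a b) mpsit (psis01 a b) psit01).
rewrite EFinM; congr (_ * _)%E.
  under eq_integral do under eq_bigr do rewrite psis_mean.
  under eq_integral do rewrite -big_mkcond.
  apply: (poisson_laplace_functional sat_ppp (measurable_cap _ _) (measurable_dist _)
    (nu := nus)) => //.
under eq_integral do under eq_bigr do rewrite psit_mean.
under eq_integral do rewrite -big_mkcond.
exact: (poisson_laplace_functional ut_ppp (measurable_planar_disc _ e11 e22 e12 _)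
  (measurable_dist _) ut_distance_law measurable_ut_laplace ut_laplace01).
Qed.


(** The mean number of visible satellites within distance [a]; [sat_tail b] is the exponent due to
    the interferers beyond [b]. *)
Definition visible_mass (a : R) : R := fine (nus `]-oo, a]%classic).
Definition sat_tail (b : R) : R :=
  fine (\int[nus]_v (\1_`]b, +oo[ v * (1 - sat_laplace v))%:E)%E.

Let tail_ge0 b v : 0 <= \1_`]b, +oo[ v * (1 - sat_laplace v).
Proof.
by apply: mulr_ge0; rewrite ?indicE// subr_ge0; case/andP: (sat_laplace01 v).
Qed.

Let tail_le1 b v : \1_`]b, +oo[ v * (1 - sat_laplace v) <= 1.
Proof.
by case/andP: (sat_laplace01 v) => l0 l1; rewrite mulr_ile1// ?subr_ge0 ?gerBl.
Qed.

Let measurable_tail b : measurable_fun setT (fun v : R => \1_`]b, +oo[ v * (1 - sat_laplace v) : R).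
Proof.
apply: measurable_funM; first exact: measurable_indic.
by apply: measurable_funB => //; exact: measurable_sat_laplace.
Qed.

Let nus_integral_fin (f : R -> R) : measurable_fun setT f -> (forall v, 0 <= f v <= 1) ->
  (\int[nus]_v (f v)%:E \is a fin_num)%E.
Proof.
move=> mf f01; rewrite ge0_fin_numE; last first.
  by apply: integral_ge0 => v _; rewrite lee_fin; case/andP: (f01 v).
apply: (@le_lt_trans _ _ (\int[nus]_v (cst 1 v))%E).
  apply: ge0_le_integral => //.
  - by move=> v _; rewrite lee_fin; case/andP: (f01 v).
  - exact/measurable_EFinP.
  - by move=> v _; rewrite lee_fin; case/andP: (f01 v).
by rewrite integral_cst// mul1e -ge0_fin_numE// fin_num_measure.
Qed.

(** [1 - gs a b] is the indicator of [v <= a] plus the loss beyond [b]. In the exponential this sum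
    becomes a product: the void probability up to [a] times the transform of the interference beyond
    [b]. *)
Let integral_1Bgs a b : a <= b ->
  fine (\int[nus]_v (1 - gs a b v)%:E)%E = visible_mass a + sat_tail b.
Proof.
move=> ab.
rewrite /visible_mass /sat_tail -fineD; last 2 first.
- by rewrite fin_num_measure.
- by apply: nus_integral_fin => // v; rewrite tail_ge0 tail_le1.
congr fine.
have -> : (nus `]-oo, a]%classic = \int[nus]_v (\1_`]-oo, a] v)%:E)%E.
  by rewrite integral_indic// setIT.
rewrite -ge0_integralD//; last 3 first.
- by apply/measurable_EFinP; exact: measurable_indic.
- by move=> v _; rewrite lee_fin.
- exact/measurable_EFinP.
apply: eq_integral => v _; rewrite -EFinD; congr EFin.
rewrite /gs !indicE !mem_setE !in_itv/= andbT.
have [va|av] := leP v a; first by rewrite (ltNge b) (le_trans va ab)/= mul0r addr0 subr0.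
by have [vb|bv] := leP v b; rewrite ?mul0r ?mul1r ?add0r ?subrr.
Qed.

Local Notation E := (sat_visible p Ns x).
Local Notation X w := (D (x 0%N w)).
Local Notation Y b w := (expR (- s * interference p e1 e2 Ns x Hs Nt u Ht b w)).

Hypothesis x0_nearest : serving_is_nearest p Ns x.

Lemma interference_factor b w : Y b w = expR (- s * sigma2 p) *
  (\prod_(n < Ns w | x n w \in C `\` cap p b) expR (- sat_loss (D (x n w)) * Hs n w) *
   \prod_(k < Nt w | u k w \in A_ut) expR (- ut_loss (D (u k w)) * Ht k w)).
Proof.
rewrite -!expR_sum -!expRD; congr expR; rewrite /interference !mulrDr addrC; congr (_ + _).
rewrite !mulr_sumr; congr (_ + _); apply: eq_bigr => i _.
  by rewrite /sat_loss; ring.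
by rewrite /ut_loss; ring.
Qed.

Let Z_zero a b w n : (n < Ns w)%N -> x n w \in C -> D (x n w) <= a -> Z a b w = 0.
Proof.
move=> nN xC Da; rewrite /Z (bigD1 (Ordinal nN))//= {1}/psis/= xC Da.
by rewrite !mul0r.
Qed.

(** Only a visible satellite within [a] makes the product vanish; one between [a] and [b] has factor
    1, matching its absence from the interference beyond [b]. *)
Let Z_interference a b w :
  (forall n, (n < Ns w)%N -> x n w \in C -> a < D (x n w)) ->
  expR (- s * sigma2 p) * Z a b w = Y b w.
Proof.
move=> h; rewrite interference_factor /Z; congr (_ * (_ * _)).
  rewrite [RHS]big_mkcond/=; apply: eq_bigr => n _.
  rewrite /psis/= in_setD; case: ifPn => [xC|//].
  rewrite leNgt (h n)//=.
  have -> : (x n w \in cap p b) = (D (x n w) <= b).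
    apply/idP/idP => [/set_mem[]//|Db]; apply/mem_set; split => //.
    by case/set_mem: xC.
  by case: ifP => _ //; rewrite /damp/= (max_idPr (Hs_ge0 _ _)).
rewrite [RHS]big_mkcond/=; apply: eq_bigr => k _.
by rewrite /psit/=; case: ifP => _ //; rewrite /damp/= (max_idPr (Ht_ge0 _ _)).
Qed.

Let not_visible w n : ~ E w -> (n < Ns w)%N -> x n w \in C -> false.
Proof.
move=> nE nN xC; apply/negP => _; apply: nE.
by rewrite /sat_visible/= /npoints (bigD1 (Ordinal nN)).
Qed.

Let Z_bin a b w : a <= b ->
  expR (- s * sigma2 p) * (Z a b w - Z b b w) =
  \1_(E `&` (fun w => X w) @^-1` `]a, b]) w * Y b w.
Proof.
move=> ab; rewrite indicE mulrBr.
have [Ew|nEw] := pselect (E w); last first.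
  rewrite memNset ?mul0r; last by case.
  (* With no visible satellite the condition on distances is void, so [Z a b] and [Z b b]
     coincide. *)
  by rewrite !Z_interference ?subrr// => n nN /(not_visible nEw nN).
have [N0 x0C x0min] := x0_nearest Ew.
have x0C' : x 0%N w \in C by exact: mem_set.
have gt_all c : c < X w -> forall n, (n < Ns w)%N -> x n w \in C -> c < D (x n w).
  by move=> cX n nN /set_mem xC; exact: lt_le_trans (x0min _ nN xC).
have [Xa|aX] := leP (X w) a.
  rewrite (@Z_zero a b w 0%N N0 x0C' Xa) (@Z_zero b b w 0%N N0 x0C' (le_trans Xa ab)) subrr.
  by rewrite memNset ?mul0r//= in_itv/= ltNge Xa => -[].
have [Xb|bX] := leP (X w) b.
  rewrite (@Z_zero b b w 0%N N0 x0C' Xb) mulr0 subr0 Z_interference; last exact: gt_all.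
  by rewrite mem_set ?mul1r//; split => //=; rewrite in_itv/= aX.
rewrite !Z_interference ?subrr; [|exact: gt_all|exact: gt_all].
by rewrite memNset ?mul0r//= in_itv/= leNgt bX andbF => -[].
Qed.


Let Z01 a b w : 0 <= Z a b w <= 1.
Proof.
have p1 : 0 <= \prod_(j < Ns w) psis a b (x j w, Hs j w) <= 1.
  rewrite prodr_ge0/=; last by move=> j _; case/andP: (psis01 a b (x j w, Hs j w)).
  by apply: prodr_ile1 => j _; exact: psis01.
have p2 : 0 <= \prod_(k < Nt w) psit (u k w, Ht k w) <= 1.
  rewrite prodr_ge0/=; last by move=> j _; case/andP: (psit01 (u j w, Ht j w)).
  by apply: prodr_ile1 => j _; exact: psit01.
case/andP: p1 => ? ?; case/andP: p2 => ? ?.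
by rewrite /Z mulr_ge0//= mulr_ile1.
Qed.

Let mZ a b : measurable_fun setT (Z a b).
Proof.
apply: measurable_funM.
  apply: (measurable_random_prod (b := fun _ _ => true)
    (f := fun j w => psis a b (x j w, Hs j w))) => // n.
  by apply: (measurableT_comp (mpsis a b)); exact: measurable_fun_pair.
apply: (measurable_random_prod (b := fun _ _ => true)
  (f := fun j w => psit (u j w, Ht j w))) => // n.
by apply: (measurableT_comp mpsit); exact: measurable_fun_pair.
Qed.

Lemma measurable_sat_visible : measurable E.
Proof.
rewrite (_ : E = npoints Ns x C @^-1` [set k | (0 < k)%N])//.
rewrite -[S in measurable S]setTI; apply: measurable_npoints => //.
exact: measurable_cap.
Qed.

Lemma measurable_serving_distance : measurable_fun setT (fun w => X w).
Proof. exact: (measurableT_comp (measurable_dist _)). Qed.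

Lemma measurable_interference (r : T -> R) : measurable_fun setT r ->
  measurable_fun setT (fun w => Y (r w) w).
Proof.
move=> mr; apply: measurableT_comp => //; apply: measurable_funM => //.
have mDn (y : nat -> T -> R3 R) n : measurable_fun setT (y n) ->
    measurable_fun setT (fun w => D (y n w)).
  by move=> my; exact: (measurableT_comp (measurable_dist _)).
apply: measurable_funD => //; apply: measurable_funD.
  apply: (measurable_random_sum (b := fun n w => x n w \in C `\` cap p (r w))
    (f := fun n w => gain_sat p * P_s p * Hs n w * D (x n w) `^ (- alpha_s p))) => // n.
    apply: (@measurable_fun_bool _ _ _ _ true); rewrite setTI.
    rewrite (_ : _ @^-1` _ = x n @^-1` C `&` [set w | r w < D (x n w)]).
      apply: measurableI.
        by rewrite -[S in measurable S]setTI; apply: mx => //; exact: measurable_cap.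
      rewrite (_ : [set w | _] = (fun w => r w < D (x n w)) @^-1` [set true])//.
      by rewrite -[S in measurable S]setTI; apply: measurable_fun_ltr => //; exact: mDn.
    apply/seteqP; split=> w.
      move=> /set_mem[[xR xC] nc]; split=> //=; rewrite ltNge; apply/negP => xr.
      exact: nc.
    by move=> [xC /= rD]; apply/mem_set; split => // -[_]; rewrite leNgt rD.
  apply: measurable_funM; first exact: measurable_funM.
  by apply: (measurableT_comp (measurable_powR _)); exact: mDn.
apply: (measurable_random_sum (b := fun n w => u n w \in A_ut)
  (f := fun n w => gain_ut p * P_ut p * Ht n w * D (u n w) `^ (- alpha_t p))) => // n.
  by apply: measurable_mem => //; exact: measurable_planar_disc.
apply: measurable_funM; first exact: measurable_funM.
by apply: (measurableT_comp (measurable_powR _)); exact: mDn.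
Qed.

Lemma interference_ge0 b w : 0 <= interference p e1 e2 Ns x Hs Nt u Ht b w.
Proof.
case: p_admissible => *; rewrite /interference /gain_sat /gain_ut.
rewrite addr_ge0//; last exact: ltW.
rewrite addr_ge0//; apply: sumr_ge0 => n _; apply: mulr_ge0; rewrite ?powR_ge0//;
  apply: mulr_ge0 => //; apply: mulr_ge0; try exact: ltW;
  apply: mulr_ge0; rewrite ?sqr_ge0//; apply: mulr_ge0; exact: ltW.
Qed.

Lemma interference_exp01 b w : 0 <= Y b w <= 1.
Proof.
rewrite expR_ge0/= -expR0 ler_expR mulNr oppr_le0 mulr_ge0//.
exact: interference_ge0.
Qed.

(** The conditional transform extended to all real [b]. Unlike the formula it is handled on the
    whole line, where continuity has no boundary cases; the two agree from [R_min p] on. *)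
Definition laplace_tail (b : R) : R :=
  expR (- s * sigma2 p) * Lt * expR (- sat_tail b).

(** [Z a b] and [Z b b] have the same expected factors beyond [b] and from the terrestrial users.
    Their difference leaves a difference of void probabilities, which is the probability of the
    bin. *)
Lemma bin_integral a b : a <= b ->
  (\int[P]_(w in E `&` (fun w => X w) @^-1` `]a, b]) (Y b w)%:E =
   ((expR (- visible_mass a) - expR (- visible_mass b)) * laplace_tail b)%:E)%E.
Proof.
move=> ab; rewrite -[S in integral _ S _]setTI -integral_indicM.
under eq_integral do rewrite -Z_bin//.
transitivity ((expR (- s * sigma2 p))%:E *
    (\int[P]_w (Z a b w)%:E - \int[P]_w (Z b b w)%:E))%E.
  rewrite -integralB_EFin//; last 2 first.
  - by apply: integrable01.
  - by apply: integrable01.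
  rewrite -integralZl//.
  by apply: integrableB => //; exact: integrable01.
rewrite !expectation_Z !integral_1Bgs// -EFinB -EFinM; congr EFin.
rewrite /laplace_tail !opprD !expRD; move: Lt (expR _) => l q; ring.
Qed.


(** There are finitely many satellites and the caps are closed, so a slight increase of the radius
    captures none of those strictly farther than [X w]. *)
Lemma interference_right_constant w : E w ->
  \forall b \near (X w)^'+, Y b w = Y (X w) w.
Proof.
move=> Ew.
have fin : \forall b \near (X w)^'+, forall n : 'I_(Ns w),
    (D (x n w) <= b) = (D (x n w) <= X w).
  apply: filter_forall => n.
  have [DX|XD] := leP (D (x n w)) (X w); near=> b.
    by apply: (le_trans DX); near: b; exact: nbhs_right_ge.
  by apply/negbTE; rewrite -ltNge; near: b; exact: nbhs_right_lt.
apply: filterS fin => b Db; congr (expR (_ * _)); rewrite /interference.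
congr (_ + _ + _); apply: eq_bigl => n.
have [xC|xC] := boolP (x n w \in C); last by rewrite !in_setD (negbTE xC).
rewrite !in_setD xC /=; congr (~~ _).
have capE c : (x n w \in cap p c) = (D (x n w) <= c).
  apply/idP/idP => [/set_mem[]//|Dc]; apply/mem_set; split => //.
  by case/set_mem: xC.
by rewrite !capE Db.
Unshelve. all: by end_near. Qed.

Let sat_tail_ge0 b : 0 <= sat_tail b.
Proof. by apply: fine_ge0; apply: integral_ge0 => v _; rewrite lee_fin. Qed.

(** The difference is the integral over []b, c]] of [1 - sat_laplace], which lies between 0 and
    1. *)
Lemma sat_tail_sub b c : b <= c ->
  0 <= sat_tail b - sat_tail c <= fine (nus `]b, c]%classic).
Proof.
move=> bc.
pose f v := \1_`]b, c] v * (1 - sat_laplace v).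
have l01 v : 0 <= 1 - sat_laplace v <= 1.
  by case/andP: (sat_laplace01 v) => l0 l1; rewrite subr_ge0 l1 gerBl.
have f01 v : 0 <= f v <= 1.
  rewrite /f indicE; case: (_ \in _); rewrite ?mul1r// mul0r lexx ler01//.
have mf : measurable_fun setT f.
  apply: measurable_funM; first exact: measurable_indic.
  by apply: measurable_funB => //; exact: measurable_sat_laplace.
have t01 e v : 0 <= \1_`]e, +oo[ v * (1 - sat_laplace v) <= 1.
  by rewrite tail_ge0 tail_le1.
have -> : sat_tail b = fine (\int[nus]_v (f v)%:E)%E + sat_tail c.
  rewrite /sat_tail -fineD; [|exact: nus_integral_fin|exact: nus_integral_fin].
  congr fine; rewrite -ge0_integralD//; last 4 first.
  - by move=> v _; rewrite lee_fin; case/andP: (f01 v).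
  - exact/measurable_EFinP.
  - by move=> v _; rewrite lee_fin.
  - exact/measurable_EFinP.
  apply: eq_integral => v _; rewrite -EFinD; congr EFin.
  rewrite /f -mulrDl; congr (_ * _); rewrite !indicE !mem_setE !in_itv/= !andbT.
  have [vc|cv] := leP v c; first by rewrite andbT addr0.
  by rewrite andbF add0r (le_lt_trans bc cv).
have f0 : (0 <= \int[nus]_v (f v)%:E)%E.
  by apply: integral_ge0 => v _; rewrite lee_fin; case/andP: (f01 v).
rewrite addrK fine_ge0//= -lee_fin fineK; last exact: nus_integral_fin.
rewrite fineK ?fin_num_measure// -[leRHS]mul1e -integral_cst//.
rewrite integral_indicM setTI.
apply: ge0_le_integral => //.
- by move=> v _; rewrite lee_fin; case/andP: (l01 v).
- apply/measurable_EFinP; apply: measurable_funTS.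
  by apply: measurable_funB => //; exact: measurable_sat_laplace.
- by move=> v _; rewrite lee_fin; case/andP: (l01 v).
Qed.

Lemma laplace_tail01 b : 0 <= laplace_tail b <= 1.
Proof.
have expN01 (y : R) : 0 <= y -> 0 <= expR (- y) <= 1.
  by move=> y0; rewrite expR_ge0/= -expR0 ler_expR oppr_le0.
have /andP[? ?] := expN01 _ (sat_tail_ge0 b).
have /andP[? ?] : 0 <= expR (- s * sigma2 p) <= 1.
  by rewrite mulNr expN01// mulr_ge0// ltW// sigma2_gt0.
have /andP[? ?] : 0 <= Lt <= 1.
  rewrite expN01// fine_ge0// integral_ge0// => v _.
  by rewrite lee_fin subr_ge0; case/andP: (ut_laplace01 v).
by rewrite /laplace_tail !mulr_ge0//= mulr_ile1// ?mulr_ge0// mulr_ile1.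
Qed.


Lemma continuous_laplace_tail (K : R) : 0 <= K ->
  (forall b c, b <= c -> fine (nus `]b, c]%classic) <= K * (c - b)) ->
  continuous laplace_tail.
Proof.
move=> K0 nusK.
have ctail : continuous sat_tail.
  apply: (Lipschitz_continuous K0) => b c bc.
  by have /andP[h1 h2] := sat_tail_sub bc; rewrite ger0_norm// (le_trans h2)// nusK.
move=> b; apply: cvgM; first exact: cvg_cst.
by apply: (cvg_comp _ _ (cvgN (ctail b))); exact: continuous_expR.
Qed.

Lemma laplace_tailE (b : R) :
  (forall f : R -> R, measurable_fun setT f -> (forall v, 0 <= f v) ->
    fine (\int[nus]_v (f v)%:E)%E =
    2 * pi * lambda_tilde p * \int[lebesgue_measure]_(v in `[R_min p, R_max p]) (f v * v)) ->
  (forall f : R -> R, measurable_fun setT f -> (forall v, 0 <= f v) ->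
    fine (\int[nut]_v (f v)%:E)%E =
    2 * pi * lambda_ut p * \int[lebesgue_measure]_(v in `[0, R_ut p]) (f v * v)) ->
  R_min p <= b -> laplace_tail b = cond_laplace_formula p s b.
Proof.
move=> nusE nutE minb; rewrite /laplace_tail /Lt /sat_tail -!expRD.
have mut : measurable_fun setT (fun v : R => 1 - ut_laplace v : R).
  by apply: measurable_funB => //; exact: measurable_ut_laplace.
have ut0 (v : R) : 0 <= 1 - ut_laplace v by rewrite subr_ge0; case/andP: (ut_laplace01 v).
have := nusE _ (measurable_tail b) (tail_ge0 b); rewrite /= => ->.
have := nutE _ mut ut0; rewrite /= => ->.
congr expR; rewrite addrAC; congr (_ - _ * _ - _); rewrite /Rintegral; congr fine.
(* The formula's interval is closed at [b], whereas interferers lie strictly beyond [b]; the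
   endpoint is negligible. *)
rewrite -[RHS]integral_itv_obnd_cbnd; last first.
  apply: measurable_funTS; apply/measurable_EFinP; apply: measurable_funM => //.
  by apply: measurable_funB => //; exact: measurable_sat_laplace.
transitivity (\int[lebesgue_measure]_(v in `[R_min p, R_max p])
    (\1_`]b, +oo[ v * ((1 - sat_laplace v) * v))%:E)%E.
  by apply: eq_integral => v _; rewrite mulrA.
rewrite integral_indicM; congr (integral _ _ _); apply/seteqP; split=> v /=.
  by rewrite !in_itv/= andbT => -[/andP[_ ->] ->].
by rewrite !in_itv/= andbT => /andP[bv ->]; rewrite bv (le_trans minb (ltW bv)).
Qed.

(** At [s = 0] both the integrand and [laplace_tail] are 1, so [bin_integral] reads off the
    probability of the bin. *)
Lemma bin_probability (a b : R) : s = 0 -> a <= b ->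
  P (E `&` (fun w => X w) @^-1` `]a, b]) =
  (expR (- visible_mass a) - expR (- visible_mass b))%:E.
Proof.
move=> s0 ab.
have sat1 v : sat_laplace v = 1.
  rewrite -(sat_mean 0) /mark_mean /damp/=.
  transitivity (fine (\int[P]_w (cst 1 w))%E).
    by congr fine; apply: eq_integral => w _; rewrite /sat_loss s0 !mul0r oppr0 mul0r expR0.
  by rewrite integral_cst// [Q in (_ * Q)%E]probability_setT mule1.
have ut1 v : ut_laplace v = 1 by rewrite /ut_laplace /ut_loss s0 !mul0r addr0 powR1.
have tail1 : laplace_tail b = 1.
  rewrite /laplace_tail /Lt /sat_tail !integral0_eq/= ?oppr0 ?expR0 ?s0 ?mul0r.
  - by rewrite oppr0 mul0r expR0 !mulr1.
  - by move=> v _; rewrite ?ut1 ?sat1 subrr ?mulr0.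
  - by move=> v _; rewrite ?ut1 ?sat1 subrr ?mulr0.
have := bin_integral ab; rewrite tail1 mulr1 => <-.
rewrite (eq_integral (cst 1%E)); last by move=> w _; rewrite s0 oppr0 mul0r expR0.
rewrite integral_cst ?mul1e//; apply: measurableI; first exact: measurable_sat_visible.
by rewrite -[Q in measurable Q]setTI; exact: measurable_serving_distance.
Qed.

End conditional_laplace.

Theorem lemma8
    (R : realType) (d : measure_display) (T : measurableType d)
    (P : probability T R)
    (p : system R) (p_admissible : admissible p)
    (* an orthonormal frame of the plane of the terrestrial disc *)
    (e1 e2 : R3 R)
    (e1_unit : dot e1 e1 = 1) (e2_unit : dot e2 e2 = 1) (e12_orth : dot e1 e2 = 0)
    (* satellites, their fading powers; terrestrial users, their fading powers *)
    (Ns : T -> nat) (x : nat -> T -> R3 R) (Hs : nat -> T -> R)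
    (Nt : T -> nat) (u : nat -> T -> R3 R) (Ht : nat -> T -> R)
    (sat_ppp : poisson_process P Ns x (sat_intensity p))
    (ut_ppp : poisson_process P Nt u (ut_intensity p e1 e2))
    (Hs_meas : forall n, measurable_fun setT (Hs n))
    (Ht_meas : forall k, measurable_fun setT (Ht k))
    (Hs_ge0 : forall n w, 0 <= Hs n w)
    (Ht_ge0 : forall k w, 0 <= Ht k w)
    (Hs_law : forall n, has_pdf_on_pos P (fun w => Num.sqrt (Hs n w))
                          (shadowed_rician_pdf (b_s p) (Omega_s p) (m_s p)))
    (Ht_law : forall k, has_pdf_on_pos P (fun w => Num.sqrt (Ht k w))
                          (nakagami_pdf (m_t p)))
    (all_indep : mutually_independent P (source_events Ns x Hs Nt u Ht))
    (x0_nearest : serving_is_nearest p Ns x)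
    (s : R) (s_ge0 : 0 <= s) :
  let E := sat_visible p Ns x in
  let X w := dist (x 0%N w) (u1 p) in
  let Y w := expR (- s * interference p e1 e2 Ns x Hs Nt u Ht (X w) w) in
  cond_expectation_version P E X Y `[R_min p, R_max p]
    (cond_laplace_formula p s)
  /\ forall r : R, R_min p <= r <= R_max p ->
       cond_expectation_at P E X Y r (cond_laplace_formula p s r).
Proof.
move=> E X Y.
have lo0 := ltW (R_min_gt0 p_admissible).
have minmax := R_min_lt_R_max p_admissible.
have hi0 : 0 <= R_max p by exact: le_trans lo0 (ltW minmax).
have pi2 : 0 < 2 * pi :> R by rewrite mulr_gt0// pi_gt0.
have ls_gt0 : 0 < 2 * pi * lambda_tilde p.
  case: p_admissible => Rus0 RusRs *; rewrite mulr_gt0// mulr_gt0// divr_gt0//.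
  exact: lt_trans RusRs.
have lt_ge0 : 0 <= 2 * pi * lambda_ut p.
  by case: p_admissible => *; apply: mulr_ge0; exact: ltW.
pose nus := radial_measure (R_max p) (ltW ls_gt0) lo0.
pose nut := radial_measure (R_ut p) lt_ge0 (lexx 0).
have satE A : measurable A -> sat_intensity p
    (cap p (R_max p) `&` (fun y => dist y (u1 p)) @^-1` A) = nus A.
  by move=> mA; exact: sat_intensity_radial.
have utE A : measurable A -> ut_intensity p e1 e2
    (planar_disc (u1 p) e1 e2 (R_ut p) `&` (fun y => dist y (u1 p)) @^-1` A) = nut A.
  by move=> mA; exact: ut_intensity_radial.
pose G := laplace_tail p s nus nut.
have cG : continuous G.
  apply: (continuous_laplace_tail p_admissible Hs_meas Hs_ge0 Hs_law s_ge0
    (mulr_ge0 (ltW ls_gt0) hi0)) => b c bc.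
  exact: radial_measure_itv_le.
have G01 b : 0 <= G b <= 1.
  exact: (laplace_tail01 p_admissible Hs_meas Ht_meas Hs_ge0 Ht_ge0 Hs_law Ht_law s_ge0).
have GE b : R_min p <= b -> G b = cond_laplace_formula p s b.
  apply: (laplace_tailE p_admissible Hs_meas Ht_meas Hs_ge0 Ht_ge0 Hs_law Ht_law s_ge0).
    by move=> f mf f0; exact: fine_integral_radial_measure.
  by move=> f mf f0; exact: fine_integral_radial_measure.
have mE : measurable E by exact: measurable_sat_visible sat_ppp.
have mX : measurable_fun setT X by exact: measurable_serving_distance sat_ppp.
(* [bin_probability] is instantiated at 0, whatever the Laplace variable of the theorem. *)
have PX (a b : R) : a <= b -> P (E `&` X @^-1` `]a, b]) =
    (expR (- visible_mass nus a) - expR (- visible_mass nus b))%:E.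
  exact: (bin_probability p_admissible e1_unit e2_unit e12_orth sat_ppp ut_ppp Hs_meas
    Ht_meas Hs_ge0 Ht_ge0 Hs_law Ht_law all_indep (lexx 0) satE utE x0_nearest).
pose Yb b w := expR (- s * interference p e1 e2 Ns x Hs Nt u Ht b w).
have mYb (r : T -> R) : measurable_fun setT r -> measurable_fun setT (fun w => Yb (r w) w).
  exact: (measurable_interference e1_unit e2_unit e12_orth sat_ppp ut_ppp Hs_meas Ht_meas).
have Yb01 b w : 0 <= Yb b w <= 1.
  exact: interference_exp01.
have main B : measurable B -> (\int[P]_(w in E `&` X @^-1` B) (Y w)%:E =
    \int[P]_(w in E `&` X @^-1` B) (G (X w))%:E)%E.
  apply: (disintegration_of_bins mE mX mYb Yb01) => //.
    by move=> w; exact: interference_right_constant.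
  move=> a b ab; rewrite PX// -EFinM mulrC.
  exact: (bin_integral p_admissible e1_unit e2_unit e12_orth sat_ppp ut_ppp Hs_meas
    Ht_meas Hs_ge0 Ht_ge0 Hs_law Ht_law all_indep s_ge0 satE utE x0_nearest).
have XE w : E w -> R_min p <= X w <= R_max p.
  by case/x0_nearest => _ [xR Xmax] _; rewrite Xmax andbT R_min_le_dist.
split.
- split.
  + apply: integrable01 => //; [exact: mYb|by move=> w; exact: Yb01].
  + apply: (eq_measurable_fun G); last first.
      by apply: measurable_funTS; exact: continuous_measurable_fun.
    by move=> b /set_mem; rewrite /= in_itv/= => /andP[/GE].
  + rewrite (_ : E `&` _ = set0) ?measure0// -subset0 => w [Ew] /=.
    by rewrite in_itv/= XE.
  + move=> B mB BD; rewrite main//; apply: eq_integral => w /set_mem[Ew _].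
    by rewrite GE//; case/andP: (XE w Ew).
- move=> r /andP[minr rmax]; rewrite -GE//.
  apply: cond_expectation_at_continuous => // e e0.
  (* A bin inside both the ball and the range of distances; when [r] is an extreme distance it lies
     on one side of [r]. Half of [e] is taken since the bin contains its right end while the ball is
     open. *)
  pose a := Num.max (R_min p) (r - e / 2); pose b := Num.min (R_max p) (r + e / 2).
  have e20 : 0 < e / 2 by rewrite divr_gt0.
  have ab : a < b.
    rewrite /a /b lt_min !gt_max minmax /=.
    by apply/andP; split; [|apply/andP; split]; lra.
  apply: (@lt_le_trans _ _ (P (E `&` X @^-1` `]a, b]))); last first.
    apply: le_measure; rewrite ?inE.
    - by apply: measurableI => //; rewrite -[Q in measurable Q]setTI; exact: mX.
    - apply: measurableI => //; rewrite -[Q in measurable Q]setTI; apply: mX => //.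
      exact: measurable_ball.
    - apply: setIS => w; rewrite /= in_itv/= /a /b gt_max le_min /ball/=.
      by move=> /andP[/andP[_ h1] /andP[_ h2]]; rewrite ltr_distl; apply/andP; split; lra.
  have mina : R_min p <= a by rewrite le_max lexx.
  have bmax : b <= R_max p by rewrite ge_min lexx.
  (* Between the extreme distances the mean number of satellites is quadratic in the distance, hence
     strictly increasing, so the bin has positive probability. *)
  have massE c : R_min p <= c -> c <= R_max p -> visible_mass nus c =
      2 * pi * lambda_tilde p * (c ^+ 2 - R_min p ^+ 2) / 2.
    move=> minc cmax; rewrite /visible_mass radial_measure_lray ?(ltW minmax)//.
    by rewrite ltNge minc /= (min_idPl cmax).
  rewrite PX ?(ltW ab)// lte_fin subr_gt0 ltr_expR ltrN2.
  rewrite !massE//; [|exact: le_trans mina (ltW ab)|exact: le_trans (ltW ab) bmax].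
  rewrite ltr_pM2r ?invr_gt0// ltr_pM2l// ltrD2r ltr_pXn2r// nnegrE.
    exact: le_trans lo0 mina.
  by apply: le_trans lo0 (le_trans mina (ltW ab)).
Qed.
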